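(* Let $K$ be a field of characteristic $\neq 2,3$ with algebraic closure $\overline K$. A Picard curve $Y$ over $K$ is special if and only if it is isomorphic over $\overline K$ to the curve $$Y_0:\; y^3=x^4-1 .$$
   Context: Curves given by an affine equation are identified with the smooth projective curve with the same function field. A Picard curve $Y$ over $K$ is a smooth projective curve of genus $3$ over $K$ such that $Y_{\overline K}=Y\otimes_K\overline K$ admits a morphism to $\mathbb P^1_{\overline K}$ that is a Galois cover of degree $3$. Such a morphism corresponds to a subgroup $G\subset \mathrm{Aut}_{\overline K}(Y_{\overline K})$ of order $3$ such that $Y_{\overline K}/G$ has genus $0$; such a $G$ is called a distinguished subgroup of automorphisms. A Picard curve $Y$ over $K$ is special if $Y_{\overline K}$ has more than one distinguished subgroup of automorphisms. *)

(* Defs.v *)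
From HB Require Import structures.
From mathcomp Require Import all_boot all_order all_algebra all_field.
From mathcomp Require Import boolp classical_sets functions cardinality.

Set Implicit Arguments.
Unset Strict Implicit.
Unset Printing Implicit Defensive.

Import GRing.Theory.

Local Open Scope classical_set_scope.
Local Open Scope ring_scope.

(** * Curves and their function fields

    Regular projective integral curves over a field [k] and finite morphisms
    are encoded through the (anti-)equivalence with function fields of one
    variable over [k] and [k]-embeddings: a curve is its function field with
    the embedding of the constants, its closed points are the valuation rings
    of the field over [k] (each point being identified with its local ring),
    and a finite morphism is written as its pullback on functions.
    Smoothness, which is stronger than regularity over an imperfect [k], is
    [smooth] below. *)

(** [F] is a finite extension of [k(x)] for some transcendental [x]; the
    denominators are cleared in the second clause. *)
Definition function_field_axiom (k F : fieldType) (e : {rmorphism k -> F}) :=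
  exists (x : F) (n : nat) (b : 'I_n -> F),
    ~ algebraicOver e x /\
    forall z : F, exists (q : {poly k}) (p : 'I_n -> {poly k}),
      q != 0 /\
      (map_poly e q).[x] * z = \sum_(i < n) (map_poly e (p i)).[x] * b i.

Record curve (k : fieldType) := Curve {
  function_field :> fieldType;
  const : {rmorphism k -> function_field};
  curveP : function_field_axiom const
}.

Arguments const {k} C : rename.

Section Genus.
Variables (k : fieldType) (C : curve k).

Record is_point (O : set C) : Prop := IsPoint {
  point_const : forall c : k, O (const C c);
  point_sub : forall a b, O a -> O b -> O (a - b);
  point_mul : forall a b, O a -> O b -> O (a * b);
  point_val : forall a, O a \/ O a^-1;
  point_proper : exists a, ~ O a
}.

(** Repartitions (Weil, Serre); only the values at points matter. *)
Definition repartition (r : set C -> C) : Prop :=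
  finite_set [set O : set C | is_point O /\ ~ O (r O)].

(** The genus is the [k]-dimension of [H^1(C, O_C)], i.e. of the quotient of
    the space of repartitions by the sum of the subspace of everywhere regular
    repartitions and the subspace of constant repartitions [fun _ => f]; the
    family [r] below is a basis of this quotient. *)
Definition has_genus (g : nat) : Prop :=
  exists r : 'I_g -> set C -> C,
    (forall i, repartition (r i)) /\
    forall a, repartition a ->
      exists! c : 'rV[k]_g, exists f : C, forall O, is_point O ->
        O (a O - \sum_(i < g) const C (c 0 i) * r i O - f).

End Genus.

Section Morphisms.
Variable k : fieldType.

(** [f] is the pullback of a finite morphism [C -> D] over [k]. *)
Definition pullback (C D : curve k) (f : {rmorphism D -> C}) : Prop :=
  forall c : k, f (const D c) = const C c.

Definition isomorphic (C D : curve k) : Prop :=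
  exists f : {rmorphism D -> C}, pullback f /\ bijective f.

(** [Aut_k(C)], acting on functions by pullback. Composition is reversed, so
    that it has the same subgroups. *)
Definition Aut_curve (C : curve k) : set (C -> C) :=
  [set s | exists f : {rmorphism C -> C},
     [/\ pullback f, bijective f & s = f :> (C -> C)]].

Record is_subgroup (C : curve k) (G : set (C -> C)) : Prop := IsSubgroup {
  subgroup_aut : forall s, G s -> Aut_curve s;
  subgroup_id : G id;
  subgroup_comp : forall s t, G s -> G t -> G (s \o t);
  subgroup_inv : forall s t, G s -> cancel s t -> cancel t s -> G t
}.

(** [Q] is the quotient curve [C / G], with quotient morphism [C -> Q] of
    pullback [f]: the function field of [C / G] is the fixed field of [G]. *)
Definition is_quotient (C : curve k) (G : set (C -> C))
    (Q : curve k) (f : {rmorphism Q -> C}) : Prop :=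
  pullback f /\ range f = [set z | forall s, G s -> s z = z].

Definition has_degree (C D : curve k) (f : {rmorphism D -> C}) (n : nat) :=
  exists b : 'I_n -> C, forall z : C,
    exists! c : 'rV[D]_n, z = \sum_(i < n) f (c 0 i) * b i.

(** The function field of [C] is a Galois extension of that of [D]: its
    automorphisms over the latter have no further fixed elements. *)
Definition is_galois (C D : curve k) (f : {rmorphism D -> C}) : Prop :=
  forall z : C,
    (forall s, Aut_curve s -> (forall w, s (f w) = f w) -> s z = z) ->
    exists w, z = f w.

End Morphisms.

(** * The projective line *)

Section ProjectiveLine.
Variable k : fieldType.

Definition P1_const : {rmorphism k -> {fraction {poly k}}} :=
  (@tofrac {poly k} \o polyC : {rmorphism _ -> _}).

Lemma P1_horner (p : {poly k}) :
  (map_poly P1_const p).[tofrac 'X] = tofrac p.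
Proof.
by rewrite /P1_const map_poly_comp horner_map -[_.[_]]/(p \Po 'X) comp_polyXr.
Qed.

Lemma P1_transcendental : ~ algebraicOver P1_const (tofrac 'X).
Proof.
by case=> p p0; rewrite /root P1_horner tofrac_eq0; apply/negP.
Qed.

Lemma P1_fraction (z : {fraction {poly k}}) :
  exists p q : {poly k}, q != 0 /\ tofrac q * z = tofrac p.
Proof.
elim/quotW: z => r; exists (frac r).1, (frac r).2.
split; first exact: denom_ratioP.
by rewrite !piE; apply/eqmodP; rewrite /= FracField.equivfE
  !numden_Ratio ?mulr1 ?mul1r ?oner_neq0 ?denom_ratioP // mulrC.
Qed.

Lemma P1_function_field : function_field_axiom P1_const.
Proof.
exists (tofrac 'X), 1%N, (fun=> 1); split; first exact: P1_transcendental.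
move=> z; have [p [q [q0 qz]]] := P1_fraction z.
by exists q, (fun=> p); rewrite q0 big_ord1 mulr1 !P1_horner.
Qed.

Definition P1 : curve k := Curve P1_function_field.

End ProjectiveLine.

(** * The curve [y^3 = x^4 - 1] *)

Lemma simple_extension_function_field (k L : fieldType) (e : {rmorphism k -> L})
    (x : L) (h : {poly L}) (hI : monic_irreducible_poly h) :
  ~ algebraicOver e x ->
  (forall z : L, exists p q : {poly k},
    q != 0 /\ (map_poly e q).[x] * z = (map_poly e p).[x]) ->
  function_field_axiom
    (qpolyC h \o e : {rmorphism k -> {poly %/ h with hI}}).
Proof.
move=> xtr frac; pose N := (size h).-1.
have mkE : mk_monic h = h by exact: mk_monicE.
have hN : size h = N.+1 by rewrite prednK // (ltn_trans _ (hI.1.1)).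
exists (qpolyC h x : {poly %/ h with hI}), N, (fun i => (in_qpoly h 'X^i)).
have horner (p : {poly k}) :
    (map_poly (qpolyC h \o e : {rmorphism k -> {poly %/ h with hI}}) p).[qpolyC h x]
    = qpolyC h (map_poly e p).[x].
  by rewrite map_poly_comp horner_map.
split=> [[p p0]|z].
  rewrite /root horner => /eqP px0; apply: xtr; exists p => //.
  rewrite /root -polyC_eq0; apply/eqP.
  exact: (congr1 (fun r : {poly %/ h} => val r) px0).
pose c i := frac (val z)`_i.
pose n i := projT1 (cid (c i)).
pose d i := projT1 (cid (projT2 (cid (c i)))).
have dP i : d i != 0 /\
    (map_poly e (d i)).[x] * (val z)`_i = (map_poly e (n i)).[x].
  exact: projT2 (cid (projT2 (cid (c i)))).
exists (\prod_(i < N) d i),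
  (fun i : 'I_N => n i * \prod_(j < N | j != i) d j).
split; first by apply/prodf_neq0 => i _; case: (dP i).
have zE : z = \sum_(i < N) qpolyC h (val z)`_i * in_qpoly h 'X^i.
  have zs : (size (val z) <= N)%N.
    have zlt : (size (val z) < size (mk_monic h))%N by exact: size_mk_monic.
    by rewrite -ltnS; apply: (leq_trans zlt); rewrite mkE hN.
  have small (p : {poly L}) : (size p <= N)%N -> val (in_qpoly h p) = p.
    by move=> ps; apply: in_qpoly_small; rewrite mkE hN ltnS.
  have inC a : in_qpoly h a%:P = qpolyC h a.
    apply: val_inj; rewrite small // size_polyC.
    by have := hI.1.1; rewrite hN ltnS; case: eqP.
  have zE : z = in_qpoly h (\sum_(i < N) (val z)`_i *: 'X^i).
    apply: val_inj; rewrite -poly_def small ?size_poly //.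
    apply/polyP => i; rewrite coef_poly.
    by case: ltnP => // i3; rewrite nth_default // (leq_trans zs).
  rewrite [in LHS]zE raddf_sum /=; apply: eq_bigr => i _.
  by rewrite -mul_polyC -inC; exact: (@in_qpolyM L h ((val z)`_i)%:P 'X^i).
rewrite [in LHS]zE mulr_sumr; apply: eq_bigr => i _.
rewrite !horner mulrA; congr (_ * _).
have -> : qpolyC h (map_poly e (\prod_(i0 < N) d i0)).[x] * qpolyC h (val z)`_i
  = qpolyC h ((map_poly e (\prod_(i0 < N) d i0)).[x] * (val z)`_i).
  by rewrite rmorphM.
congr (qpolyC h _); rewrite (bigD1 i) //=.
by rewrite ![map_poly e (_ * _)]rmorphM !hornerM mulrAC (proj2 (dP i)).
Qed.

Section Y0.
Variable k : fieldType.

(** [y^3 - (x^4 - 1)], as a polynomial in [y] over [k(x)]. *)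
Definition Y0_poly : {poly {fraction {poly k}}} :=
  'X^3 - (tofrac ('X^4 - 1))%:P.

Lemma size_Y0_poly : size Y0_poly = 4%N.
Proof. by rewrite size_XnsubC. Qed.

Lemma Y0_poly_irr : monic_irreducible_poly Y0_poly.
Proof.
split; last exact: monicXnsubC.
apply: cubic_irreducible; first by rewrite size_Y0_poly.
move=> x; apply/negP; rewrite /root !hornerE subr_eq0 => /eqP x3.
have [p [q [q0 qx]]] := P1_fraction x.
have: tofrac (q ^+ 3 * ('X^4 - 1)) = tofrac (p ^+ 3).
  by rewrite tofracM !tofracXn -qx exprMn x3.
move/eqP; rewrite tofrac_eq => /eqP /(congr1 (fun r : {poly k} => (size r).-1)).
have q3 : q ^+ 3 != 0 by rewrite expf_neq0.
rewrite -polyC1 size_Mmonic ?monicXnsubC // size_XnsubC // size_exp.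
move: (size_exp q 3); rewrite -size_poly_gt0 in q3.
case: (size _) q3 => // m _ /= ->; rewrite addnS /= => /(congr1 (modn^~ 3)).
by rewrite -modnDml !modnMl.
Qed.

Definition Y0_const : {rmorphism k -> {poly %/ Y0_poly with Y0_poly_irr}} :=
  (qpolyC Y0_poly \o P1_const k : {rmorphism _ -> _}).

Lemma Y0_function_field : function_field_axiom Y0_const.
Proof.
apply: (@simple_extension_function_field _ _ _ (tofrac 'X)).
  exact: P1_transcendental.
move=> z; have [p [q [q0 qz]]] := P1_fraction z.
by exists p, q; rewrite !P1_horner.
Qed.

(** The field [k(x)[y]/(y^3 - (x^4 - 1))]. *)
Definition Y0 : curve k := Curve Y0_function_field.

End Y0.

(** * Base change to an algebraic closure *)

Section BaseChange.
Variables (K : fieldType) (Kbar : closedFieldType) (iota : {rmorphism K -> Kbar}).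

Definition algebraic_closure : Prop := forall u : Kbar, algebraicOver iota u.

(** The datum identifying [Ybar] with the base change to [Kbar] of the curve
    [Y], provided that the latter is geometrically integral: the function field
    of [Ybar] is [K(Y) \otimes_K Kbar], which is already a field since [Kbar]
    is algebraic over [K]. The last two clauses say that the natural map from
    this tensor product is onto and injective. *)
Record base_change (Y : curve K) (Ybar : curve Kbar) := BaseChange {
  bc_map :> {rmorphism Y -> Ybar};
  bc_const : forall c : K, bc_map (const Y c) = const Ybar (iota c);
  bc_onto : forall z : Ybar, exists (n : nat) (c : 'I_n -> Kbar) (a : 'I_n -> Y),
    z = \sum_(i < n) const Ybar (c i) * bc_map (a i);
  bc_inj : forall (n : nat) (a : 'I_n -> Y),
    (forall c : 'I_n -> K,
       \sum_(i < n) const Y (c i) * a i = 0 -> forall i, c i = 0) ->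
    forall c : 'I_n -> Kbar,
      \sum_(i < n) const Ybar (c i) * bc_map (a i) = 0 -> forall i, c i = 0
}.

Variables (Y : curve K) (Ybar : curve Kbar) (j : base_change Y Ybar).

(** [O \otimes_K Kbar], as a subring of the function field of [Ybar]. *)
Definition point_extension (O : set Y) : set Ybar :=
  [set z | exists (n : nat) (c : 'I_n -> Kbar) (a : 'I_n -> Y),
     (forall i, O (a i)) /\ z = \sum_(i < n) const Ybar (c i) * j (a i)].

(** [Y] is smooth when [Y_Kbar] is regular, i.e. (in dimension 1) normal: its
    semi-local ring above each closed point of [Y] is integrally closed. *)
Definition smooth : Prop :=
  forall O : set Y, is_point O ->
    forall (z : Ybar) (p : {poly Ybar}),
      p \is monic -> (forall i, point_extension O p`_i) -> root p z ->
      point_extension O z.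

(** * Picard curves *)

Definition picard_curve : Prop :=
  [/\ smooth, has_genus Y 3 &
      exists f : {rmorphism P1 Kbar -> Ybar},
        [/\ pullback f, has_degree f 3 & is_galois f]].

End BaseChange.

Definition distinguished (k : fieldType) (C : curve k) (G : set (C -> C)) : Prop :=
  [/\ is_subgroup G, (G #= `I_3)%card &
      exists (Q : curve k) (f : {rmorphism Q -> C}),
        is_quotient G f /\ has_genus Q 0].

(** More than one distinguished subgroup; to be applied to [Y_Kbar]. *)
Definition special (k : fieldType) (C : curve k) : Prop :=
  exists G1 G2 : set (C -> C),
    [/\ distinguished G1, distinguished G2 & G1 <> G2].

(* Main.v *)
(** Let [C] be the curve [Ybar] over [k = Kbar]; it has genus 3 because [Y] is
    smooth. If [G] is distinguished, then [C/G] is rational and Kummer theory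
    presents [C] as [y^3 = h1 h2^2] over [k(x)], with [h1 h2] separable and, after
    moving a branch point, infinity ramified. The genus of this curve is
    [deg h1 + deg h2 - 1], so that [deg h1 + deg h2 = 4], and a change of [x] turns
    the equation into [y^3 = f(x)] with [f] a separable quartic.

    The regular differentials are then spanned by [eta], [x eta], [y eta] with
    [eta = dx / (3 y^2)]: the equation is that of the canonical plane quartic, and
    [G] is a group of homologies of the plane. Two distinguished groups thus give
    equations [y1^3 = f1(x1)] and [y2^3 = f2(x2)] of the same quartic, exchanged by
    a projective change of coordinates. Either one of [x1], [x2] is a rational
    function of the other, and then the two groups coincide, or comparing
    coefficients forces [f1 = c4 x^4 + c0] after an affine change of [x1], which is
    [Y0] up to scaling.

    Conversely, on [Y0] the group of [y |-> w y], where [w^2 + w + 1 = 0], differs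
    from its conjugate by [(x, y) |-> (mu x / (y + 1), (2 - y) / (y + 1))], where
    [mu^2 = 3]. *)

Require Import Defs.
From HB Require Import structures.
From mathcomp Require Import all_boot all_order all_algebra all_field.
From mathcomp Require Import boolp classical_sets functions cardinality.
From mathcomp Require Import ring zify.

Set Implicit Arguments.
Unset Strict Implicit.
Unset Printing Implicit Defensive.

Import GRing.Theory.

Local Open Scope classical_set_scope.
Local Open Scope ring_scope.

(** * Valuation rings *)

(** Neither Riemann-Roch nor Hurwitz is invoked; one explicit computation replaces both. Once
    infinity is ramified in the cubic cover, a single point lies over it, and the three
    eigencomponents of a function have orders there that differ modulo 3, so their poles cannot
    cancel. Regularity is tested on each component, by cubing it: this leaves a fraction in [x] and
    a comparison of degrees. Strong approximation pushes every repartition to that point; the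
    leftover monomials are a basis of H^1, and the same counts bound the regular differentials.
    Orders are never integers: a point is known only through its ring [O] and the ideal [nonunit O].
    The finiteness that this hides comes from linear dependence over [k[x]]. The genus is given over
    [K], while the argument runs over the closure; smoothness keeps a basis of H^1 independent after
    base change. Differentials enter through dual derivations. These are all proportional, so the
    spans of [1], [x], [y] for two equations differ by one factor [h], which is the projective
    change of coordinates. *)

Section Subrings.
Variable F : fieldType.
Implicit Types (S R : set F) (p q : {poly F}) (a z w : F).

Record is_subring S : Prop := IsSubring {
  subring1 : S 1;
  subringB : forall a b, S a -> S b -> S (a - b);
  subringM : forall a b, S a -> S b -> S (a * b)
}.

Lemma subring0 S : is_subring S -> S 0.
Proof. by move=> SS; rewrite -(subrr 1); apply: subringB => //; exact: subring1. Qed.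

Lemma subringN S a : is_subring S -> S a -> S (- a).
Proof. by move=> SS Sa; rewrite -sub0r; apply: subringB => //; exact: subring0. Qed.

Lemma subringD S a b : is_subring S -> S a -> S b -> S (a + b).
Proof. by move=> SS Sa Sb; rewrite -[b]opprK; apply: subringB => //; exact: subringN. Qed.

Lemma subringX S a n : is_subring S -> S a -> S (a ^+ n).
Proof.
move=> SS Sa; elim: n => [|n IH]; first exact: subring1.
by rewrite exprS; apply: subringM.
Qed.

Lemma subring_sum S (I : Type) (r : seq I) (P : pred I) (f : I -> F) :
  is_subring S -> (forall i, P i -> S (f i)) -> S (\sum_(i <- r | P i) f i).
Proof.
move=> SS Sf; elim/big_ind: _ => //; first exact: subring0.
by move=> a b; exact: subringD.
Qed.

Lemma subring_prod S (I : Type) (r : seq I) (P : pred I) (f : I -> F) :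
  is_subring S -> (forall i, P i -> S (f i)) -> S (\prod_(i <- r | P i) f i).
Proof.
move=> SS Sf; elim/big_ind: _ => //; first exact: subring1.
by move=> a b; exact: subringM.
Qed.

Definition coefs_in S p := forall i, S p`_i.

Lemma subring_horner S p a : is_subring S -> coefs_in S p -> S a -> S p.[a].
Proof.
move=> SS Sp Sa; rewrite horner_coef; apply: subring_sum => // i _.
by apply: subringM => //; exact: subringX.
Qed.

Definition adjoin S a : set F := [set u | exists2 p, coefs_in S p & u = p.[a]].

Lemma adjoin_subring S a : is_subring S -> is_subring (adjoin S a).
Proof.
move=> SS; split.
- exists 1; last by rewrite hornerC.
  by move=> i; rewrite coef1; case: (i == 0)%N; [exact: subring1|exact: subring0].
- move=> _ _ [p Sp ->] [q Sq ->]; exists (p - q); last by rewrite hornerD hornerN.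
  by move=> i; rewrite coefB; exact: subringB.
- move=> _ _ [p Sp ->] [q Sq ->]; exists (p * q); last by rewrite hornerM.
  by move=> i; rewrite coefM; apply: subring_sum => // j _; exact: subringM.
Qed.

Lemma adjoin_sub S a : is_subring S -> S `<=` adjoin S a.
Proof.
move=> SS b Sb; exists b%:P; last by rewrite hornerC.
by move=> i; rewrite coefC; case: (i == 0)%N => //; exact: subring0.
Qed.

Lemma adjoin_gen S a : is_subring S -> adjoin S a a.
Proof.
move=> SS; exists 'X; last by rewrite hornerX.
by move=> i; rewrite coefX; case: (i == 1)%N; [exact: subring1|exact: subring0].
Qed.

Lemma horner_rev p n a : a != 0 -> (size p <= n.+1)%N ->
  p.[a] * a^-1 ^+ n = (\poly_(j < n.+1) p`_(n - j)).[a^-1].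
Proof.
move=> a0 sp; rewrite horner_poly (horner_coef_wide _ sp) mulr_suml.
rewrite (reindex_inj rev_ord_inj) /=; apply: eq_bigr => -[i /=]; rewrite ltnS => le _.
rewrite subSS -mulrA; congr (_ * _).
have -> : a^-1 ^+ n = a^-1 ^+ (n - i) * a^-1 ^+ i by rewrite -exprD subnK.
by rewrite mulrA -exprMn mulfV // expr1n mul1r.
Qed.

Lemma coefs_in_rev S p n : is_subring S -> coefs_in S p ->
  coefs_in S (\poly_(j < n) p`_(n.-1 - j)).
Proof. by move=> SS Sp i; rewrite coef_poly; case: ifP => // _; exact: subring0. Qed.

(** Multiplying [z = p.[z^-1]] by [z ^+ size p] gives a monic relation. Hence adjoining [z^-1] to a
    ring over which [z] is not integral does not produce [z], and the Zorn argument can start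
    there. *)
Lemma adjoin_inv_integral S z : is_subring S -> z != 0 -> adjoin S z^-1 z ->
  exists p, [/\ p \is monic, coefs_in S p & root p z].
Proof.
move=> SS z0 [p Sp zE].
pose n := size p; pose q := \poly_(j < n.+1) p`_(n - j).
have qz : p.[z^-1] * z ^+ n = q.[z].
  by rewrite -{2}[z]invrK horner_rev ?invr_eq0 // invrK.
exists ('X^(n.+1) - q); split.
- rewrite monicE lead_coefDl ?lead_coefXn // size_polyN size_polyXn ltnS.
  exact: size_poly.
- move=> i; rewrite coefB coefXn; apply: subringB => //.
    by case: (i == _); [exact: subring1|exact: subring0].
  exact: (@coefs_in_rev S p n.+1).
- by rewrite /root !hornerE -qz -zE -exprS subrr.
Qed.

Section Maximal.
Variables (S : set F) (z : F).
Hypotheses (SS : is_subring S) (z0 : z != 0) (Sw : S z^-1) (Sz : ~ S z).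
Hypothesis Smax : forall T, is_subring T -> S `<=` T -> ~ T z -> T `<=` S.

Lemma maximal_adjoin a : ~ S a -> adjoin S a z.
Proof.
move=> Sa; apply: contrapT => nz; apply: Sa.
have := Smax (adjoin_subring a SS) (@adjoin_sub S a SS) nz; apply.
exact: adjoin_gen.
Qed.

(** [z^-1] behaves like an element of the maximal ideal. If the inverse of [b = 1 - z^-1 * s] were
    missing, [z] would be a polynomial in [b^-1], so some [z * b ^+ n] would be in [S]; but [b] is 1
    modulo [z^-1], so [z] itself would be in [S]. *)
Lemma maximal_unit s : S s -> S (1 - z^-1 * s)^-1.
Proof.
move=> Ss; set b := 1 - _.
have [->|b0] := eqVneq b 0; first by rewrite invr0; exact: subring0.
apply: contrapT => /maximal_adjoin[p Sp zE].
have Sb : S b by apply: subringB => //; [exact: subring1|exact: subringM].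
have zb n : S (z * b ^+ n - z).
  elim: n => [|n IH]; first by rewrite mulr1 subrr; exact: subring0.
  have -> : z * b ^+ n.+1 - z = (z * b ^+ n - z) - s * b ^+ n.
    by rewrite exprS /b; field.
  by apply: subringB => //; apply: subringM => //; exact: subringX.
have : S (z * b ^+ size p).
  rewrite zE -{2}[b]invrK horner_rev ?invr_eq0 // invrK.
  by apply: subring_horner => //; exact: (@coefs_in_rev S p (size p).+1).
move=> /subringB -/(_ SS _ (zb (size p))); rewrite opprB addrC subrK.
exact: Sz.
Qed.

(** The reduction step of Chevalley's extension theorem. Moving the constant term of [q] to the left
    of [z = q.[a^-1]] leaves [z] times a unit, by [maximal_unit]; so [a ^+ n] is a combination of
    lower powers of [a], which replaces the leading term of [p]. *)
Lemma maximal_reduce a n m p q :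
  a != 0 -> (m <= n)%N -> coefs_in S p -> coefs_in S q ->
  (size p <= n.+1)%N -> (size q <= m.+1)%N ->
  z = p.[a] -> z = q.[a^-1] ->
  (0 < n)%N /\ exists r, [/\ coefs_in S r, (size r <= n)%N & z = r.[a]].
Proof.
move=> a0 mn Sp Sq sp sq zp zq.
have m0 : (0 < m)%N.
  case: m sq {mn} => // sq; case: Sz; rewrite zq.
  by rewrite (size1_polyC sq) hornerC; exact: Sq.
have n0 : (0 < n)%N by exact: leq_trans m0 mn.
split=> //.
pose b := 1 - z^-1 * q`_0; pose c := b^-1.
have b0 : b != 0.
  apply/eqP=> bE; apply: Sz; have -> : z = q`_0; last exact: Sq.
  have -> : z = z * b + q`_0 by rewrite /b; field.
  by rewrite bE mulr0 add0r.
have Sc : S c by exact: maximal_unit.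
pose T := \poly_(j < n) q`_(n - j).
have TE : z * a ^+ n = T.[a] + q`_0 * a ^+ n.
  rewrite zq -{2}[a]invrK horner_rev ?invr_eq0 ?invrK // ?(leq_trans sq) //.
  by rewrite /T !horner_poly big_ord_recr /= subnn.
have an : a ^+ n = z^-1 * c * T.[a].
  have -> : T.[a] = (z * b) * a ^+ n by apply: (addIr (q`_0 * a ^+ n)); rewrite -TE /b; field.
  by rewrite /c; field; rewrite z0 b0.
exists (\poly_(j < n) p`_j + (p`_n * (z^-1 * c)) *: T); split.
- move=> i; rewrite coefD coefZ !coef_poly; case: ifP => _; last first.
    by rewrite mulr0 addr0; exact: subring0.
  by apply: subringD => //; do 3?apply: subringM => //.
- apply: (leq_trans (size_polyD _ _)); rewrite geq_max size_poly /=.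
  exact: (leq_trans (size_scale_leq _ _) (size_poly _ _)).
rewrite hornerD hornerZ -mulrA -an [LHS]zp (horner_coef_wide _ sp) big_ord_recr /=.
by rewrite horner_poly.
Qed.

Lemma maximal_val a : S a \/ S a^-1.
Proof.
apply: contrapT => /not_orP[Sa Sa'].
have a0 : a != 0 by apply/eqP=> a0; apply: Sa; rewrite a0; exact: subring0.
have [p Sp zp] := maximal_adjoin Sa; have [q Sq zq] := maximal_adjoin Sa'.
(* Expressions of [z] in [a] and in [a^-1] cannot be shortened for ever; [maximal_reduce] is applied
   to [a] or to [a^-1], according to which expression is longer. *)
have [N] := ubnP (size p + size q)%N; elim: N => // N IH in a p q a0 Sp Sq zp zq {Sa Sa'} *.
have p0 : (0 < size p)%N.
  by rewrite lt0n; apply/eqP=> /eqP/[!size_poly_eq0]/eqP p0; case/eqP: z0; rewrite zp p0 horner0.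
have q0 : (0 < size q)%N.
  by rewrite lt0n; apply/eqP=> /eqP/[!size_poly_eq0]/eqP q0; case/eqP: z0; rewrite zq q0 horner0.
have [le|/ltnW le] := leqP (size q) (size p).
  case: (@maximal_reduce a (size p).-1 (size q).-1 p q) => //; rewrite ?prednK //.
    by rewrite -!subn1 leq_sub2r.
  move=> p1 [r [Sr sr zr]] lN; apply: (IH a r q) => //.
  by move: lN sr p0; lia.
case: (@maximal_reduce a^-1 (size q).-1 (size p).-1 q p); rewrite ?invr_eq0 ?invrK ?prednK //.
  by rewrite -!subn1 leq_sub2r.
move=> q1 [r [Sr sr zr]] lN; apply: (IH a p r) => //.
by move: lN sr q0; lia.
Qed.

End Maximal.

(* A subring maximal among those containing [z^-1] but not [z] is a valuation ring. *)
Lemma valuation_ring_exists R z : is_subring R ->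
  (forall p, p \is monic -> coefs_in R p -> ~ root p z) ->
  exists S, [/\ is_subring S, R `<=` S, forall a, S a \/ S a^-1 & ~ S z].
Proof.
move=> RS zint.
have z0 : z != 0.
  apply/eqP=> z0; apply: (zint 'X); rewrite ?monicX ?z0 /root ?hornerX //.
  by move=> i; rewrite coefX; case: (i == _); [exact: subring1|exact: subring0].
pose good S := [/\ is_subring S, R `<=` S, S z^-1 & ~ S z].
have good0 : good (adjoin R z^-1).
  split; [exact: adjoin_subring|exact: adjoin_sub|exact: adjoin_gen|].
  by move=> /adjoin_inv_integral -/(_ RS z0)[p [pm Rp]]; exact: zint.
have [|S [PS Smax]] := @Zorn_bigcup _ [set S | S = set0 \/ good S].
  move=> G GP Gtot; have [[S0 [GS0 gS0]]|nG] := pselect (exists S, G S /\ good S); last first.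
    left; apply/seteqP; split=> // a [S GS Sa].
    by case: (GP S GS) => [S0|gS]; [rewrite S0 in Sa|case: nG; exists S].
  right.
  have [S0S RS0 S0w S0z] := gS0.
  have two a b : (\bigcup_(X in G) X) a -> (\bigcup_(X in G) X) b ->
      exists S, [/\ G S, good S, S a & S b].
    move=> [S GS Sa] [T GT Tb].
    have gS : good S by case: (GP S GS) => // S_0; rewrite S_0 in Sa.
    have gT : good T by case: (GP T GT) => // T_0; rewrite T_0 in Tb.
    by case: (Gtot _ _ GS GT) => st; [exists T|exists S]; split=> //; exact: st.
  split.
  - split; first by exists S0 => //; exact: subring1.
      by move=> a b /two h /h[S [GS [SS _ _ _] Sa Sb]]; exists S => //; exact: subringB.
    by move=> a b /two h /h[S [GS [SS _ _ _] Sa Sb]]; exists S => //; exact: subringM.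
  - by move=> a Ra; exists S0 => //; exact: RS0.
  - by exists S0.
  - by move=> [S GS Sz]; case: (GP S GS) => [S_0|[]//]; rewrite S_0 in Sz.
have {PS} [SS RSS Sw Sz] : good S.
  case: PS => // S0; case: (Smax (adjoin R z^-1)); last by right.
  rewrite S0; split=> // h.
  by have := h _ (subring1 (adjoin_subring z^-1 RS)).
exists S; split=> //; apply: (@maximal_val S z) => // T TS ST Tz.
apply: contrapT => TnS; case: (Smax T); first by split.
by right; split=> //; [apply: subset_trans ST|exact: ST].
Qed.

End Subrings.

(** * Points *)

Section Points.
Variables (k : fieldType) (C : curve k).
Implicit Types (O : set C) (x z a b t : C) (p q : {poly k}).

Definition ev x p : C := (map_poly (const C) p).[x].

Lemma ev_is_zmod_morphism x : zmod_morphism (ev x).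
Proof. by move=> p q; rewrite /ev rmorphB hornerD hornerN. Qed.

Lemma ev_is_monoid_morphism x : monoid_morphism (ev x).
Proof. by split=> [|p q]; rewrite /ev ?rmorph1 ?hornerC // rmorphM hornerM. Qed.

HB.instance Definition _ x :=
  GRing.isZmodMorphism.Build {poly k} C (ev x) (ev_is_zmod_morphism x).
HB.instance Definition _ x :=
  GRing.isMonoidMorphism.Build {poly k} C (ev x) (ev_is_monoid_morphism x).

Lemma evX x : ev x 'X = x.
Proof. by rewrite /ev map_polyX hornerX. Qed.

Lemma evC x c : ev x c%:P = const C c.
Proof. by rewrite /ev map_polyC hornerC. Qed.

Lemma evD x p q : ev x (p + q) = ev x p + ev x q. Proof. exact: rmorphD. Qed.
Lemma evB x p q : ev x (p - q) = ev x p - ev x q. Proof. exact: rmorphB. Qed.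
Lemma evN x p : ev x (- p) = - ev x p. Proof. exact: rmorphN. Qed.
Lemma evM x p q : ev x (p * q) = ev x p * ev x q. Proof. exact: rmorphM. Qed.
Lemma evXn x p n : ev x (p ^+ n) = ev x p ^+ n. Proof. exact: rmorphXn. Qed.
Lemma ev0 x : ev x 0 = 0. Proof. exact: rmorph0. Qed.
Lemma ev1 x : ev x 1 = 1. Proof. exact: rmorph1. Qed.

Definition evE := (evX, evC, evD, evB, evN, evM, evXn, ev0, ev1).

Definition transcendental x := ~ algebraicOver (const C) x.

Lemma ev_eq0 x p : transcendental x -> (ev x p == 0) = (p == 0).
Proof.
move=> xT; apply/idP/idP=> [px|/eqP->]; last by rewrite rmorph0.
by apply/negPn/negP=> p0; apply: xT; exists p.
Qed.

Lemma ev_inj x : transcendental x -> injective (ev x).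
Proof.
move=> xT p q /eqP; rewrite -subr_eq0 -rmorphB ev_eq0 // subr_eq0.
by move/eqP.
Qed.

(** The maximal ideal of [O]. Zero is listed separately because [0^-1 = 0] does lie in [O]. *)
Definition nonunit O : set C := [set a | O a /\ (a = 0 \/ ~ O a^-1)].

Section Point.
Variable O : set C.
Hypothesis PO : is_point O.

Lemma point1 : O 1.
Proof. by rewrite -(rmorph1 (const C)); exact: point_const. Qed.

Lemma point_subring : is_subring O.
Proof. by split; [exact: point1|exact: point_sub|exact: point_mul]. Qed.

Lemma point0 : O 0. Proof. exact: subring0 point_subring. Qed.

Lemma pointD a b : O a -> O b -> O (a + b).
Proof. exact: subringD point_subring. Qed.

Lemma pointN a : O a -> O (- a).
Proof. exact: subringN point_subring. Qed.

Lemma pointX a n : O a -> O (a ^+ n).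
Proof. exact: subringX point_subring. Qed.

Lemma point_ev x p : O x -> O (ev x p).
Proof.
move=> Ox; apply: (subring_horner point_subring) => // i.
by rewrite coef_map; exact: point_const.
Qed.

Lemma nonunit_in a : nonunit O a -> O a. Proof. by case. Qed.

Lemma nonunit0 : nonunit O 0. Proof. by split; [exact: point0|left]. Qed.

Lemma nonunit_inv a : ~ O a -> nonunit O a^-1.
Proof. by move=> Oa; case: (point_val PO a) => // Oa'; split=> //; rewrite invrK; right. Qed.

Lemma unit_inv a : O a -> ~ nonunit O a -> O a^-1.
Proof. by move=> Oa nO; apply: contrapT => Oa'; apply: nO; split=> //; right. Qed.

Lemma unit_neq0 a : ~ nonunit O a -> a != 0.
Proof. by move=> nO; apply/eqP=> a0; apply: nO; rewrite a0; exact: nonunit0. Qed.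

Lemma nonunitMl a b : O a -> nonunit O b -> nonunit O (a * b).
Proof.
move=> Oa [Ob nb]; split; first exact: point_mul.
case: nb => [->|nb]; first by rewrite mulr0; left.
have [->|a0] := eqVneq a 0; first by rewrite mul0r; left.
have [->|b0] := eqVneq b 0; first by rewrite mulr0; left.
right=> h; apply: nb.
have -> : b^-1 = a * (a * b)^-1 by field; rewrite a0 b0.
exact: point_mul.
Qed.

Lemma nonunitMr a b : nonunit O a -> O b -> nonunit O (a * b).
Proof. by move=> ? ?; rewrite mulrC; exact: nonunitMl. Qed.

Lemma nonunit1 : ~ nonunit O 1.
Proof. by case=> _ [/eqP|]; rewrite ?oner_eq0 // invr1; apply; exact: point1. Qed.

Lemma nonunitN a : nonunit O a -> nonunit O (- a).
Proof.
move=> h; rewrite -mulN1r; apply: nonunitMl => //.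
by apply: pointN; exact: point1.
Qed.

Lemma nonunitD a b : nonunit O a -> nonunit O b -> nonunit O (a + b).
Proof.
move=> ma mb.
have [->|a0] := eqVneq a 0; first by rewrite add0r.
have [->|b0] := eqVneq b 0; first by rewrite addr0.
case: (point_val PO (a / b)) => h.
  have -> : a + b = (a / b + 1) * b by field.
  by apply: nonunitMl => //; apply: pointD => //; exact: point1.
have -> : a + b = ((a / b)^-1 + 1) * a by field; rewrite a0 b0.
by apply: nonunitMl => //; apply: pointD => //; exact: point1.
Qed.

Lemma nonunitB a b : nonunit O a -> nonunit O b -> nonunit O (a - b).
Proof. by move=> ma mb; apply: nonunitD => //; exact: nonunitN. Qed.

Lemma nonunit_sum (I : Type) (r : seq I) (P : pred I) (f : I -> C) :
  (forall i, P i -> nonunit O (f i)) -> nonunit O (\sum_(i <- r | P i) f i).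
Proof. by move=> h; elim/big_ind: _ => //; [exact: nonunit0|exact: nonunitD]. Qed.

Lemma nonunitX a n : nonunit O a -> (0 < n)%N -> nonunit O (a ^+ n).
Proof.
case: n => // n ma _; rewrite exprS; apply: nonunitMr => //.
by apply: pointX; exact: nonunit_in.
Qed.

Lemma nonunit_prime a b : O a -> O b -> nonunit O (a * b) ->
  nonunit O a \/ nonunit O b.
Proof.
move=> Oa Ob mab; apply: contrapT => /not_orP[na nb]; apply: nonunit1.
have -> : 1 = (a^-1 * b^-1) * (a * b).
  by field; rewrite (unit_neq0 na) (unit_neq0 nb).
by apply: nonunitMl => //; apply: point_mul => //; exact: unit_inv.
Qed.

Lemma unitM a b : O a -> O b -> ~ nonunit O a -> ~ nonunit O b -> ~ nonunit O (a * b).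
Proof. by move=> Oa Ob na nb /(nonunit_prime Oa Ob)[]. Qed.

Lemma nonunit_prod (I : Type) (r : seq I) (P : pred I) (f : I -> C) :
  (forall i, P i -> O (f i)) -> nonunit O (\prod_(i <- r | P i) f i) ->
  exists2 i, P i & nonunit O (f i).
Proof.
move=> Of; elim: r => [|i r IH]; first by rewrite big_nil => /nonunit1.
rewrite big_cons; case: ifP => // Pi /(nonunit_prime (Of i Pi))[|mi|//]; last by exists i.
by apply: subring_prod => //; exact: point_subring.
Qed.

Lemma nonunitXE a n : O a -> nonunit O (a ^+ n) -> nonunit O a.
Proof.
move=> Oa; elim: n => [/nonunit1//|n IH]; rewrite exprS => /nonunit_prime[] //.
exact: pointX.
Qed.

Lemma unitD a b : O a -> ~ nonunit O a -> nonunit O b -> ~ nonunit O (a + b).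
Proof. by move=> Oa na mb mab; apply: na; rewrite -(addrK b a); exact: nonunitB. Qed.

Lemma notin_nonunit a : ~ O a -> a != 0.
Proof. by move=> Oa; apply/eqP=> a0; apply: Oa; rewrite a0; exact: point0. Qed.

Lemma nonunit_notin a : nonunit O a -> a != 0 -> ~ O a^-1.
Proof. by case=> _ [->|//]; rewrite eqxx. Qed.

Lemma const_unit c : c != 0 -> ~ nonunit O (const C c).
Proof.
move=> c0 h; apply: (nonunit_notin h); first by rewrite fmorph_eq0.
by rewrite -fmorphV; exact: point_const.
Qed.

Lemma point_mulr_unit a b : O a -> ~ nonunit O a -> O (a * b) -> O b.
Proof.
move=> Oa na Oab; have -> : b = a^-1 * (a * b) by rewrite mulKf // (unit_neq0 na).
by apply: point_mul => //; exact: unit_inv.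
Qed.

Lemma point_mul_notin a b : ~ O b -> O (a * b) -> nonunit O a.
Proof.
move=> nb Oab; have -> : a = (a * b) * b^-1 by rewrite mulfK // (notin_nonunit nb).
by apply: nonunitMl => //; exact: nonunit_inv.
Qed.

Lemma point_Xn a n : (0 < n)%N -> O (a ^+ n) -> O a.
Proof.
move=> n0 Oan; apply: contrapT => Oa.
have := nonunitX (nonunit_inv Oa) n0; rewrite exprVn => h.
apply: (nonunit_notin h); last by rewrite invrK.
by rewrite invr_eq0 expf_neq0 // (notin_nonunit Oa).
Qed.

(* The coefficients of [P(X) / (X - z)] and their products with [z] lie in
   every valuation ring containing the coefficients of [P]. *)
Lemma quotient_coef (P : {poly C}) z i : coefs_in O P -> root P z ->
  O (drop_poly i P).[z] /\ O (z * (drop_poly i P).[z]).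
Proof.
move=> OP /eqP Pz.
have Odrop j : O (drop_poly j P).[z].
  have [Oz|nz] := pselect (O z).
    by apply: (subring_horner point_subring) => // l; rewrite coef_drop_poly; exact: OP.
  have z0 := notin_nonunit nz.
  (* When [z] is outside [O], the upper part of the relation is minus the lower part divided by
     [z ^+ j], hence a polynomial in [z^-1]. *)
  have : (take_poly j P).[z] + z ^+ j * (drop_poly j P).[z] = 0.
    by rewrite -[RHS]Pz -{3}(poly_take_drop j P) hornerD hornerM hornerXn mulrC.
  move/eqP; rewrite addrC addr_eq0 => /eqP E.
  have -> : (drop_poly j P).[z] = - ((take_poly j P).[z] * z^-1 ^+ j).
    apply: (mulfI (expf_neq0 j z0)); rewrite E exprVn; field.
    by rewrite expf_neq0.
  rewrite horner_rev ?(leq_trans (size_take_poly _ _)) //; apply: pointN.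
  apply: (subring_horner point_subring); last by case: (nonunit_inv nz).
  apply: (@coefs_in_rev _ _ _ j.+1) => [|l]; first exact: point_subring.
  by rewrite coef_take_poly; case: ifP => // _; exact: point0.
split=> //; case: i => [|i].
  by rewrite drop_poly0l Pz mulr0; exact: point0.
have -> : z * (drop_poly i.+1 P).[z] = (drop_poly i P).[z] - P`_i.
  have -> : drop_poly i P = 'X * drop_poly i.+1 P + (P`_i)%:P.
    apply/polyP=> j; rewrite coefD coefXM coefC !coef_drop_poly.
    by case: j => [|j] /=; rewrite ?add0r // addr0 addnS addSn.
  by rewrite !hornerE; ring.
exact: point_sub.
Qed.

End Point.

Lemma point_exists (R : set C) z : is_subring R -> (forall c, R (const C c)) ->
  (forall P, P \is monic -> coefs_in R P -> ~ root P z) ->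
  exists O, [/\ is_point O, R `<=` O & ~ O z].
Proof.
move=> RS Rc h; have [S [SS RSS Sv Sz]] := valuation_ring_exists RS h.
exists S; split=> //; split=> //; [|exact: subringB|exact: subringM|by exists z].
by move=> c; exact: RSS.
Qed.

End Points.

(** With more rows than columns there is a kernel vector over the fraction field; clearing its
    denominators keeps it nonzero. *)
Lemma tofrac_left_kernel (k : fieldType) n (M : 'M[{poly k}]_(n.+1, n)) :
  exists2 v : 'rV[{poly k}]_n.+1, v != 0 & v *m M = 0.
Proof.
pose u := nz_row (kermx (map_mx (@tofrac {poly k}) M)).
have u0 : u != 0.
  rewrite nz_row_eq0 kermx_eq0 /row_free; apply/eqP=> rk.
  by have := rank_leq_col (map_mx (@tofrac {poly k}) M); rewrite rk ltnn.
have uM : u *m map_mx (@tofrac {poly k}) M = 0 by apply/sub_kermxP; exact: nz_row_sub.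
have /choice[pq pqP] : forall j, exists pq : {poly k} * {poly k},
    pq.2 != 0 /\ tofrac pq.2 * u 0 j = tofrac pq.1.
  by move=> j; have [p [q [q0 E]]] := P1_fraction (u 0 j); exists (p, q).
pose D := \prod_j (pq j).2.
have D0 : D != 0 by apply/prodf_neq0 => j _; case: (pqP j).
pose v := \row_j ((pq j).1 * \prod_(i | i != j) (pq i).2).
have vE : map_mx (@tofrac {poly k}) v = tofrac D *: u.
  apply/rowP=> j; rewrite !mxE tofracM -(pqP j).2 mulrAC -tofracM.
  by rewrite /D [in RHS](bigD1 j).
exists v.
  apply: contraNneq u0 => v0; move: vE; rewrite v0 map_mx0 => /esym/eqP.
  by rewrite scaler_eq0 tofrac_eq0 (negbTE D0).
have : map_mx (@tofrac {poly k}) (v *m M) = 0.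
  by rewrite map_mxM vE -scalemxAl uM scaler0.
move=> vM; apply/rowP=> i; move/rowP: vM => /(_ i); rewrite !mxE => /eqP.
by rewrite tofrac_eq0 => /eqP.
Qed.

(** * Points over the [x]-line, and linear dependence over [k[x]] *)

Section FunctionField.
Variables (k : fieldType) (C : curve k).
Implicit Types (O : set C) (x z a b t : C) (p q pi : {poly k}).

Definition finite_over x := transcendental x /\
  exists n (b : 'I_n -> C), forall z, exists q (p : 'I_n -> {poly k}),
    q != 0 /\ ev x q * z = \sum_(i < n) ev x (p i) * b i.

Lemma finite_over_exists : exists x, finite_over x.
Proof. by have [x [n [b [xT h]]]] := curveP C; exists x; split=> //; exists n, b. Qed.

Lemma transcendental_neq0 x : transcendental x -> x != 0.
Proof. by move=> xT; apply/eqP=> x0; apply: xT; rewrite x0; exact: algebraic0. Qed.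

Lemma transcendentalV x : transcendental x -> transcendental x^-1.
Proof. by move=> xT h; apply: xT; rewrite -[x]invrK; exact: algebraic_inv. Qed.

Lemma ev_rev x p n : x != 0 -> (size p <= n.+1)%N ->
  ev x p = x ^+ n * ev x^-1 (\poly_(j < n.+1) p`_(n - j)).
Proof.
move=> x0 sp; apply: (mulIf (expf_neq0 n (invr_neq0 x0))).
rewrite {1}/ev horner_rev ?(leq_trans (size_poly _ _)) // mulrAC -exprMn mulfV // expr1n mul1r.
congr (_.[_]); apply/polyP=> i; rewrite coef_map [in LHS]coef_poly [in RHS]coef_poly.
by rewrite coef_map /=; case: ifP; rewrite ?raddf0.
Qed.

Lemma rev_neq0 p n : (size p <= n.+1)%N -> p != 0 -> \poly_(j < n.+1) p`_(n - j) != 0.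
Proof.
move=> sp p0; have s0 : (0 < size p)%N by rewrite size_poly_gt0.
apply/eqP=> /polyP/(_ (n - (size p).-1)%N); rewrite coef_poly coef0 ltnS leq_subr.
rewrite subKn; last by rewrite -ltnS prednK.
by move/eqP; rewrite -lead_coefE lead_coef_eq0 (negbTE p0).
Qed.

Lemma finite_overV x : finite_over x -> finite_over x^-1.
Proof.
move=> [xT [n [b h]]]; split; first exact: transcendentalV.
exists n, b => z; have [q [p [q0 E]]] := h z.
have x0 := transcendental_neq0 xT.
pose N := maxn (size q) (\max_i size (p i)).
have sq : (size q <= N.+1)%N by apply: leq_trans (leqnSn _); exact: leq_maxl.
have sp i : (size (p i) <= N.+1)%N.
  by apply: leq_trans (leqnSn _); apply: (leq_trans _ (leq_maxr _ _)); exact: (leq_bigmax i).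
exists (\poly_(j < N.+1) q`_(N - j)), (fun i => \poly_(j < N.+1) (p i)`_(N - j)).
split; first exact: rev_neq0.
apply: (mulfI (expf_neq0 N x0)); rewrite mulrA -ev_rev // E mulr_sumr.
by apply: eq_bigr => i _; rewrite mulrA -ev_rev.
Qed.

Lemma finite_over_dep x : finite_over x -> exists n, forall z : 'I_n.+1 -> C,
  exists p : 'I_n.+1 -> {poly k}, (exists i, p i != 0) /\ \sum_i ev x (p i) * z i = 0.
Proof.
move=> [xT [n [b h]]]; exists n => z.
have /choice[qp qpP] : forall j, exists qp : {poly k} * ('I_n -> {poly k}),
    qp.1 != 0 /\ ev x qp.1 * z j = \sum_(i < n) ev x (qp.2 i) * b i.
  by move=> j; have [q [p E]] := h (z j); exists (q, p).
have [v v0 vM] := tofrac_left_kernel (\matrix_(j, i) (qp j).2 i).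
exists (fun j => v 0 j * (qp j).1); split.
  have [j vj] : exists j, v 0 j != 0.
    apply: contrapT => nv; case/eqP: v0; apply/rowP=> j; rewrite mxE.
    by apply: contrapT => /eqP vj; apply: nv; exists j.
  by exists j; rewrite mulf_neq0 //; case: (qpP j).
transitivity (\sum_j \sum_i ev x (v 0 j * (qp j).2 i) * b i).
  apply: eq_bigr => j _; rewrite rmorphM -mulrA (qpP j).2 mulr_sumr.
  by apply: eq_bigr => i _; rewrite rmorphM mulrA.
rewrite exchange_big big1 // => i _ /=; rewrite -mulr_suml -rmorph_sum.
move/rowP: vM => /(_ i); rewrite !mxE => E.
have -> : \sum_j v 0 j * (qp j).2 i = 0.
  by rewrite -[RHS]E; apply: eq_bigr => j _; rewrite mxE.
by rewrite rmorph0 mul0r.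
Qed.

(** Dividing by [pi] while all coefficients allow it must end, since a nonzero coefficient shrinks.
    The resulting relation survives reduction modulo [pi], which makes it usable at a point over
    [pi]. *)
Lemma normalize_relation x (pi : {poly k}) n (z : 'I_n -> C) (p : 'I_n -> {poly k}) :
  transcendental x -> (1 < size pi)%N ->
  (exists i, p i != 0) -> \sum_i ev x (p i) * z i = 0 ->
  exists p' : 'I_n -> {poly k}, (exists i, ~~ (pi %| p' i)) /\ \sum_i ev x (p' i) * z i = 0.
Proof.
move=> xT spi [i0 pi0]; have [N] := ubnP (size (p i0)).
elim: N => // N IH in p pi0 *; rewrite ltnS => sN E.
have [h|nh] := pselect (exists i, ~~ (pi %| p i)); first by exists p.
have dv i : pi %| p i by apply: contrapT => /negP h; apply: nh; exists i.
have pi_neq0 : pi != 0 by rewrite -size_poly_gt0; exact: ltn_trans spi.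
have pE i : p i = (p i %/ pi) * pi by rewrite divpK.
have q0 : p i0 %/ pi != 0 by apply: contra_neq pi0; rewrite {2}(pE i0) => ->; rewrite mul0r.
apply: (IH (fun i => p i %/ pi)) => //.
  rewrite size_divp //; move: pi0 sN spi; rewrite -size_poly_gt0.
  by move: (size (p i0)) (size pi); lia.
apply: (mulIf (_ : ev x pi != 0)); first by rewrite ev_eq0.
rewrite mul0r -[RHS]E mulr_suml; apply: eq_bigr => i _.
by rewrite {2}(pE i) rmorphM mulrAC.
Qed.

(* [pi] generates the prime ideal of [k[X]] lying under [O] via [x]. *)
Definition lies_over O x pi :=
  [/\ (1 < size pi)%N, nonunit O (ev x pi) & forall p, nonunit O (ev x p) -> pi %| p].

(** The relation is a dependence between [1, z, ..., z ^+ n], made primitive at [pi]. *)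
Lemma finite_over_relation x z (pi : {poly k}) : finite_over x -> (1 < size pi)%N ->
  exists P : {poly {poly k}}, (exists i, ~~ (pi %| P`_i)) /\ root (map_poly (ev x) P) z.
Proof.
move=> fx spi; have [n dep] := finite_over_dep fx.
have [p [pN0 E]] := dep (fun i => z ^+ i).
have {pN0 E}[p' [[i pi'] E]] := normalize_relation fx.1 spi pN0 E.
exists (\poly_(i < n.+1) p' (inord i)); split.
  by exists i; rewrite coef_poly ltn_ord inord_val.
have -> : map_poly (ev x) (\poly_(i < n.+1) p' (inord i)) =
    \poly_(i < n.+1) ev x (p' (inord i)).
  by apply/polyP=> j; rewrite coef_map /= !coef_poly; case: ifP; rewrite ?raddf0.
rewrite /root horner_poly; apply/eqP; rewrite -[RHS]E.
by apply: eq_bigr => j _; rewrite inord_val.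
Qed.

Lemma coefs_in_map O x (P : {poly {poly k}}) : is_point O -> O x ->
  coefs_in O (map_poly (ev x) P).
Proof. by move=> PO Ox i; rewrite coef_map; exact: point_ev. Qed.

(** The integral closure of [k[x]], in its description as an intersection of valuation rings. *)
Definition regular x : set C := [set u | forall O, is_point O -> O x -> O u].

Lemma regular_subring x : is_subring (regular x).
Proof.
split=> [O PO _|a b ra rb O PO Ox|a b ra rb O PO Ox]; first exact: point1.
  by apply: point_sub => //; [exact: ra|exact: rb].
by apply: point_mul => //; [exact: ra|exact: rb].
Qed.

Lemma regular_ev x p : regular x (ev x p).
Proof. by move=> O PO; exact: point_ev. Qed.

Lemma regular_lead_coef x z (P : {poly {poly k}}) :
  P != 0 -> root (map_poly (ev x) P) z -> regular x (ev x (lead_coef P) * z).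
Proof.
move=> P0 Pz O PO Ox.
have [_] := quotient_coef PO (size P).-1 (coefs_in_map P PO Ox) Pz.
(* The topmost of the elements of [quotient_coef] is the leading coefficient. *)
have -> : drop_poly (size P).-1 (map_poly (ev x) P) = (ev x (lead_coef P))%:P.
  apply/polyP=> j; rewrite coef_drop_poly coefC coef_map; case: j => //= j.
  by rewrite nth_default ?rmorph0 // addSn -addnS prednK ?leq_addl // size_poly_gt0.
by rewrite hornerC mulrC.
Qed.

Lemma regular_denominator x z : finite_over x ->
  exists q, q != 0 /\ regular x (ev x q * z).
Proof.
move=> fx; have sX : (1 < size ('X : {poly k}))%N by rewrite size_polyX.
have [P [[i Pi] Pz]] := finite_over_relation z fx sX.
have P0 : P != 0 by apply/eqP=> P0; move: Pi; rewrite P0 coef0 dvdp0.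
exists (lead_coef P); split; first by rewrite lead_coef_eq0.
exact: regular_lead_coef.
Qed.

Section Over.
Variables (O : set C) (x : C).
Hypotheses (PO : is_point O) (Ox : O x) (fx : finite_over x).

Lemma lies_over_exists : exists pi, lies_over O x pi.
Proof.
(* If every nonzero polynomial in [x] were a unit at [O], all denominators could be inverted and [O]
   would be the whole field. *)
have [p0 [p0n mp0]] : exists p, p != 0 /\ nonunit O (ev x p).
  apply: contrapT => nex; have [a Oa] := point_proper PO; apply: Oa.
  have [q [q0 /(_ O PO Ox)]] := regular_denominator a fx.
  apply: point_mulr_unit => //; first exact: point_ev.
  by move=> mq; apply: nex; exists q.
pose Q n := `[< exists p, [/\ p != 0, nonunit O (ev x p) & size p = n] >].
have exQ : exists n, Q n by exists (size p0); apply/asboolP; exists p0.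
case: (ex_minnP exQ) => n /asboolP[pi [pi0 mpi spi]] minn; exists pi; split=> //.
  rewrite ltnNge; apply/negP=> /size1_polyC piE; move: mpi; rewrite piE evC.
  by apply: const_unit => //; rewrite -polyC_eq0 -piE.
move=> p mp; rewrite /dvdp; apply: contrapT => /negP r0.
have : Q (size (p %% pi)).
  apply/asboolP; exists (p %% pi); split=> //.
  have -> : p %% pi = p - p %/ pi * pi by rewrite {2}(divp_eq p pi) addrC addKr.
  rewrite rmorphB rmorphM; apply: nonunitB => //.
  by apply: nonunitMl => //; exact: point_ev.
by move=> /minn; rewrite leqNgt -spi ltn_modp pi0.
Qed.

Lemma lies_over_unit pi p : lies_over O x pi -> ~~ (pi %| p) -> ~ nonunit O (ev x p).
Proof. by move=> [_ _ h] /negP np /h. Qed.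

Lemma lies_over_neq0 pi : lies_over O x pi -> ev x pi != 0.
Proof.
by move=> [spi _ _]; rewrite (ev_eq0 _ fx.1) -size_poly_gt0 (ltn_trans _ spi).
Qed.

(** [O] is a localization of [regular x]. The elements [b i] of [quotient_coef] are denominators for
    [z], and the [i]-th coefficient of the relation is [b i - z * b i.+1]. Some coefficient is a
    unit at [O], so [b i] or [b i.+1] is one. *)
Lemma local_denominator z : O z ->
  exists u, [/\ regular x u, regular x (u * z) & ~ nonunit O u].
Proof.
move=> Oz; have [pi lo] := lies_over_exists; have [spi _ _] := lo.
have [P [[i Pi] Pz]] := finite_over_relation z fx spi.
pose b i := (drop_poly i (map_poly (ev x) P)).[z].
have bR i' : regular x (b i') /\ regular x (b i' * z).
  by split=> O' PO' Ox'; have [h1 h2] := quotient_coef PO' i' (coefs_in_map P PO' Ox') Pz;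
    rewrite // mulrC.
have E : ev x P`_i = b i - z * b i.+1.
  have -> : b i = z * b i.+1 + ev x P`_i; last by rewrite addrC addKr.
  rewrite /b.
  have -> : drop_poly i (map_poly (ev x) P) =
      'X * drop_poly i.+1 (map_poly (ev x) P) + (ev x P`_i)%:P.
    apply/polyP=> j; rewrite coefD coefXM coefC !coef_drop_poly !coef_map.
    by case: j => [|j] /=; rewrite ?add0r // addr0 addnS addSn.
  by rewrite !hornerE.
have [nb|nb] := pselect (nonunit O (b i)); last first.
  by exists (b i); case: (bR i).
exists (b i.+1); case: (bR i.+1) => r1 r2; split=> // nb'.
apply: (lies_over_unit lo Pi); rewrite E; apply: nonunitB => //.
exact: nonunitMl.
Qed.

End Over.

Lemma point_contains O x : is_point O -> finite_over x ->
  exists y, [/\ finite_over y, O y & y = x \/ y = x^-1].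
Proof.
move=> PO fx; case: (point_val PO x) => Ox; first by exists x; split=> //; left.
by exists x^-1; split=> //; [exact: finite_overV|right].
Qed.

(** A bound on ramification, uniform over all points. If it failed, [ev x pi] would have larger
    order at [O] than [phi ^+ n.+1]. In a relation between powers of [phi] that is primitive at
    [pi], the first term whose coefficient is a unit would then have strictly smallest order and
    could not cancel. *)
Lemma uniform_exponent x : finite_over x -> exists n, forall O pi phi,
  is_point O -> O x -> lies_over O x pi -> nonunit O phi -> O (phi ^+ n / ev x pi).
Proof.
move=> fx; have [n dep] := finite_over_dep fx; exists n.+1 => O pi phi PO Ox lo mphi.
apply: contrapT => nO; have t0 := lies_over_neq0 fx lo.
have phi0 : phi != 0.
  by apply/eqP=> phi0; apply: nO; rewrite phi0 exprS !mul0r; exact: point0.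
have mt : nonunit O (ev x pi / phi ^+ n.+1).
  by rewrite -[_ / _]invf_div; exact: nonunit_inv.
have [spi _ _] := lo.
have [p [pN0 E]] := dep (fun i => phi ^+ i).
have {pN0 E}[p' [[i pi'] E]] := normalize_relation fx.1 spi pN0 E.
have {i pi'}[i ndv imin] : exists2 i, ~~ (pi %| p' i) &
    forall j, ~~ (pi %| p' j) -> (i <= j)%N.
  by case: (arg_minnP (P := fun i => ~~ (pi %| p' i)) (fun i => i : nat) pi') => j; exists j.
apply: (lies_over_unit lo ndv).
have phii0 : phi ^+ i != 0 by rewrite expf_neq0.
have -> : ev x (p' i) = - \sum_(j | j != i) ev x (p' j) * (phi ^+ j / phi ^+ i).
  apply: (mulIf phii0); apply/eqP; rewrite -subr_eq0 mulNr opprK; apply/eqP.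
  rewrite -[RHS]E [in RHS](bigD1 i) //=; congr (_ + _); rewrite mulr_suml.
  by apply: eq_bigr => j _; rewrite -mulrA mulfVK.
apply: nonunitN => //; apply: nonunit_sum => // j ji.
have [lt|le] := ltnP i j.
  apply: nonunitMl => //; first exact: point_ev.
  rewrite -(subnK (ltnW lt)) exprD mulfK //; apply: nonunitX => //.
  by rewrite subn_gt0.
have {ji le}lt : (j < i)%N by rewrite ltn_neqAle le andbT; exact: ji.
have : pi %| p' j by apply: contraTT lt => /imin; rewrite -leqNgt.
move=> /dvdpP[s ->]; rewrite rmorphM.
have -> : ev x s * ev x pi * (phi ^+ j / phi ^+ i) =
    ev x s * phi ^+ (n.+1 - i + j) * (ev x pi / phi ^+ n.+1).
  rewrite exprD; have -> : phi ^+ n.+1 = phi ^+ (n.+1 - i) * phi ^+ i.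
    by rewrite -exprD subnK // ltnW.
  by field; rewrite phii0 expf_neq0.
apply: nonunitMl => //; apply: point_mul => //; first exact: point_ev.
by apply: pointX => //; exact: nonunit_in.
Qed.

(** The valuation is archimedean: a denominator of [z] is, up to a unit, a power of [ev x pi], and
    by [uniform_exponent] some power of [phi] is divisible by [ev x pi]. *)
Lemma point_absorb O phi z : is_point O -> nonunit O phi -> exists N, O (phi ^+ N * z).
Proof.
move=> PO mphi; have [x0 fx0] := finite_over_exists.
have [x [fx Ox _]] := point_contains PO fx0.
have [pi lo] := lies_over_exists PO Ox fx; have [n nP] := uniform_exponent fx.
have t0 := lies_over_neq0 fx lo.
have [q [q0 /(_ O PO Ox) Oq]] := regular_denominator z fx.
have pi0 : pi != 0 by apply: contra_neq t0 => ->; rewrite rmorph0.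
have [M [s [ns qE]]] : exists M s, ~~ (pi %| s) /\ q = s * pi ^+ M.
  have [N] := ubnP (size q); elim: N q q0 {Oq} => // N IH q q0; rewrite ltnS => sq.
  have [dv|nd] := boolP (pi %| q); last by exists 0%N, q; rewrite mulr1.
  have qE : q = (q %/ pi) * pi by rewrite divpK.
  have q'0 : q %/ pi != 0 by apply: contra_neq q0; rewrite {2}qE => ->; rewrite mul0r.
  have [||M [s [ns E]]] := IH (q %/ pi) => //.
    case: lo => spi _ _; rewrite size_divp //; move: q0 sq spi; rewrite -size_poly_gt0.
    by move: (size q) (size pi); lia.
  by exists M.+1, s; split=> //; rewrite qE E exprSr mulrA.
have Otz : O (ev x pi ^+ M * z).
  apply: (point_mulr_unit PO _ (lies_over_unit lo ns)); first exact: point_ev.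
  by rewrite mulrA -rmorphXn -rmorphM -qE.
exists (n * M)%N.
have -> : phi ^+ (n * M) * z = (phi ^+ n / ev x pi) ^+ M * (ev x pi ^+ M * z).
  by rewrite mulrA -exprMn divfK // exprM.
by apply: point_mul => //; apply: pointX => //; exact: nP.
Qed.

(** An element [z] of the larger ring outside [O] has a nonunit inverse, whose powers absorb any
    [a]; then [a] lies in the larger ring, which would not be proper. *)
Lemma point_maximal O O' : is_point O -> is_point O' -> O `<=` O' -> O = O'.
Proof.
move=> PO PO' sub; apply/seteqP; split=> // z O'z; apply: contrapT => Oz.
have [a O'a] := point_proper PO'; apply: O'a.
have [N ON] := point_absorb a PO (nonunit_inv PO Oz).
have z0 := notin_nonunit PO Oz.
have -> : a = z ^+ N * (z^-1 ^+ N * a) by rewrite mulrA -exprMn mulfV // expr1n mul1r.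
by apply: point_mul => //; [exact: pointX|exact: sub].
Qed.

Lemma point_separate O O' x : finite_over x -> is_point O -> is_point O' -> O x -> O' x ->
  O <> O' -> exists u, [/\ regular x u, ~ nonunit O u & nonunit O' u].
Proof.
move=> fx PO PO' Ox O'x neq.
have [z [Oz O'z]] : exists z, O z /\ ~ O' z.
  apply: contrapT => nz; apply: neq; apply: point_maximal => // z Oz.
  by apply: contrapT => O'z; apply: nz; exists z.
have [u [ru ruz nu]] := local_denominator PO Ox fx Oz; exists u; split=> //.
by apply: (point_mul_notin PO' O'z); exact: ruz.
Qed.

End FunctionField.

(** * Strong approximation *)

Section Approximation.
Variables (k : closedFieldType) (C : curve k).
Implicit Types (O : set C) (x z a b t : C) (p q pi : {poly k}).

Lemma nonunit_split O z p : is_point O -> O z -> p != 0 -> nonunit O (ev z p) ->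
  exists c, nonunit O (z - const C c).
Proof.
move=> PO Oz p0; have [r ->] := closed_field_poly_normal p.
rewrite -mul_polyC evM evC => 
  /(nonunit_prime PO (point_const PO _) (point_ev PO _ Oz))[h|].
  by case: (@const_unit _ _ _ PO (lead_coef p)) => //; rewrite lead_coef_eq0.
rewrite rmorph_prod /= => /(nonunit_prod PO)[c _|c _]; last by rewrite !evE; exists c.
exact: point_ev.
Qed.

Lemma lies_over_XsubC O x c : is_point O -> O x -> nonunit O (x - const C c) ->
  lies_over O x ('X - c%:P).
Proof.
move=> PO Ox mx; split; [by rewrite size_XsubC|by rewrite !evE|move=> p mp].
rewrite dvdp_XsubCl; apply: contrapT => /negP pc; apply: (const_unit PO pc).
have : root (p - p.[c]%:P) c by rewrite /root !hornerE subrr.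
move=> /factor_theorem[q E].
have -> : const C p.[c] = ev x p - ev x q * (x - const C c).
  by rewrite -[X in _ * (X - _)](evX x) -!(evC x) -evB -evM -E -evB subKr.
by apply: nonunitB => //; apply: nonunitMl => //; exact: point_ev.
Qed.

Lemma XsubC_neq0 x c : transcendental x -> x - const C c != 0.
Proof.
by move=> xT; rewrite -(evC x) -{1}(evX x) -evB ev_eq0 // polyXsubC_eq0.
Qed.

Lemma residue_base O x : is_point O -> O x -> finite_over x ->
  exists c, nonunit O (x - const C c).
Proof.
move=> PO Ox fx; have [pi [spi mpi _]] := lies_over_exists PO Ox fx.
by apply: (nonunit_split PO Ox _ mpi); rewrite -size_poly_gt0 (ltn_trans _ spi).
Qed.

(** The residue field is [k]. A relation for [z] that is primitive at ['X - c%:P], with its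
    coefficients evaluated at [c], is a nonzero polynomial over [k] whose value at [z] is a nonunit;
    one of its linear factors is then a nonunit. *)
Lemma residue O z : is_point O -> O z -> exists c, nonunit O (z - const C c).
Proof.
move=> PO Oz; have [x0 fx0] := finite_over_exists C.
have [x [fx Ox _]] := point_contains PO fx0.
have [c mc] := residue_base PO Ox fx.
have sc : (1 < size ('X - c%:P)%R)%N by rewrite size_XsubC.
have [P [[i Pi] Pz]] := finite_over_relation z fx sc.
pose Q := map_poly (horner_eval c) P.
apply: (nonunit_split (p := Q) PO Oz).
  apply/eqP=> /polyP/(_ i); rewrite coef_map coef0 /= => /eqP.
  by rewrite horner_evalE -/(root _ _) -dvdp_XsubCl (negbTE Pi).
have -> : ev z Q = - \sum_(j < size P) (ev x (P`_j) - const C (P`_j).[c]) * z ^+ j.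
  have QE : ev z Q = \sum_(j < size P) const C (P`_j).[c] * z ^+ j.
    rewrite /ev (@horner_coef_wide _ (size P)); last first.
      by rewrite (leq_trans (size_poly _ _)) ?size_poly.
    by apply: eq_bigr => j _; rewrite !coef_map.
  have PE : \sum_(j < size P) ev x (P`_j) * z ^+ j = 0.
    have /eqP := Pz; rewrite (horner_coef_wide _ (size_poly _ _)) => E; rewrite -[RHS]E.
    by apply: eq_bigr => j _; rewrite coef_map.
  rewrite QE -[LHS]opprK; congr (- _); rewrite -[LHS]add0r -[X in X + _]PE -sumrB.
  by apply: eq_bigr => j _; rewrite mulrBl.
apply: nonunitN => //; apply: nonunit_sum => // j _; apply: nonunitMr => //; last exact: pointX.
have : root (P`_j - (P`_j).[c]%:P) c by rewrite /root !hornerE subrr.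
move=> /factor_theorem[q E]; rewrite -(evC x) -evB E !evE.
by apply: nonunitMl => //; exact: point_ev.
Qed.

Lemma nonunit_sub_in O x c : is_point O -> nonunit O (x - const C c) -> O x.
Proof.
move=> PO /nonunit_in h; rewrite -(subrK (const C c) x).
by apply: pointD => //; exact: point_const.
Qed.

(** Among infinitely many points, [n.+1] of them have functions [phi i] that are units at the [i]-th
    point and nonunits at the others. A relation between the [phi i], primitive at ['X - c%:P], then
    fails at a point whose coefficient is a unit. *)
Lemma fiber_finite x c : finite_over x ->
  finite_set [set O : set C | is_point O /\ nonunit O (x - const C c)].
Proof.
move=> fx; apply: contrapT => /infiniteP/ppcard_leP[f].
have fP i : is_point (f i) /\ nonunit (f i) (x - const C c) by exact: (@funS _ _ _ _ f i I).
have fI i j : f i = f j -> i = j by apply: inj; rewrite inE.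
have fx_in i : f i x by case: (fP i) => h1 h2; exact: (nonunit_sub_in h1 h2).
have /choice[u uP] : forall ij : nat * nat, exists u,
    ij.1 <> ij.2 -> [/\ regular x u, ~ nonunit (f ij.1) u & nonunit (f ij.2) u].
  move=> [i j] /=; have [ij|ij] := eqVneq i j; first by exists 0.
  have [] := point_separate fx (fP i).1 (fP j).1 (fx_in i) (fx_in j).
    by move/fI/eqP; rewrite (negbTE ij).
  by move=> u uP; exists u.
have [n dep] := finite_over_dep fx.
pose phi (i : 'I_n.+1) := \prod_(j < n.+1 | j != i) u (i : nat, j : nat).
have [p [pN0 E]] := dep phi.
have sc : (1 < size ('X - c%:P)%R)%N by rewrite size_XsubC.
have {pN0 E}[p' [[i ndv] E]] := normalize_relation fx.1 sc pN0 E.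
have phi_in i' j : f i' (phi j).
  apply: (subring_prod _ (point_subring (fP i').1)) => l lj.
  have [ru _ _] : [/\ regular x (u (j : nat, l : nat)),
      ~ nonunit (f j) (u (j : nat, l : nat)) & nonunit (f l) (u (j : nat, l : nat))].
    by apply: (uP (_, _)) => /= /val_inj jl; rewrite jl eqxx in lj.
  by apply: ru; [exact: (fP i').1|exact: fx_in].
have PO := (fP i).1.
have lo := lies_over_XsubC PO (fx_in i) (fP i).2.
apply: (lies_over_unit lo ndv).
have nphi : ~ nonunit (f i) (phi i).
  move=> /(nonunit_prod PO)[l li|l li].
    have [ru _ _] : [/\ regular x (u (i : nat, l : nat)),
        ~ nonunit (f i) (u (i : nat, l : nat)) & nonunit (f l) (u (i : nat, l : nat))].
      by apply: (uP (_, _)) => /= /val_inj il; rewrite il eqxx in li.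
    by apply: ru => //; exact: fx_in.
  by case: (uP (i : nat, l : nat)) => //= /val_inj il; rewrite il eqxx in li.
have : nonunit (f i) (ev x (p' i) * phi i).
  have -> : ev x (p' i) * phi i = - \sum_(j | j != i) ev x (p' j) * phi j.
    by apply/eqP; rewrite -subr_eq0 opprK -[X in _ == X]E [X in _ == X](bigD1 i).
  apply: nonunitN => //; apply: nonunit_sum => // j ji; apply: nonunitMl => //.
    exact: point_ev.
  rewrite /phi (bigD1 i) 1?eq_sym //=; apply: nonunitMr => //.
    by case: (uP (j : nat, i : nat)) => //= /val_inj ij; rewrite ij eqxx in ji.
  apply: (subring_prod _ (point_subring PO)) => l /andP[lj _].
  have [ru _ _] : [/\ regular x (u (j : nat, l : nat)),
      ~ nonunit (f j) (u (j : nat, l : nat)) & nonunit (f l) (u (j : nat, l : nat))].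
    by apply: (uP (_, _)) => /= /val_inj jl; rewrite jl eqxx in lj.
  by apply: ru => //; exact: fx_in.
by case/(nonunit_prime PO (point_ev PO _ (fx_in i)) (phi_in i i)).
Qed.

(** An approximate idempotent of the fibre: the product of functions separating [O] from the other
    points, divided by its value at [O]. *)
Lemma fiber_separate O x c : is_point O -> finite_over x -> nonunit O (x - const C c) ->
  exists phi, [/\ regular x phi, nonunit O (1 - phi) &
    forall O', is_point O' -> nonunit O' (x - const C c) -> O' <> O -> nonunit O' phi].
Proof.
move=> PO fx mO; have Ox := nonunit_sub_in PO mO.
have [s sE] : exists s : seq (set C), forall O', is_point O' ->
    nonunit O' (x - const C c) -> O' \in s.
  have /finite_seqP[s E] := fiber_finite c fx.
  exists s => O' PO' mO'; suff : [set` s] O' by [].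
  by rewrite -E.
have /choice[u uP] : forall O', exists u, is_point O' -> nonunit O' (x - const C c) ->
    O' <> O -> [/\ regular x u, ~ nonunit O u & nonunit O' u].
  move=> O'; have [[PO' [mO' OO']]|h] :=
    pselect (is_point O' /\ nonunit O' (x - const C c) /\ O' <> O); last first.
    by exists 0 => *; case: h; split.
  have [|u uP] := point_separate fx PO PO' Ox (nonunit_sub_in PO' mO'); last by exists u.
  by move=> h; apply: OO'.
pose good O' := `[< is_point O' /\ nonunit O' (x - const C c) /\ O' <> O >].
pose psi := \prod_(O' <- s | good O') u O'.
have rpsi : regular x psi.
  apply: (subring_prod _ (regular_subring x)).
  by move=> O' /asboolP[h1 [h2 h3]]; case: (uP O').
have npsi : ~ nonunit O psi.
  move=> /(nonunit_prod PO)[] O' /asboolP[h1 [h2 h3]]; case: (uP O') => // ru nu mu.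
  exact: ru.
have Opsi := rpsi O PO Ox.
have [d md] := residue PO Opsi.
have d0 : d != 0.
  by apply/eqP=> d0; apply: npsi; rewrite d0 rmorph0 subr0 in md.
have cd0 : const C d != 0 by rewrite fmorph_eq0.
exists (psi / const C d); split.
- rewrite mulrC -fmorphV; apply: (subringM (regular_subring x)) => //.
  by move=> O' PO' _; exact: point_const.
- have -> : 1 - psi / const C d = - (const C d^-1 * (psi - const C d)).
    by rewrite fmorphV; field.
  by apply: nonunitN => //; apply: nonunitMl => //; exact: point_const.
- move=> O' PO' mO' OO'; rewrite mulrC -fmorphV; apply: nonunitMl => //; first exact: point_const.
  have O's := sE O' PO' mO'.
  have gO' : good O' by apply/asboolP.
  have -> : psi = u O' * \prod_(Q <- rem O' s | good Q) u Q.
    by rewrite /psi (perm_big _ (perm_to_rem O's)) big_cons gO'.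
  have [ru nu mu] := uP O' PO' mO' OO'.
  apply: nonunitMr => //; apply: (subring_prod _ (point_subring PO')).
  move=> Q /asboolP[h1 [h2 h3]]; have [rQ _ _] := uP Q h1 h2 h3.
  by apply: rQ => //; exact: (nonunit_sub_in PO' mO').
Qed.

Lemma regular_other_fiber O x c a : is_point O -> O x -> ~ nonunit O (x - const C c) ->
  O a -> forall M, O (a / (x - const C c) ^+ M).
Proof.
move=> PO Ox nO Oa M; apply: point_mul => //; rewrite -exprVn; apply: pointX => //.
by apply: unit_inv => //; apply: point_sub => //; exact: point_const.
Qed.

(* Prescribes the principal part [a] at [O]; poles at the poles of [x] are allowed. *)
Lemma principal_part O x a : is_point O -> O x -> finite_over x ->
  exists f, O (f - a) /\ forall O', is_point O' -> O' x -> O' <> O -> O' f.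
Proof.
move=> PO Ox fx; have [c mc] := residue_base PO Ox fx.
set t := x - const C c in mc.
have t0 : t != 0 by exact: XsubC_neq0 fx.1.
have [phi [rphi mphi oth]] := fiber_separate PO fx mc.
have [N NP] := uniform_exponent fx.
have tE : ev x ('X - c%:P) = t by rewrite !evE.
have [q [q0 rqa]] := regular_denominator a fx.
have [M [q' q'c qE]] := multiplicity_XsubC q c.
move: q'c; rewrite q0 implyTb => q'c.
have cop : coprimep (('X - c%:P) ^+ M) q'.
  by apply: coprimep_expl; rewrite coprimep_sym coprimep_XsubC.
(* Partial fractions: [s * q'] is 1 modulo [('X - c%:P) ^+ M], and it removes the poles of [a] over
   the other values of [x]. *)
have [w [s ws]] : exists w s, w * ('X - c%:P) ^+ M + s * q' = 1.
  by have /Bezout_eq1_coprimepP[[w s] E] := cop; exists w, s.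
have {ws}ws : ev x w * t ^+ M + ev x s * ev x q' = 1 by rewrite -tE -evXn -!evM -evD ws ev1.
(* An [N]-th power of a nonunit of the fibre is divisible by [t], so an [e]-th power is divisible by
   [t ^+ M]. Now [E] is a multiple of [phi ^+ e] and [1 - E] one of [(1 - phi) ^+ e]: modulo
   [t ^+ M], [E] is 0 at the other points of the fibre and 1 at [O]. *)
pose e := (N * M)%N.
pose E := 1 - (1 - phi ^+ e) ^+ e.
have powN O' psi : is_point O' -> nonunit O' t -> nonunit O' psi -> O' (psi ^+ e / t ^+ M).
  move=> PO' mt mpsi; have O'x := nonunit_sub_in PO' mt.
  rewrite /e exprM -expr_div_n; apply: pointX => //; rewrite -tE.
  by apply: NP => //; exact: lies_over_XsubC.
have rE : regular x E.
  have r1 : regular x 1 by exact: subring1 (regular_subring x).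
  do 2?[apply: (subringB (regular_subring x)) => //; apply: (subringX _ (regular_subring x))] => //.
have rt : regular x t by rewrite -tE; exact: regular_ev.
have divE (S : set C) y n : is_subring S -> S y -> exists2 u, S u & 1 - (1 - y) ^+ n = y * u.
  move=> SS Sy; elim: n => [|n [u Su IH]].
    by exists 0; rewrite ?mulr0 ?subrr //; exact: subring0.
  exists (u + (1 - y) ^+ n); last by rewrite mulrDr -IH exprSr; ring.
  by apply: (subringD SS) => //; apply: (subringX _ SS); apply: (subringB SS) => //; exact: subring1 SS.
have qxE : ev x q = ev x q' * t ^+ M by rewrite qE !evE.
have Oev O' p : is_point O' -> O' x -> O' (ev x p) by move=> PO' O'x; exact: (point_ev PO').
exists (ev x s * ev x q' * a * E); split.
  have nq' : ~ nonunit O (ev x q').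
    apply: (lies_over_unit (lies_over_XsubC PO Ox mc)).
    by rewrite dvdp_XsubCl.
  have Ota : O (t ^+ M * a).
    apply: (point_mulr_unit PO (Oev O q' PO Ox) nq').
    by rewrite mulrA -qxE; exact: rqa.
  have [u' Ou' E'] := divE O (1 - phi) e (point_subring PO) (nonunit_in mphi).
  have -> : ev x s * ev x q' * a * E - a =
      - (ev x s * ev x q' * (((1 - phi) ^+ e / t ^+ M) * u' ^+ e * (t ^+ M * a)))
      - ev x w * (t ^+ M * a).
    have E2 : E = 1 - ((1 - phi) * u') ^+ e by rewrite -E' subKr.
    have -> : ev x w * (t ^+ M * a) = (1 - ev x s * ev x q') * a by rewrite -ws; ring.
    by rewrite E2 exprMn; field; rewrite expf_neq0.
  apply: point_sub => //; last by apply: point_mul => //; exact: Oev.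
  apply: pointN => //; apply: point_mul => //; first by apply: point_mul => //; exact: Oev.
  by do 2?apply: point_mul => //; [exact: powN|exact: pointX].
move=> O' PO' O'x O'O.
have [mt|nt] := pselect (nonunit O' t).
  have [u Ou Eu] := divE O' (phi ^+ e) e (point_subring PO') (pointX PO' e (rphi O' PO' O'x)).
  have -> : ev x s * ev x q' * a * E =
      ev x s * (ev x q * a) * (phi ^+ e / t ^+ M * u).
    by rewrite /E Eu qxE; field; rewrite expf_neq0.
  do 2?apply: point_mul => //; [exact: Oev|exact: rqa|].
  by apply: powN => //; exact: oth.
have -> : ev x s * ev x q' * a * E = ev x s * (ev x q * a) * E / t ^+ M.
  by rewrite qxE; field; rewrite expf_neq0.
apply: regular_other_fiber => //; do 2?apply: point_mul => //; [exact: Oev|exact: rqa|].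
exact: rE.
Qed.

(** The principal parts at the finitely many exceptional points add up, each being regular at every
    other point where [x] is. *)
Lemma strong_approximation x (a : set C -> C) : finite_over x -> repartition a ->
  exists f, forall O, is_point O -> O x -> O (a O - f).
Proof.
move=> fx /finite_seqP[s sE].
have /choice[g gP] : forall O, exists g, is_point O -> O x ->
    O (g - a O) /\ forall O', is_point O' -> O' x -> O' <> O -> O' g.
  move=> O; have [[PO Ox]|h] := pselect (is_point O /\ O x).
    by have [g gP] := principal_part (a O) PO Ox fx; exists g.
  by exists 0 => PO Ox; case: h.
pose good O := `[< is_point O /\ O x >].
(* A repeated point would contribute its principal part twice. *)
pose s' := undup s.
exists (\sum_(O <- s' | good O) g O) => O PO Ox.
have go : good O by apply/asboolP.
have sum_in (r : seq (set C)) : O \notin r -> O (\sum_(Q <- r | good Q) g Q).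
  move=> Or; rewrite big_seq_cond; apply: subring_sum; first exact: point_subring.
  move=> Q /andP[Qr /asboolP[PQ Qx]]; have [_ h] := gP Q PQ Qx; apply: h => // OQ.
  by move: Or; rewrite OQ Qr.
have [Os|Os] := boolP (O \in s').
  have -> : \sum_(Q <- s' | good Q) g Q = g O + \sum_(Q <- rem O s' | good Q) g Q.
    by rewrite (perm_big _ (perm_to_rem Os)) big_cons go.
  rewrite opprD addrA; apply: point_sub => //; last first.
    by apply: sum_in; rewrite mem_rem_uniqF // undup_uniq.
  by rewrite -opprB; apply: pointN => //; case: (gP O PO Ox).
apply: point_sub => //; last exact: sum_in.
apply: contrapT => nO; move/negP: Os; apply; rewrite mem_undup.
suff : [set` s] O by [].
by rewrite -sE.
Qed.

End Approximation.

(** * Rational functions of a transcendental element, and its poles *)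

Section Rational.
Variables (k : fieldType) (C : curve k).
Implicit Types (O : set C) (x z a b f : C) (p q : {poly k}).

Lemma frac_lift x : transcendental x ->
  exists Phi : {rmorphism {fraction {poly k}} -> C}, forall p, Phi (tofrac p) = ev x p.
Proof.
move=> xT.
have /choice[h hP] : forall z : {fraction {poly k}}, exists w : C, forall p q,
    tofrac q * z = tofrac p -> ev x q * w = ev x p.
  move=> z; have [p0 [q0 [q00 E0]]] := P1_fraction z.
  exists (ev x p0 / ev x q0) => p q E.
  have eq0 : ev x q0 != 0 by rewrite ev_eq0.
  have : q0 * p = q * p0.
    by apply/eqP; rewrite -tofrac_eq !tofracM -E -E0 mulrCA.
  move/(congr1 (ev x)); rewrite !evM => E1; apply: (mulfI eq0); rewrite E1.
  by field.
have zm : zmod_morphism h.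
  move=> z1 z2.
  have [p1 [q1 [q10 E1]]] := P1_fraction z1; have [p2 [q2 [q20 E2]]] := P1_fraction z2.
  have e1 : ev x q1 != 0 by rewrite ev_eq0.
  have e2 : ev x q2 != 0 by rewrite ev_eq0.
  have := hP (z1 - z2) (p1 * q2 - p2 * q1) (q1 * q2).
  rewrite tofracB !tofracM -E1 -E2 => /(_ ltac:(ring)).
  rewrite evB !evM -(hP z1 p1 q1 E1) -(hP z2 p2 q2 E2) => E.
  by apply: (mulfI (mulf_neq0 e1 e2)); rewrite E; ring.
have mm : monoid_morphism h.
  split.
    by have := hP 1 1 1; rewrite mulr1 ev1 mul1r; apply.
  move=> z1 z2.
  have [p1 [q1 [q10 E1]]] := P1_fraction z1; have [p2 [q2 [q20 E2]]] := P1_fraction z2.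
  have e1 : ev x q1 != 0 by rewrite ev_eq0.
  have e2 : ev x q2 != 0 by rewrite ev_eq0.
  have := hP (z1 * z2) (p1 * p2) (q1 * q2).
  rewrite !tofracM -E1 -E2 => /(_ ltac:(ring)).
  rewrite !evM -(hP z1 p1 q1 E1) -(hP z2 p2 q2 E2) => E.
  by apply: (mulfI (mulf_neq0 e1 e2)); rewrite E; ring.
pose z_ := GRing.isZmodMorphism.Build _ _ h zm.
pose m_ := GRing.isMonoidMorphism.Build _ _ h mm.
pose Phi : {rmorphism {fraction {poly k}} -> C} := HB.pack h z_ m_.
by exists Phi => p; have := hP (tofrac p) p 1; rewrite tofrac1 mul1r ev1 mul1r; apply.
Qed.

Lemma ev_swapXY x y (P : {poly {poly k}}) :
  (map_poly (ev x) P).[y] = (map_poly (ev y) (swapXY P)).[x].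
Proof.
have E u v (S : {poly {poly k}}) : (map_poly (ev u) S).[v] =
    (swapXY (map_poly (map_poly (const C)) S)).[u%:P].[v].
  by rewrite horner_swapXY -map_poly_comp.
by rewrite !E (horner2_swapXY _ y x) swapXY_map.
Qed.

(** Exchange: a relation of [f] over [k[x]], read through [swapXY], makes [x] algebraic over [k(f)];
    so [z], which is algebraic over [k(x)], is algebraic over [k(f)]. *)
Lemma transcendental_relation f z : transcendental f ->
  exists P : {poly {poly k}}, P != 0 /\ root (map_poly (ev f) P) z.
Proof.
move=> fT; have [Phi PhiE] := frac_lift fT.
have [x fx] := finite_over_exists C.
have rel y : exists P : {poly {poly k}}, P != 0 /\ root (map_poly (ev x) P) y.
  have sX : (1 < size ('X : {poly k}))%N by rewrite size_polyX.
  have [P [[i Pi] Py]] := finite_over_relation y fx sX; exists P; split=> //.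
  by apply/eqP=> P0; move: Pi; rewrite P0 coef0 dvdp0.
have xA : algebraicOver Phi x.
  have [P [P0 Pf]] := rel f; pose S := swapXY P.
  have S0 : S != 0 by rewrite swapXY_eq0.
  exists (map_poly (@tofrac _) S).
    by rewrite map_poly_eq0_id0 // tofrac_eq0 lead_coef_eq0.
  have -> : map_poly Phi (map_poly (@tofrac _) S) = map_poly (ev f) S.
    by apply/polyP=> i; rewrite !coef_map /= PhiE.
  by rewrite /root -ev_swapXY.
have zI : integralOver Phi z.
  have [P [P0 Pz]] := rel z.
  apply: (integral_root (p := map_poly (ev x) P)) => //.
    by rewrite map_poly_eq0_id0 // ev_eq0 ?lead_coef_eq0 //; exact: fx.1.
  apply/integral_poly => i; rewrite coef_map /=; apply: integral_horner.
    apply/integral_poly => j; rewrite coef_map /= -(evC f) -PhiE.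
    exact: integral_id.
  by apply/integral_algebraic.
have /integral_algebraic[Q Q0 Qz] := zI.
have /choice[pq pqP] : forall j, exists pq : {poly k} * {poly k},
    pq.2 != 0 /\ tofrac pq.2 * Q`_j = tofrac pq.1.
  by move=> j; have [p [q [q0 E]]] := P1_fraction Q`_j; exists (p, q).
pose D := \prod_(j < size Q) (pq j).2.
have D0 : D != 0 by apply/prodf_neq0 => j _; case: (pqP j).
pose P := \poly_(j < size Q)
  ((pq j).1 * \prod_(i < size Q | i != j :> nat) (pq i).2).
have PE : map_poly (@tofrac _) P = tofrac D *: Q.
  apply/polyP=> j; rewrite coef_map coefZ /= coef_poly; case: ltnP => jQ; last first.
    by rewrite tofrac0 nth_default // mulr0.
  rewrite tofracM -(pqP j).2 mulrAC -tofracM; congr (tofrac _ * _).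
  by rewrite /D [RHS](bigD1 (Ordinal jQ)).
exists P; split.
  apply/eqP=> P0; move/eqP: PE; rewrite P0 map_poly0 eq_sym scaler_eq0 tofrac_eq0.
  by rewrite (negbTE D0) (negbTE Q0).
have -> : map_poly (ev f) P = map_poly Phi (map_poly (@tofrac _) P).
  by apply/polyP=> i; rewrite !coef_map /= PhiE.
by rewrite PE map_polyZ /root hornerZ (eqP Qz) mulr0.
Qed.

(** A transcendental element is not integral over the constants, so some valuation ring containing
    the constants omits it. *)
Lemma infinite_point_exists x : transcendental x -> exists O, is_point O /\ ~ O x.
Proof.
move=> xT; have [||P Pm Pc Px|O [PO _ Ox]] :=
    @point_exists _ C (range (const C)) x; last by exists O.
- split; first by exists 1; rewrite ?rmorph1.
    by move=> _ _ [a _ <-] [b _ <-]; exists (a - b); rewrite ?rmorphB.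
  by move=> _ _ [a _ <-] [b _ <-]; exists (a * b); rewrite ?rmorphM.
- by move=> c; exists c.
have /choice[c cP] : forall i, exists c, const C c = P`_i.
  by move=> i; have [c _ E] := Pc i; exists c.
apply: xT; exists (\poly_(i < size P) c i); last first.
  have -> // : map_poly (const C) (\poly_(i < size P) c i) = P.
  apply/polyP=> i; rewrite coef_map /= coef_poly; case: ltnP => h; first exact: cP.
  by rewrite rmorph0 nth_default.
apply/eqP=> /polyP/(_ (size P).-1); rewrite coef_poly coef0.
have P0 := monic_neq0 Pm; rewrite prednK ?size_poly_gt0 // leqnn => c0.
have := cP (size P).-1; rewrite c0 rmorph0 -lead_coefE => /esym/eqP.
by rewrite lead_coef_eq0 (negbTE P0).
Qed.

Lemma zero_point_exists x c : transcendental x ->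
  exists O, is_point O /\ nonunit O (x - const C c).
Proof.
move=> xT.
have [|O [PO nO]] := @infinite_point_exists (x - const C c)^-1.
  apply: transcendentalV => h; apply: xT; rewrite -(subrK (const C c) x).
  by apply: algebraic_add => //; exact: algebraic_id.
by exists O; split=> //; have := nonunit_inv PO nO; rewrite invrK.
Qed.

(* At a pole of [x], a polynomial in [x] has the order of its leading term. *)
Lemma ev_infinity O x p : is_point O -> ~ O x -> p != 0 ->
  exists u, [/\ O u, ~ nonunit O u & ev x p = x ^+ (size p).-1 * u].
Proof.
move=> PO nx p0; have sp : size p = (size p).-1.+1 by rewrite prednK // size_poly_gt0.
have x0 := notin_nonunit PO nx; have mx := nonunit_inv PO nx.
exists (ev x^-1 (\poly_(j < (size p).-1.+1) p`_((size p).-1 - j))).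
have Ox := nonunit_in mx.
split; [exact: point_ev| |by rewrite -ev_rev // -sp].
set r := \poly_(j < _) _.
have : root (r - (r`_0)%:P) 0 by rewrite /root !hornerE -horner_coef0 subrr.
move=> /factor_theorem[q]; rewrite subr0 => E.
have -> : ev x^-1 r = const C r`_0 + ev x^-1 q * x^-1.
  by rewrite -[X in _ + _ * X]evX -(evC x^-1) -evM -E -evD addrC subrK.
apply: unitD => //; first exact: point_const.
  apply: const_unit => //; rewrite coef_poly /= subn0.
  by rewrite -lead_coefE lead_coef_eq0.
by apply: nonunitMl => //; exact: point_ev.
Qed.

Lemma ev_infinity_le O x p q : is_point O -> ~ O x -> q != 0 ->
  (size p <= size q)%N -> O (ev x p / ev x q).
Proof.
move=> PO nx q0 le; have [->|p0] := eqVneq p 0; first by rewrite ev0 mul0r; exact: point0.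
have [u [Ou nu ->]] := ev_infinity PO nx p0; have [v [Ov nv ->]] := ev_infinity PO nx q0.
have x0 := notin_nonunit PO nx; have v0 := unit_neq0 PO nv.
have -> : (size q).-1 = ((size p).-1 + ((size q).-1 - (size p).-1))%N.
  by rewrite subnKC // -!subn1 leq_sub2r.
rewrite exprD; set n := (_ - _)%N.
have -> : x ^+ (size p).-1 * u / (x ^+ (size p).-1 * x ^+ n * v) = x^-1 ^+ n * (u * v^-1).
  by rewrite exprVn; field; rewrite v0 !expf_neq0.
do 2?apply: point_mul => //; last exact: unit_inv.
by apply: pointX => //; exact: nonunit_in (nonunit_inv PO nx).
Qed.

Lemma ev_infinity_lt O x p q : is_point O -> ~ O x -> q != 0 ->
  (size p < size q)%N -> nonunit O (ev x p / ev x q).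
Proof.
move=> PO nx q0 lt.
have -> : ev x p / ev x q = x^-1 * (ev x (p * 'X) / ev x q).
  by rewrite evM evX; field; rewrite (notin_nonunit PO nx) /=;
    have [v [_ nv ->]] := ev_infinity PO nx q0;
    rewrite mulf_neq0 ?expf_neq0 ?(notin_nonunit PO nx) ?(unit_neq0 PO nv).
apply: nonunitMr => //; first exact: nonunit_inv.
apply: ev_infinity_le => //; have [->|p0] := eqVneq p 0; first by rewrite mul0r size_poly0.
by rewrite size_mulX.
Qed.

Lemma ev_infinity_in O x p q : is_point O -> ~ O x -> q != 0 ->
  O (ev x p / ev x q) -> (size p <= size q)%N.
Proof.
move=> PO nx q0 Opq; rewrite leqNgt; apply/negP=> lt.
have p0 : p != 0 by rewrite -size_poly_gt0 (leq_ltn_trans _ lt).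
have := ev_infinity_lt PO nx p0 lt; rewrite -[_ / _]invf_div => m.
apply: (nonunit_notin m); last by rewrite invrK.
have [u [_ nu ->]] := ev_infinity PO nx p0; have [v [_ nv ->]] := ev_infinity PO nx q0.
have x0 := notin_nonunit PO nx.
by rewrite invr_eq0 !mulf_neq0 ?invr_eq0 ?mulf_neq0 ?expf_neq0 ?(unit_neq0 PO nu) ?(unit_neq0 PO nv).
Qed.

End Rational.

(** * The genus *)

Section Genus.
Variables (k : fieldType) (C : curve k).
Implicit Types (O : set C) (a : set C -> C).

(* The class of [a] modulo regular and constant repartitions has coordinates [c] on [r]. *)
Definition h1_coord n (r : 'I_n -> set C -> C) a (c : 'rV[k]_n) := exists f : C,
  forall O, is_point O -> O (a O - \sum_(i < n) const C (c 0 i) * r i O - f).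

Lemma h1_coord_self n (r : 'I_n -> set C -> C) i : h1_coord r (r i) (delta_mx 0 i).
Proof.
exists 0 => O PO; rewrite (bigD1 i) //= mxE !eqxx rmorph1 mul1r big1 => [|j ji].
  by rewrite addr0 subrr subr0; exact: point0.
by rewrite mxE (negbTE ji) andbF rmorph0 mul0r.
Qed.

Lemma h1_coord_trans n m (r : 'I_n -> set C -> C) (r' : 'I_m -> set C -> C) a c
    (M : 'M[k]_(m, n)) :
  h1_coord r' a c -> (forall j, h1_coord r (r' j) (row j M)) -> h1_coord r a (c *m M).
Proof.
move=> [f fP] /choice[g gP]; exists (f + \sum_j const C (c 0 j) * g j) => O PO.
have -> : a O - \sum_(i < n) const C ((c *m M) 0 i) * r i O - (f + \sum_j const C (c 0 j) * g j) =
    (a O - \sum_j const C (c 0 j) * r' j O - f) +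
    \sum_j const C (c 0 j) * (r' j O - \sum_(i < n) const C (row j M 0 i) * r i O - g j).
  have -> : \sum_(i < n) const C ((c *m M) 0 i) * r i O =
      \sum_j const C (c 0 j) * \sum_(i < n) const C (row j M 0 i) * r i O.
    transitivity (\sum_(i < n) \sum_j const C (c 0 j) * (const C (row j M 0 i) * r i O)).
      apply: eq_bigr => i _; rewrite mxE rmorph_sum mulr_suml; apply: eq_bigr => j _.
      by rewrite rmorphM mulrA mxE.
    by rewrite exchange_big; apply: eq_bigr => j _; rewrite mulr_sumr.
  under [X in _ = _ + X]eq_bigr do rewrite !mulrBr.
  by rewrite !sumrB; ring.
apply: pointD => //; first exact: fP.
apply: subring_sum => [|j _]; first exact: point_subring.
by apply: point_mul => //; [exact: point_const|exact: gP].
Qed.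

(** Because coordinates are unique, the matrices expressing the two families on each other have
    product 1. *)
Lemma has_genus_unique g g' : has_genus C g -> has_genus C g' -> g = g'.
Proof.
suff h n m : has_genus C n -> has_genus C m -> (n <= m)%N.
  by move=> h1 h2; apply/eqP; rewrite eqn_leq !h.
move=> [r [rr rP]] [r' [rr' rP']].
have /choice[N NP] : forall i, exists c, h1_coord r' (r i) c.
  by move=> i; have [c [cP _]] := rP' _ (rr i); exists c.
have /choice[M MP] : forall i, exists c, h1_coord r (r' i) c.
  by move=> i; have [c [cP _]] := rP _ (rr' i); exists c.
apply: (@mulmx1_min _ n m (\matrix_i N i) (\matrix_i M i)).
apply/row_matrixP => i; rewrite row_mul rowK row1.
have [c [_ cU]] := rP _ (rr i).
rewrite -(cU (delta_mx 0 i)); last exact: h1_coord_self.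
apply/esym; apply: cU; apply: (h1_coord_trans (NP i)) => j.
by rewrite rowK.
Qed.

Lemma has_genus_basis g (r : 'I_g -> set C -> C) :
  (forall i, repartition (r i)) -> (forall a, repartition a -> exists c, h1_coord r a c) ->
  (forall (c : 'rV[k]_g) f,
    (forall O, is_point O -> O (\sum_(i < g) const C (c 0 i) * r i O + f)) -> c = 0) ->
  has_genus C g.
Proof.
move=> rr span indep; exists r; split=> // a /span[c cP]; exists c; split=> // c' [f' cf'].
have [f cf] := cP; apply/eqP; rewrite -subr_eq0; apply/eqP.
apply: (indep _ (f - f')) => O PO.
have -> : \sum_(i < g) const C ((c - c') 0 i) * r i O + (f - f') =
  (a O - \sum_(i < g) const C (c' 0 i) * r i O - f') -
  (a O - \sum_(i < g) const C (c 0 i) * r i O - f).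
  under eq_bigr do rewrite !mxE rmorphB mulrBl.
  by rewrite sumrB; ring.
by apply: point_sub => //; [exact: cf'|exact: cf].
Qed.

(** If no nonunit generates the maximal ideal, every nonunit is divisible by the [2 ^ j]-th power of
    another one; for [ev x pi] this contradicts [uniform_exponent], since [n < 2 ^ n]. *)
Lemma uniformizer O : is_point O -> exists t,
  [/\ t != 0, nonunit O t & forall b, nonunit O b -> O (b / t)].
Proof.
move=> PO; apply: contrapT => nt.
have ext t : t != 0 -> nonunit O t -> exists b, [/\ b != 0, nonunit O b & nonunit O (t / b)].
  move=> t0 mt; apply: contrapT => nb; apply: nt; exists t; split=> // b mb.
  have [->|b0] := eqVneq b 0; first by rewrite mul0r; exact: point0.
  apply: contrapT => h; apply: nb; exists b; split=> //.
  by rewrite -invf_div; exact: nonunit_inv.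
have pow j t : t != 0 -> nonunit O t ->
    exists b, [/\ b != 0, nonunit O b & O (t / b ^+ (2 ^ j)%N)].
  elim: j t => [|j IH] t t0 mt; first by exists t; rewrite expr1 divff //; split=> //; exact: point1.
  have [b [b0 mb mtb]] := ext t t0 mt.
  (* [t] is the product of [b] and [t / b], so the square of the one of smaller order divides it. *)
  have [d [d0 md Od]] : exists d, [/\ d != 0, nonunit O d & O (t / d ^+ 2)].
    case: (point_val PO (t / b / b)) => h.
      by exists b; split=> //; rewrite expr2 invfM mulrA.
    exists (t / b); split=> //; first by rewrite mulf_neq0 ?invr_eq0.
    have -> : t / (t / b) ^+ 2 = (t / b / b)^-1 by field; rewrite t0 b0.
    by [].
  have [e [e0 me Oe]] := IH d d0 md; exists e; split=> //.
  have -> : t / e ^+ (2 ^ j.+1) = (t / d ^+ 2) * (d / e ^+ (2 ^ j)) ^+ 2.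
    by rewrite expnSr exprM; field; rewrite d0 expf_neq0.
  by apply: point_mul => //; exact: pointX.
have [x0 fx0] := finite_over_exists C.
have [x [fx Ox _]] := point_contains PO fx0.
have [pi lo] := lies_over_exists PO Ox fx; have [n nP] := uniform_exponent fx.
have t0 := lies_over_neq0 fx lo; have [_ mt _] := lo.
have [b [b0 mb Ob]] := pow n _ t0 mt.
have h := nP O pi b PO Ox lo mb; have lt : (n < 2 ^ n)%N by exact: ltn_expl.
have mb' : nonunit O (b ^+ (2 ^ n - n)) by apply: nonunitX => //; rewrite subn_gt0.
apply: (nonunit_notin mb'); first by rewrite expf_neq0.
have -> : (b ^+ (2 ^ n - n))^-1 = ev x pi / b ^+ (2 ^ n) * (b ^+ n / ev x pi).
  have -> : b ^+ (2 ^ n) = b ^+ (2 ^ n - n) * b ^+ n by rewrite -exprD subnK // ltnW.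
  by field; rewrite t0 !expf_neq0.
exact: point_mul.
Qed.

End Genus.

Lemma polynomial_part (k : fieldType) (C : curve k) (O : set C) (x a : C) (p q : {poly k}) :
  transcendental x -> is_point O -> ~ O x -> q != 0 -> ev x q * a = ev x p ->
  O (a - ev x (p %/ q)).
Proof.
move=> xT PO nx q0 E; have eq0 : ev x q != 0 by rewrite ev_eq0.
have -> : a - ev x (p %/ q) = ev x (p %% q) / ev x q.
  by apply: (mulfI eq0); rewrite mulrBr E {1}(divp_eq p q) !evE; field.
by apply: ev_infinity_le => //; rewrite ltnW // ltn_modp.
Qed.

Section AlgebraicallyClosed.
Variables (k : closedFieldType) (C : curve k).
Implicit Types (O : set C) (x z f : C).

Lemma algebraic_const z : algebraicOver (const C) z -> exists c, z = const C c.
Proof.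
move=> [p p0 pz]; have [r pE] := closed_field_poly_normal p; move: pz.
rewrite pE map_polyZ rmorph_prod /= rootZ ?fmorph_eq0 ?lead_coef_eq0 //.
elim: r {pE} => [|c r IH]; first by rewrite big_nil /root hornerC oner_eq0.
rewrite big_cons rootM => /orP[|//]; rewrite rmorphB /= map_polyX map_polyC /= root_XsubC.
by move/eqP ->; exists c.
Qed.

Lemma regular_everywhere_const z : (forall O, is_point O -> O z) -> exists c, z = const C c.
Proof.
move=> reg; apply: algebraic_const; apply: contrapT => zT.
by have [O [PO]] := infinite_point_exists zT; apply; exact: reg.
Qed.

Lemma const_or_transcendental z : (exists c, z = const C c) \/ transcendental z.
Proof.
have [h|h] := pselect (algebraicOver (const C) z); [left|by right].
exact: algebraic_const.
Qed.

(** As H^1 vanishes, the principal part [t^-1] at one point [P] is that of a global [f], whose only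
    pole is simple and at [P]. Subtracting multiples of powers of [f] shows that a function with
    poles only at [P] is a polynomial in [f], and a denominator in [k[f]] brings any [z] to this
    case. *)
Lemma genus0_generator : has_genus C 0 ->
  exists f, transcendental f /\ forall z, exists p q, q != 0 /\ ev f q * z = ev f p.
Proof.
move=> [r [_ rP]].
have [x fx] := finite_over_exists C.
have [P [PP _]] := infinite_point_exists fx.1.
have [t [t0 mt tP]] := uniformizer PP.
have tV : ~ P t^-1 by exact: nonunit_notin.
pose a O : C := if `[< O = P >] then t^-1 else 0.
have [|c [[f fP] _]] := rP a.
  apply: (sub_finite_set _ (finite_set1 P)) => O [PO nO]; apply: contrapT => OP; apply: nO.
  by rewrite /a asboolF //; exact: point0.
have fO O : is_point O -> O <> P -> O f.
  move=> PO OP; have := fP O PO; rewrite big_ord0 /a asboolF // subr0 sub0r.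
  by move/(pointN PO); rewrite opprK.
have ft : P (t^-1 - f) by have := fP P PP; rewrite big_ord0 /a asboolT // subr0.
have fN : ~ P f by move=> Pf; apply: tV; rewrite -(subrK f t^-1); exact: pointD.
have fT : transcendental f.
  by case: (const_or_transcendental f) => // -[d fE]; case: fN; rewrite fE; exact: point_const.
have f0 := transcendental_neq0 fT.
have ftE : t * f = 1 + - (t * (t^-1 - f)) by field.
have ftP : P (t * f).
  rewrite ftE; apply: pointD => //; first exact: point1.
  by apply: pointN => //; apply: point_mul => //; exact: nonunit_in.
have ftu : P (t * f)^-1.
  apply: unit_inv => //; rewrite ftE; apply: unitD => //; [exact: point1|exact: nonunit1|].
  by apply: nonunitN => //; exact: nonunitMr.
have poly n z : P (t ^+ n * z) -> (forall O, is_point O -> O <> P -> O z) ->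
    exists p, z = ev f p.
  elim: n z => [|n IH] z Pz rz.
    have [|d zE] := @regular_everywhere_const z; last by exists d%:P; rewrite evC.
    move=> O PO; have [->|OP] := pselect (O = P); last exact: rz.
    by rewrite mul1r in Pz.
  pose y := z / f ^+ n.+1.
  have Py : P y.
    have -> : y = (t * f)^-1 ^+ n.+1 * (t ^+ n.+1 * z).
      by rewrite /y exprVn exprMn; field; rewrite !expf_neq0.
    by apply: point_mul => //; exact: pointX.
  (* [d] is the leading coefficient of [z] in terms of [f]; removing [d * f ^+ n.+1] lowers the
     allowed pole order by one. *)
  have [d md] := residue PP Py.
  have [||p pE] := IH (z - const C d * f ^+ n.+1).
  - have -> : t ^+ n * (z - const C d * f ^+ n.+1) =
        (t * f) ^+ n.+1 * ((y - const C d) / t).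
      by rewrite /y exprMn (exprS t); field; rewrite t0 expf_neq0.
    by apply: point_mul => //; [exact: pointX|exact: tP].
  - move=> O PO OP; apply: point_sub => //; first exact: rz.
    by apply: point_mul => //; [exact: point_const|apply: pointX => //; exact: fO].
  exists (p + d%:P * 'X^(n.+1)); rewrite !evE -pE; ring.
exists f; split=> // z; have [Q [Q0 Qz]] := transcendental_relation z fT.
have [N PN] := point_absorb (ev f (lead_coef Q) * z) PP mt.
have [O PO OP|p pE] := poly N _ PN.
  by apply: (regular_lead_coef Q0 Qz) => //; exact: fO.
by exists p, (lead_coef Q); rewrite lead_coef_eq0 -pE.
Qed.

End AlgebraicallyClosed.

(** Strong approximation settles all points but the pole of [x]; a polynomial corrects that one and
    stays regular at the others. The pole is unique because membership of a fraction there is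
    decided by degrees. *)
Lemma P1_genus0 (k : closedFieldType) : has_genus (P1 k) 0.
Proof.
exists (fun _ _ => 0); split=> [[]//|a ra].
pose x : P1 k := tofrac 'X.
have xT : transcendental x by exact: P1_transcendental.
have evP (p : {poly k}) : ev x p = tofrac p by exact: P1_horner.
have fx : finite_over x.
  split=> //; exists 1%N, (fun=> 1) => z; have [p [q [q0 qz]]] := P1_fraction z.
  by exists q, (fun=> p); rewrite q0 big_ord1 mulr1 !evP.
have [f0 f0P] := strong_approximation fx ra.
have [P [PP nx]] := infinite_point_exists xT.
have inP O : is_point O -> ~ O x -> O = P.
  move=> PO Ox; apply: point_maximal => // z Oz.
  have [p [q [q0 qz]]] := P1_fraction z.
  have zE : z = ev x p / ev x q.
    by rewrite !evP -qz mulrAC divff ?mul1r // tofrac_eq0.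
  rewrite zE; apply: ev_infinity_le => //; apply: (ev_infinity_in PO Ox q0).
  by rewrite -zE.
have [s sP] : exists s, P (a P - f0 - ev x s).
  have [p [q [q0 qz]]] := P1_fraction (a P - f0); exists (p %/ q).
  by apply: polynomial_part => //; rewrite !evP.
exists 0; split=> [|c _]; last by apply/rowP; case.
exists (f0 + ev x s) => O PO; rewrite big_ord0 subr0 opprD addrA.
have [Ox|Ox] := pselect (O x); last by rewrite (inP O PO Ox).
by apply: point_sub => //; [exact: f0P|exact: point_ev].
Qed.

Lemma fiber_poly_finite (k : closedFieldType) (C : curve k) (x : C) (p : {poly k}) :
  finite_over x -> p != 0 ->
  finite_set [set O : set C | [/\ is_point O, O x & nonunit O (ev x p)]].
Proof.
move=> fx p0; have [r pE] := closed_field_poly_normal p.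
suff : finite_set [set O : set C | is_point O /\ exists2 c, c \in r & nonunit O (x - const C c)].
  apply: sub_finite_set => O [PO Ox]; rewrite pE -mul_polyC evM evC.
  case/(nonunit_prime PO (point_const PO _) (point_ev PO _ Ox)).
    by move=> h; case: (const_unit PO _ h); rewrite lead_coef_eq0.
  rewrite big_seq rmorph_prod /= => /(nonunit_prod PO)[c cr|c cr]; first exact: point_ev.
  by rewrite !evE => mc; split=> //; exists c.
elim: r {p0 pE} => [|c r IH].
  by apply: (sub_finite_set _ (finite_set0 _)) => O [_ []].
apply: (sub_finite_set _ (_ : finite_set
  ([set O : set C | is_point O /\ nonunit O (x - const C c)] `|` _))); last first.
  by rewrite finite_setU; split; [exact: fiber_finite|exact: IH].
move=> O [PO [d]]; rewrite inE => /orP[/eqP->|dr] md; first by left.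
by right; split=> //; exists d.
Qed.

(** * Base change to the algebraic closure *)

Section IndependentFamilies.
Variables (K : fieldType) (L : fieldType) (iota : {rmorphism K -> L}).

Definition independent n (d : 'I_n -> L) :=
  forall c : 'I_n -> K, \sum_i iota (c i) * d i = 0 -> forall i, c i = 0.

Definition in_span n (d : 'I_n -> L) e := exists c : 'I_n -> K, e = \sum_i iota (c i) * d i.

Definition fcons T n (d : 'I_n -> T) (e : T) (i : 'I_n.+1) : T :=
  if unlift ord_max i is Some j then d j else e.

Lemma fcons_max T n (d : 'I_n -> T) e : fcons d e ord_max = e.
Proof. by rewrite /fcons unlift_none. Qed.

Lemma fcons_widen T n (d : 'I_n -> T) e i : fcons d e (widen_ord (leqnSn n) i) = d i.
Proof.
have -> : widen_ord (leqnSn n) i = lift ord_max i.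
  by apply: val_inj; rewrite /= /bump leqNgt ltn_ord.
by rewrite /fcons liftK.
Qed.

Lemma in_span_notin_independent n (d : 'I_n -> L) e :
  independent d -> ~ in_span d e -> independent (fcons d e).
Proof.
move=> id ne c; rewrite big_ord_recr /= fcons_max.
under eq_bigr do rewrite fcons_widen.
move=> E; have c0 : c ord_max = 0.
  apply: contrapT => /eqP c0; apply: ne.
  exists (fun i => - (c (widen_ord (leqnSn n) i) / c ord_max)).
  have ic0 : iota (c ord_max) != 0 by rewrite fmorph_eq0.
  apply: (mulfI ic0); rewrite mulr_sumr; move/eqP: E; rewrite addrC addr_eq0 => /eqP ->.
  rewrite -sumrN; apply: eq_bigr => i _; rewrite rmorphN fmorph_div.
  by field.
move=> i; move: E; rewrite c0 rmorph0 mul0r addr0 => /id ci.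
have [j ->|->//] := unliftP ord_max i.
have <- : widen_ord (leqnSn n) j = lift ord_max j.
  by apply: val_inj; rewrite /= /bump leqNgt ltn_ord.
exact: ci.
Qed.

Lemma in_span_fcons n (d : 'I_n -> L) e u : in_span d u -> in_span (fcons d e) u.
Proof.
move=> [c ->]; exists (fcons c 0); rewrite big_ord_recr /= !fcons_max rmorph0 mul0r addr0.
by apply: eq_bigr => i _; rewrite !fcons_widen.
Qed.

Lemma independent_basis N (e : 'I_N -> L) : exists n (d : 'I_n -> L),
  independent d /\ forall i, in_span d (e i).
Proof.
elim: N e => [|N IH] e.
  by exists 0%N, (fun=> 0); split=> [c _ []|[]].
have [n [d [id de]]] := IH (fun i => e (lift ord0 i)).
have cases m (d' : 'I_m -> L) : in_span d' (e ord0) ->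
    (forall i, in_span d' (e (lift ord0 i))) -> forall i, in_span d' (e i).
  by move=> h0 h i; have [j ->|->] := unliftP ord0 i.
have [h|h] := pselect (in_span d (e ord0)); first by exists n, d; split=> //; exact: cases.
exists n.+1, (fcons d (e ord0)); split; first exact: in_span_notin_independent.
apply: cases => [|i]; last exact: in_span_fcons.
exists (fcons (fun=> 0) 1); rewrite big_ord_recr /= !fcons_max rmorph1 mul1r big1 ?add0r // => i _.
by rewrite fcons_widen rmorph0 mul0r.
Qed.

End IndependentFamilies.

Section Transfer.
Variables (K : fieldType) (Kbar : closedFieldType) (iota : {rmorphism K -> Kbar}).
Variables (Y : curve K) (Ybar : curve Kbar) (j : base_change iota Y Ybar).

Definition point_below (O' : set Ybar) : set Y := [set a | O' (j a)].

Lemma point_below_point O' : is_point O' -> is_point (point_below O').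
Proof.
move=> PO; split.
- by move=> c; rewrite /point_below /= bc_const; exact: point_const.
- by move=> a b Oa Ob; rewrite /point_below /= rmorphB; exact: point_sub.
- by move=> a b Oa Ob; rewrite /point_below /= rmorphM; exact: point_mul.
- by move=> a; rewrite /point_below /= fmorphV; exact: point_val.
apply: contrapT => na; have [z nz] := point_proper PO; apply: nz.
have [n [c [a ->]]] := bc_onto j z.
apply: subring_sum => [|i _]; first exact: point_subring.
apply: point_mul => //; first exact: point_const.
by apply: contrapT => nOa; apply: na; exists (a i).
Qed.

Lemma point_extension_seq (O : set Y) z : point_extension j O z <->
  exists2 s : seq (Kbar * Y), (forall p, p \in s -> O p.2) &
    z = \sum_(p <- s) const Ybar p.1 * j p.2.
Proof.
split=> [[n [c [a [Oa ->]]]]|[s Os ->]].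
  exists [seq (c i, a i) | i <- enum 'I_n]; first by move=> p /mapP[i _ ->]; exact: Oa.
  by rewrite big_map big_enum.
exists (size s), (fun i => (tnth (in_tuple s) i).1), (fun i => (tnth (in_tuple s) i).2).
by split=> [i|]; [apply: Os; exact: mem_tnth|rewrite big_tnth].
Qed.

Lemma point_extension_subring O : is_point O -> is_subring (point_extension j O).
Proof.
move=> PO; split.
- apply/point_extension_seq; exists [:: (1, 1)].
    by move=> p; rewrite inE => /eqP ->; exact: point1.
  by rewrite big_seq1 !rmorph1 mulr1.
- move=> a b /point_extension_seq[s Os ->] /point_extension_seq[t Ot ->].
  apply/point_extension_seq; exists (s ++ [seq (- p.1, p.2) | p <- t]).
    move=> p; rewrite mem_cat => /orP[/Os//|/mapP[q qt ->]]; exact: (Ot q).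
  rewrite big_cat big_map /= -sumrN; congr (_ + _).
  by apply: eq_bigr => p _; rewrite rmorphN mulNr.
- move=> a b /point_extension_seq[s Os ->] /point_extension_seq[t Ot ->].
  apply/point_extension_seq; exists [seq (p.1 * q.1, p.2 * q.2) | p <- s, q <- t].
    move=> p /allpairsP[[p1 p2] /= [ps qt ->]].
    by apply: point_mul => //=; [exact: Os|exact: Ot].
  rewrite big_allpairs_dep mulr_suml; apply: eq_bigr => p _; rewrite mulr_sumr.
  by apply: eq_bigr => q _ /=; rewrite !rmorphM; ring.
Qed.

Lemma point_extension_const O c : is_point O -> point_extension j O (const Ybar c).
Proof.
move=> PO; apply/point_extension_seq; exists [:: (c, 1)].
  by move=> p; rewrite inE => /eqP ->; exact: point1.
by rewrite big_seq1 rmorph1 mulr1.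
Qed.

Lemma point_extension_in O a : O a -> point_extension j O (j a).
Proof.
move=> Oa; apply/point_extension_seq; exists [:: (1, a)].
  by move=> p; rewrite inE => /eqP ->.
by rewrite big_seq1 rmorph1 mul1r.
Qed.

(** By smoothness the extension of [O] is integrally closed, hence an intersection of valuation
    rings; [point_maximal] shows that these lie over [O]. *)
Lemma smooth_intersection O z : smooth j -> is_point O ->
  (forall O', is_point O' -> point_below O' = O -> O' z) -> point_extension j O z.
Proof.
move=> sm PO h; apply: contrapT => nz.
have [||P Pm Pc Pz|O' [PO' sub Oz]] := @point_exists _ Ybar (point_extension j O) z.
- exact: point_extension_subring.
- by move=> c; exact: point_extension_const.
- by apply: nz; exact: (sm O PO z P Pm Pc Pz).
apply: Oz; apply: h => //; apply/esym; apply: point_maximal => //; first exact: point_below_point.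
by move=> a Oa; apply: sub; exact: point_extension_in.
Qed.

(** This is [bc_inj] with the two factors of the tensor product exchanged. A [K]-linear relation
    between the [w i] eliminates one of them and leaves the new constants independent; without such
    a relation, [bc_inj] would make every [d i] zero. *)
Lemma bc_independent n (d : 'I_n -> Kbar) (w : 'I_n -> Y) : independent iota d ->
  \sum_i const Ybar (d i) * j (w i) = 0 -> forall i, w i = 0.
Proof.
elim: n d w => [|n IH] d w id E; first by case.
have [iw|] := pselect (forall c : 'I_n.+1 -> K,
    \sum_i const Y (c i) * w i = 0 -> forall i, c i = 0).
  have d0 := bc_inj iw E.
  suff /eqP : (1 : K) = 0 by rewrite oner_eq0.
  by apply: (id (fun=> 1) _ ord0); rewrite big1 // => i _; rewrite d0 mulr0.
move=> /existsNP[c /not_implyP[cw /existsNP[i0 /eqP ci0]]].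
have cY0 : const Y (c i0) != 0 by rewrite fmorph_eq0.
pose nu i := - (c (lift i0 i) / c i0).
have wE : w i0 = \sum_i const Y (nu i) * w (lift i0 i).
  apply: (mulfI cY0); move/eqP: cw; rewrite (bigD1_ord i0) //= addr_eq0 => /eqP ->.
  rewrite mulr_sumr -sumrN; apply: eq_bigr => i _; rewrite /nu rmorphN fmorph_div.
  by field.
have w0 : forall i, w (lift i0 i) = 0.
  apply: (IH (fun i => d (lift i0 i) + iota (nu i) * d i0)).
    move=> e E'.
    pose e' i := if unlift i0 i is Some i' then e i' else \sum_i e i * nu i.
    have e'0 : forall i, e' i = 0.
      apply: id; rewrite (bigD1_ord i0) //= /e' unlift_none -[RHS]E'.
      under [X in _ + X]eq_bigr do rewrite liftK.
      under [in RHS]eq_bigr do rewrite mulrDr.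
      rewrite big_split /= addrC; congr (_ + _).
      rewrite rmorph_sum mulr_suml; apply: eq_bigr => i _; rewrite rmorphM; ring.
    by move=> i; have := e'0 (lift i0 i); rewrite /e' liftK.
  rewrite -[RHS]E [in RHS](bigD1_ord i0) //= wE rmorph_sum mulr_sumr -big_split.
  by apply: eq_bigr => i _ /=; rewrite !rmorphD !rmorphM /= bc_const; ring.
move=> i; have [i' ->|->] := unliftP i0 i; first exact: w0.
by rewrite wE big1 // => l _; rewrite w0 mulr0.
Qed.

(** An expression with coefficients in [O] is consumed one term [(c, o)] at a time: if [c] is in the
    span of [d], the term is absorbed into the [w i]; otherwise [c] is appended to [d], with
    coefficient [- o]. *)
Lemma point_extension_coef O n (d : 'I_n -> Kbar) (w : 'I_n -> Y) :
  is_point O -> independent iota d ->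
  point_extension j O (\sum_i const Ybar (d i) * j (w i)) -> forall i, O (w i).
Proof.
move=> PO id /point_extension_seq[s Os E].
elim: s n d w id Os E => [|[c o] s IH] n d w id Os E.
  by move=> i; rewrite (bc_independent id) ?E ?big_nil //; exact: point0.
have Oo : O o by apply: (Os (c, o)); rewrite inE eqxx.
have Os' p : p \in s -> O p.2 by move=> ps; apply: Os; rewrite inE ps orbT.
have [[g gE]|ns] := pselect (in_span iota d c).
  have h i : O (w i - const Y (g i) * o).
    apply: (IH n d (fun i => w i - const Y (g i) * o)) => //.
    under eq_bigr do rewrite rmorphB mulrBr.
    rewrite sumrB E big_cons /= gE rmorph_sum mulr_suml addrC addrA.
    rewrite [X in X + _](_ : _ = 0) ?add0r //; apply/eqP; rewrite addrC subr_eq0; apply/eqP.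
    by apply: eq_bigr => i' _; rewrite !rmorphM bc_const; ring.
  move=> i; rewrite -(subrK (const Y (g i) * o) (w i)); apply: pointD => //.
  by apply: point_mul => //; exact: point_const.
move=> i.
have := IH n.+1 (fcons d c) (fcons w (- o)) (in_span_notin_independent id ns) Os' _
  (widen_ord (leqnSn n) i); rewrite fcons_widen; apply.
rewrite big_ord_recr /= !fcons_max.
under eq_bigr do rewrite !fcons_widen.
by rewrite E big_cons /= rmorphN; ring.
Qed.

End Transfer.

Section GenusTransfer.
Variables (K : fieldType) (Kbar : closedFieldType) (iota : {rmorphism K -> Kbar}).
Variables (Y : curve K) (Ybar : curve Kbar) (j : base_change iota Y Ybar).

Lemma ev_base_change y p : j (ev y p) = ev (j y) (map_poly iota p).
Proof.
rewrite /ev -horner_map -!map_poly_comp; congr (horner _ _).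
by apply: eq_map_poly => c /=; rewrite bc_const.
Qed.

Lemma transcendental_base_change y : transcendental y -> transcendental (j y).
Proof.
move=> yT [p p0 /eqP]; rewrite (horner_coef_wide _ (size_poly _ _)) => E.
case/eqP: p0; apply/polyP=> i; rewrite coef0.
have [ip|] := ltnP i (size p); last exact: nth_default.
have := @bc_inj _ _ _ _ _ j (size p) (fun i => y ^+ i) _ (fun i => p`_i) _ (Ordinal ip).
apply=> [c cE|]; last first.
  by rewrite -[RHS]E; apply: eq_bigr => l _; rewrite coef_map rmorphXn.
pose P := \poly_(l < size p) (if insub l is Some l' then c l' else 0).
have P0 : P = 0.
  apply/eqP; rewrite -(ev_eq0 _ yT); apply/eqP.
  rewrite /ev (horner_coef_wide _ (leq_trans (size_poly _ _) (size_poly _ _))) -[RHS]cE.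
  by apply: eq_bigr => l _; rewrite coef_map coef_poly ltn_ord valK.
by move=> l; have := congr1 (fun Q : {poly K} => Q`_l) P0; rewrite coef_poly ltn_ord valK coef0.
Qed.

Lemma finite_over_base_change y : finite_over y -> finite_over (j y).
Proof.
move=> [yT [n [b bP]]]; split; first exact: transcendental_base_change.
exists n, (fun i => j (b i)) => z; have [N [c [a ->]]] := bc_onto j z.
have /choice[qp qpP] : forall l, exists qp : {poly K} * ('I_n -> {poly K}),
    qp.1 != 0 /\ ev y qp.1 * a l = \sum_(i < n) ev y (qp.2 i) * b i.
  by move=> l; have [q [p E]] := bP (a l); exists (q, p).
exists (map_poly iota (\prod_l (qp l).1)), (fun i => \sum_l (c l)%:P *
  map_poly iota (\prod_(m | m != l) (qp m).1 * (qp l).2 i)); split.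
  by rewrite map_poly_eq0; apply/prodf_neq0 => l _; case: (qpP l).
rewrite mulr_sumr; under [RHS]eq_bigr do rewrite rmorph_sum mulr_suml.
rewrite exchange_big; apply: eq_bigr => l _ /=.
under [RHS]eq_bigr do rewrite evM evC -mulrA -ev_base_change -rmorphM evM -mulrA.
rewrite -mulr_sumr -rmorph_sum -mulr_sumr -(qpP l).2 /= -ev_base_change (bigD1 l) //= evM.
by rewrite !rmorphM; ring.
Qed.

Lemma point_below_fiber_finite O : is_point O ->
  finite_set [set O' : set Ybar | is_point O' /\ point_below j O' = O].
Proof.
move=> PO; have [y0 fy0] := finite_over_exists Y.
have [y [fy Oy _]] := point_contains PO fy0.
have [pi lo] := lies_over_exists PO Oy fy; have [spi mpi _] := lo.
apply: (sub_finite_set _ (fiber_poly_finite (p := map_poly iota pi) (finite_over_base_change fy) _)).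
  move=> O' [PO' E]; have Oj a : O a -> O' (j a) by rewrite -E.
  split=> //; first exact: Oj.
  rewrite -ev_base_change; split; first by apply: Oj; exact: nonunit_in.
  right; rewrite -fmorphV => h.
  apply: (nonunit_notin mpi (lies_over_neq0 fy lo)).
  by rewrite -E.
by rewrite map_poly_eq0 -size_poly_gt0 (ltn_trans _ spi).
Qed.

Section Basis.
Variables (g : nat) (r : 'I_g -> set Y -> Y).
Hypotheses (sm : smooth j) (rr : forall i, repartition (r i)).
Hypothesis rP : forall a, repartition a -> exists! c : 'rV[K]_g, h1_coord r a c.

Definition pull_repartition (a : set Y -> Y) (O' : set Ybar) : Ybar := j (a (point_below j O')).

Let rbar i := pull_repartition (r i).

Lemma pull_repartitionP a : repartition a -> repartition (pull_repartition a).
Proof.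
move=> /finite_seqP[s sE].
have sub : [set O' : set Ybar | is_point O' /\ ~ O' (pull_repartition a O')] `<=`
    [set O' : set Ybar | is_point O' /\ point_below j O' \in s].
  move=> O' [PO' nO]; split=> //.
  suff : [set` s] (point_below j O') by [].
  by rewrite -sE; split=> //; exact: point_below_point.
apply: (sub_finite_set sub); have {sE} sP : forall O, O \in s -> is_point O.
  move=> O Os; have : [set` s] O by [].
  by rewrite -sE => -[].
elim: s sP {sub} => [|O s IH] sP.
  by apply: (sub_finite_set _ (finite_set0 _)) => O' [].
apply: (sub_finite_set _ (_ : finite_set
  ([set O' : set Ybar | is_point O' /\ point_below j O' = O] `|`
   [set O' : set Ybar | is_point O' /\ point_below j O' \in s]))).
  by move=> O' [PO']; rewrite inE => /orP[/eqP h|h]; [left|right].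
rewrite finite_setU; split; first by apply: point_below_fiber_finite; apply: sP; rewrite inE eqxx.
by apply: IH => O1 O1s; apply: sP; rewrite inE O1s orbT.
Qed.

Definition has_coord (a : set Ybar -> Ybar) := exists c, h1_coord rbar a c.

Lemma has_coordD a b : has_coord a -> has_coord b -> has_coord (fun O => a O + b O).
Proof.
move=> [c [f cf]] [d [h dh]]; exists (c + d), (f + h) => O PO.
have -> : a O + b O - \sum_(i < g) const Ybar ((c + d) 0 i) * rbar i O - (f + h) =
   (a O - \sum_(i < g) const Ybar (c 0 i) * rbar i O - f) +
   (b O - \sum_(i < g) const Ybar (d 0 i) * rbar i O - h).
  under eq_bigr do rewrite mxE rmorphD mulrDl.
  by rewrite big_split /=; ring.
by apply: pointD => //; [exact: cf|exact: dh].
Qed.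

Lemma has_coord0 : has_coord (fun=> 0).
Proof.
exists 0, 0 => O PO; rewrite big1 => [|i _]; last by rewrite mxE rmorph0 mul0r.
by rewrite !subr0; exact: point0.
Qed.

Lemma has_coord_sum (I : Type) (s : seq I) (a : I -> set Ybar -> Ybar) :
  (forall i, has_coord (a i)) -> has_coord (fun O => \sum_(i <- s) a i O).
Proof.
move=> ha; elim: s => [|i s IH].
  by rewrite (_ : (fun _ => _) = fun=> 0); [exact: has_coord0|apply/funext=> O; rewrite big_nil].
rewrite (_ : (fun _ => _) = fun O => a i O + \sum_(i <- s) a i O); first exact: has_coordD.
by apply/funext=> O; rewrite big_cons.
Qed.

Lemma has_coord_congr a b : (forall O, is_point O -> O (a O - b O)) -> has_coord b -> has_coord a.
Proof.
move=> ab [c [f cf]]; exists c, f => O PO.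
have -> : a O - \sum_(i < g) const Ybar (c 0 i) * rbar i O - f =
  (a O - b O) + (b O - \sum_(i < g) const Ybar (c 0 i) * rbar i O - f) by ring.
by apply: (pointD PO); [exact: ab|exact: cf].
Qed.

Lemma has_coord_pull c a : repartition a ->
  has_coord (fun O' => const Ybar c * pull_repartition a O').
Proof.
move=> ra; have [d [[f df] _]] := rP ra.
exists (\row_i (c * iota (d 0 i))), (const Ybar c * j f) => O' PO'.
have -> : const Ybar c * pull_repartition a O' -
    \sum_(i < g) const Ybar ((\row_i (c * iota (d 0 i))) 0 i) * rbar i O' - const Ybar c * j f =
    const Ybar c * j (a (point_below j O') -
      \sum_(i < g) const Y (d 0 i) * r i (point_below j O') - f).
  rewrite !rmorphB !mulrBr rmorph_sum mulr_sumr; congr (_ - _ - _).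
  by apply: eq_bigr => i _; rewrite mxE !rmorphM /= bc_const; ring.
apply: point_mul => //; first exact: point_const.
by apply: (df (point_below j O')); exact: point_below_point.
Qed.

Lemma repartition_single (O : set Y) (b : Y) :
  repartition (fun Q => if `[< Q = O >] then b else 0).
Proof.
apply: (sub_finite_set _ (finite_set1 O)) => Q [PQ nQ]; apply: contrapT => QO; apply: nQ.
by rewrite asboolF //; exact: point0.
Qed.

Lemma has_coord_single (O : set Y) (b : Ybar) :
  has_coord (fun O' => if `[< point_below j O' = O >] then b else 0).
Proof.
have [n [c [a ->]]] := bc_onto j b.
pose s i O' := const Ybar (c i) * pull_repartition (fun Q => if `[< Q = O >] then a i else 0) O'.
rewrite (_ : (fun _ => _) = fun O' => \sum_(i <- index_enum 'I_n) s i O').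
  by apply: has_coord_sum => i; apply: has_coord_pull; exact: repartition_single.
apply/funext=> O'; rewrite /s /pull_repartition; case: ifP => // _.
by rewrite big1 // => i _; rewrite rmorph0 mulr0.
Qed.

(** Strong approximation over a point [O] of [Y] replaces [a] by one function [b O] at all points
    above [O] at once. So [a] may be taken constant along the fibres, and such a repartition is a
    [Kbar]-combination of pulled back ones. *)
Lemma has_coordP a : repartition a -> has_coord a.
Proof.
move=> ra; have /finite_seqP[s sE] := finite_image (point_below j) ra.
have /choice[b bP] : forall O, exists b, is_point O ->
    forall O', is_point O' -> point_below j O' = O -> O' (a O' - b).
  move=> O; have [PO|nO] := pselect (is_point O); last by exists 0.
  have [y0 fy0] := finite_over_exists Y.
  have [y [fy Oy _]] := point_contains PO fy0.
  have [b bP] := strong_approximation (finite_over_base_change fy) ra.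
  by exists b => _ O' PO' E; apply: bP => //; rewrite -[O' _]/(point_below j O' y) E.
pose t := undup s.
apply: (@has_coord_congr _
  (fun O' => \sum_(O <- t) if `[< point_below j O' = O >] then b O else 0)); last first.
  by apply: has_coord_sum => O; exact: has_coord_single.
move=> O' PO'; have PO := point_below_point j PO'.
have [h|h] := boolP (point_below j O' \in t).
  rewrite (bigD1_seq (point_below j O')) ?undup_uniq //= asboolT // big1 => [|O OO'].
    by rewrite addr0; exact: bP.
  by rewrite asboolF // => E; rewrite E eqxx in OO'.
rewrite big_seq big1 => [|O Ot]; last first.
  by rewrite asboolF // => E; rewrite E Ot in h.
rewrite subr0; apply: contrapT => nO; move: h; rewrite mem_undup => /negP; apply.
suff : [set` s] (point_below j O') by [].
by rewrite -sE; exists O'.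
Qed.

(** The entries of [c] and the constants occurring in [f] are expanded on a family [d] independent
    over [K]. By smoothness the relation holds in the extension of each [O], so
    [point_extension_coef] splits it into one relation on [Y] for each member of [d]; there
    uniqueness of coordinates applies. *)
Lemma coord_zero (c : 'rV[Kbar]_g) (f : Ybar) :
  (forall O, is_point O -> O (\sum_(i < g) const Ybar (c 0 i) * rbar i O + f)) -> c = 0.
Proof.
move=> h; have [N [e [b fE]]] := bc_onto j f.
pose ce (i : 'I_(g + N)) := match fintype.split i with inl i => c 0 i | inr i => e i end.
have [n [d [id dP]]] := independent_basis iota ce.
have /choice[G GP] := dP.
pose w O l : Y := \sum_(i < g) const Y (G (lshift N i) l) * r i O +
  \sum_(i < N) const Y (G (rshift g i) l) * b i.
have key O : is_point O -> forall l, O (w O l).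
  move=> PO; apply: (point_extension_coef (j := j) (w := w O) PO id); apply: smooth_intersection => // O' PO' E.
  have -> : \sum_i const Ybar (d i) * j (w O i) =
      \sum_(i < g) const Ybar (c 0 i) * rbar i O' + f; last exact: h.
    transitivity (\sum_l (\sum_(i < g) const Ybar (iota (G (lshift N i) l) * d l) * rbar i O' +
       \sum_(i < N) const Ybar (iota (G (rshift g i) l) * d l) * j (b i))).
      apply: eq_bigr => l _; rewrite rmorphD mulrDr !rmorph_sum !mulr_sumr.
      congr (_ + _); apply: eq_bigr => i _; rewrite !rmorphM /= bc_const /rbar /pull_repartition ?E; ring.
    rewrite big_split /= exchange_big fE [X in _ + X]exchange_big /=; congr (_ + _).
      apply: eq_bigr => i _; rewrite -mulr_suml -rmorph_sum -GP /ce.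
      by case: split_ordP => i' /eqP; rewrite ?eq_shift // => /eqP <-.
    apply: eq_bigr => i _; rewrite -mulr_suml -rmorph_sum -GP /ce.
    by case: split_ordP => i' /eqP; rewrite ?eq_shift // => /eqP <-.
have r0 : repartition (fun _ : set Y => (0 : Y)).
  by apply: (sub_finite_set _ (finite_set0 _)) => O [PO]; apply; exact: point0.
have [c0 [_ cU]] := rP r0.
have G0 l i : G (lshift N i) l = 0.
  have e1 : c0 = 0.
    apply: cU; exists 0 => O PO; rewrite big1 => [|i' _]; last by rewrite mxE rmorph0 mul0r.
    by rewrite !subr0; exact: point0.
  have e2 : c0 = \row_i G (lshift N i) l.
    apply: cU; exists (\sum_(i < N) const Y (G (rshift g i) l) * b i) => O PO.
    rewrite sub0r -opprD; apply: pointN => //.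
    have -> : \sum_(i0 < g) const Y ((\row_i1 G (lshift N i1) l) 0 i0) * r i0 O =
       \sum_(i < g) const Y (G (lshift N i) l) * r i O by apply: eq_bigr => i' _; rewrite mxE.
    exact: key.
  by have := congr1 (fun v : 'rV_g => v 0 i) (etrans (esym e2) e1); rewrite !mxE.
apply/rowP=> i; rewrite mxE.
have -> : c 0 i = ce (lshift N i).
  by rewrite /ce; case: split_ordP => i' /eqP; rewrite eq_shift // => /eqP <-.
by rewrite GP big1 // => l _; rewrite G0 rmorph0 mul0r.
Qed.

End Basis.

Lemma has_genus_base_change g : smooth j -> has_genus Y g -> has_genus Ybar g.
Proof.
move=> sm [r [rr rP]].
apply: (@has_genus_basis _ _ _ (fun i => pull_repartition (r i))).
- by move=> i; exact: pull_repartitionP.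
- by move=> a ra; exact: (has_coordP rP).
- by move=> c f; exact: (coord_zero sm rP).
Qed.

End GenusTransfer.

(** * Cyclic cubic covers of the line *)

Section RationalFunctions.
Variables (k : fieldType) (C : curve k).
Implicit Types (O : set C) (x y z a b : C) (p q : {poly k}).

Definition ratl x : set C := [set a | exists p q, q != 0 /\ ev x q * a = ev x p].

Lemma ratl_subring x : transcendental x -> is_subring (ratl x).
Proof.
move=> xT; split.
- by exists 1, 1; rewrite oner_neq0 mulr1.
- move=> a b [p [q [q0 E]]] [p' [q' [q'0 E']]].
  exists (p * q' - p' * q), (q * q'); rewrite mulf_neq0 //; split=> //.
  by rewrite evB !evM -E -E'; ring.
- move=> a b [p [q [q0 E]]] [p' [q' [q'0 E']]].
  by exists (p * p'), (q * q'); rewrite mulf_neq0 // !evM -E -E'; split=> //; ring.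
Qed.

Lemma ratl_ev x p : ratl x (ev x p).
Proof. by exists p, 1; rewrite oner_neq0 ev1 mul1r. Qed.

Lemma ratl_const x c : ratl x (const C c).
Proof. by rewrite -(evC x); exact: ratl_ev. Qed.

Lemma ratl_id x : ratl x x.
Proof. by rewrite -{2}(evX x); exact: ratl_ev. Qed.

Lemma ratlV x a : transcendental x -> ratl x a -> ratl x a^-1.
Proof.
move=> xT [p [q [q0 E]]]; have [->|a0] := eqVneq a 0; first by rewrite invr0 -(ev0 x); exact: ratl_ev.
exists q, p; rewrite -(ev_eq0 _ xT) -E mulf_neq0 ?ev_eq0 //; split=> //.
by rewrite mulfK.
Qed.

Lemma ratl_trans x x' a : transcendental x -> transcendental x' ->
  ratl x' x -> ratl x a -> ratl x' a.
Proof.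
move=> xT x'T xx' [p [q [q0 E]]].
have h r : ratl x' (ev x r).
  apply: (subring_horner (ratl_subring x'T)) => // i.
  by rewrite coef_map; exact: ratl_const.
have eq0 : ev x q != 0 by rewrite ev_eq0.
have -> : a = (ev x q)^-1 * ev x p by rewrite -E mulKf.
by apply: (subringM (ratl_subring x'T)) => //; exact: ratlV.
Qed.

Lemma ratl_quot x a : transcendental x -> ratl x a ->
  exists p q, q != 0 /\ a = ev x p / ev x q.
Proof.
by move=> xT [p [q [q0 E]]]; exists p, q; split=> //; rewrite -E mulrAC mulfV ?mul1r ?ev_eq0.
Qed.

Lemma ratl_coprime x a : transcendental x -> ratl x a ->
  exists p q, [/\ q != 0, coprimep p q & ev x q * a = ev x p].
Proof.
move=> xT [p [q [q0 E]]]; have g0 : gcdp p q != 0 by rewrite gcdp_eq0 negb_and q0 orbT.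
exists (p %/ gcdp p q), (q %/ gcdp p q); split.
- by rewrite dvdp_div_eq0 ?dvdp_gcdr.
- by rewrite coprimep_div_gcd // q0 orbT.
apply: (mulfI (_ : ev x (gcdp p q) != 0)); first by rewrite ev_eq0.
by rewrite mulrA -!evM ![gcdp p q * _]mulrC !divpK ?dvdp_gcdl ?dvdp_gcdr.
Qed.

End RationalFunctions.

Section Pullback.
Variables (k : fieldType) (C D : curve k) (phi : {rmorphism D -> C}).
Hypothesis phik : pullback phi.

Lemma pullback_ev x p : phi (ev x p) = ev (phi x) p.
Proof.
rewrite /ev -horner_map -map_poly_comp; congr (horner _ _).
by apply: eq_map_poly => c /=; rewrite phik.
Qed.

Lemma pullback_transcendental x : transcendental x -> transcendental (phi x).
Proof.
move=> xT [p p0 /rootP px]; apply: xT; exists p => //; apply/rootP.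
by apply: (fmorph_inj phi); rewrite [LHS]pullback_ev rmorph0.
Qed.

Lemma pullback_ratl x a : ratl x a -> ratl (phi x) (phi a).
Proof.
by move=> [p [q [q0 E]]]; exists p, q; split=> //; rewrite -!pullback_ev -E rmorphM.
Qed.
End Pullback.

Section Endomorphisms.
Variables (k : fieldType) (C : curve k).
Implicit Types (O : set C) (x y z a b : C) (p q : {poly k}).

Lemma ratl_endo (s : {rmorphism C -> C}) x a : pullback s -> transcendental x ->
  s x = x -> ratl x a -> s a = a.
Proof.
move=> sc xT sx /(ratl_quot xT)[p [q [q0 ->]]].
by rewrite fmorph_div !pullback_ev // sx.
Qed.

Lemma endo_point (s : {rmorphism C -> C}) O : pullback s ->
  (forall z, exists a, s a = z) -> is_point O -> is_point [set a | O (s a)].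
Proof.
move=> sc sS PO; split=> /=.
- by move=> c; rewrite sc; exact: point_const.
- by move=> a b Oa Ob; rewrite rmorphB; exact: point_sub.
- by move=> a b Oa Ob; rewrite rmorphM; exact: point_mul.
- by move=> a; rewrite fmorphV; exact: point_val.
by have [z nz] := point_proper PO; have [a E] := sS z; exists a; rewrite E.
Qed.

Section Comparable.
Variable O : set C.
Hypothesis PO : is_point O.

(* [a] and [b] have different valuations, or one of them vanishes. *)
Definition val_neq a b := [\/ a = 0, b = 0, nonunit O (a / b) | nonunit O (b / a)].

Lemma val_neq_add_in a b : val_neq a b -> O (a + b) -> O a /\ O b.
Proof.
have dom u v : nonunit O (v / u) -> O (u + v) -> O u /\ O v.
  move=> m Ouv; have [u0|u0] := eqVneq u 0.
    by move: Ouv; rewrite u0 add0r; split=> //; exact: point0.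
  have nu : ~ nonunit O (1 + v / u).
    by apply: unitD => //; [exact: point1|exact: nonunit1].
  have O1 : O (1 + v / u) by apply: pointD => //; [exact: point1|exact: nonunit_in].
  have Ou : O u.
    apply: (point_mulr_unit PO O1 nu).
    by have -> : (1 + v / u) * u = u + v by field.
  by split=> //; rewrite -(addKr u v); apply: pointD => //; exact: pointN.
case=> [->|->|m|m] h.
- by move: h; rewrite add0r; split=> //; exact: point0.
- by move: h; rewrite addr0; split=> //; exact: point0.
- by rewrite addrC in h; case: (dom _ _ m h).
- exact: dom.
Qed.

Lemma val_neq_addl a b c : val_neq a b -> val_neq a c -> val_neq b c -> val_neq (a + b) c.
Proof.
have dom u v : u != 0 -> nonunit O (v / u) -> val_neq u c -> val_neq (u + v) c.
  move=> u0 m; have nu : ~ nonunit O (1 + v / u).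
    by apply: unitD => //; [exact: point1|exact: nonunit1].
  have O1 : O (1 + v / u) by apply: pointD => //; [exact: point1|exact: nonunit_in].
  have uvE : u + v = (1 + v / u) * u by field.
  have nu0 := unit_neq0 PO nu.
  case=> [/eqP|->|h|h]; first by rewrite (negbTE u0).
  - exact: Or42.
  - by apply: Or43; rewrite uvE -mulrA; exact: nonunitMl.
  apply: Or44; rewrite uvE invfM mulrCA; apply: nonunitMl => //; exact: unit_inv.
case=> [->|->|m|m] ac bc; rewrite ?add0r ?addr0 //.
  have [->|b0] := eqVneq b 0; first by rewrite addr0.
  by rewrite addrC; exact: dom.
have [->|a0] := eqVneq a 0; first by rewrite add0r.
exact: dom.
Qed.

(** The quotient of the cubes is a fraction in [x] of nonzero degree, so it or its inverse vanishes
    at the pole of [x]; the cube root inherits this. *)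
Lemma val_neq_cube x a b p q : transcendental x -> ~ O x -> p != 0 -> q != 0 ->
  (size p != size q)%N -> ev x q * a ^+ 3 = ev x p * b ^+ 3 -> val_neq a b.
Proof.
move=> xT nx.
have half u v (p1 q1 : {poly k}) : v != 0 -> q1 != 0 ->
   (size p1 < size q1)%N -> ev x q1 * u ^+ 3 = ev x p1 * v ^+ 3 -> nonunit O (u / v).
  move=> v0 q0 lt E.
  have m : nonunit O ((u / v) ^+ 3).
    have -> : (u / v) ^+ 3 = ev x p1 / ev x q1.
      apply: (mulfI (_ : ev x q1 * v ^+ 3 != 0)).
        by rewrite mulf_neq0 ?expf_neq0 ?ev_eq0.
      transitivity (ev x q1 * u ^+ 3); first by field.
      by rewrite E; field; rewrite ev_eq0.
    exact: ev_infinity_lt.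
  by apply: (nonunitXE PO (n := 3)) => //; apply: (point_Xn PO (n := 3)) => //; exact: nonunit_in.
move=> p0 q0 pq E.
have [a0|a0] := eqVneq a 0; first exact: Or41.
have [b0|b0] := eqVneq b 0; first exact: Or42.
case: (ltngtP (size p) (size q)) pq => // lt _; first by apply: Or43; exact: half lt E.
by apply: Or44; exact: half lt (esym E).
Qed.

End Comparable.
End Endomorphisms.

(** [k[x]] is integrally closed: at a zero of [x - c], where [c] is a root of the reduced
    denominator, the numerator would vanish too. *)
Lemma ratl_regular (k : closedFieldType) (C : curve k) (x a : C) :
  transcendental x -> ratl x a -> regular x a -> exists p, a = ev x p.
Proof.
move=> xT rx reg; have [p [q [q0 cpq E]]] := ratl_coprime xT rx.
have [sq|sq] := leqP (size q) 1.
  move: q0 E; rewrite (size1_polyC sq) polyC_eq0 evC => q0 E.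
  exists ((q`_0)^-1%:P * p); rewrite evM evC -E fmorphV mulKf //.
  by rewrite fmorph_eq0.
have [c qc] : exists c, root q c by apply/closed_rootP; rewrite neq_ltn sq orbT.
have [O [PO mc]] := zero_point_exists c xT.
have Ox := nonunit_sub_in PO mc.
have lo : lies_over O x ('X - c%:P) by exact: lies_over_XsubC.
have mq : nonunit O (ev x q).
  have [s ->] := factor_theorem _ _ qc; rewrite !evE.
  by apply: nonunitMl => //; exact: point_ev.
have : nonunit O (ev x p) by rewrite -E; apply: nonunitMr => //; exact: reg.
move/(let: And3 _ _ h := lo in h p); rewrite dvdp_XsubCl => pc.
by have := coprimep_root cpq pc; rewrite (eqP qc) eqxx.
Qed.

(** When [u * v] is separable, [u * v ^+ 2] has no root of multiplicity 3, so it cannot cancel a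
    root of [q ^+ 3]. *)
Lemma cube_factor_poly (k : closedFieldType) (u v p q r : {poly k}) :
  separable_poly (u * v) -> q != 0 -> coprimep p q ->
  p ^+ 3 * (u * v ^+ 2) = r * q ^+ 3 -> (size q <= 1)%N.
Proof.
move=> sep q0 cpq E; rewrite leqNgt; apply/negP=> sq.
have [c qc] : exists c, root q c by apply/closed_rootP; rewrite neq_ltn sq orbT.
have npc : ~~ root p c by apply/negP=> pc; have := coprimep_root cpq pc; rewrite (eqP qc) eqxx.
have XcN0 : 'X - c%:P != 0 by rewrite polyXsubC_eq0.
have dvd : ('X - c%:P) ^+ 3 %| u * v ^+ 2.
  have cp : coprimep (('X - c%:P) ^+ 3) (p ^+ 3).
    by apply: coprimep_expl; apply: coprimep_expr; rewrite coprimep_sym coprimep_XsubC.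
  rewrite -(Gauss_dvdpr _ cp) E; apply: dvdp_mull; apply: dvdp_exp2r.
  by rewrite dvdp_XsubCl.
have nsq s : s * s %| u * v -> coprimep s s by exact: separable_coprime.
have self : ~ coprimep ('X - c%:P) ('X - c%:P).
  by rewrite coprimepp size_XsubC.
have nboth : ~~ (root u c && root v c).
  apply/negP=> /andP[uc vc]; apply: self; apply: nsq.
  by rewrite dvdp_mul // dvdp_XsubCl.
have [vc|vc] := boolP (root v c).
  have uc : ~~ root u c by move: nboth; rewrite vc andbT.
  have cp : coprimep (('X - c%:P) ^+ 3) u.
    by apply: coprimep_expl; rewrite coprimep_sym coprimep_XsubC.
  move: dvd; rewrite Gauss_dvdpr //; have [v' vE] := factor_theorem _ _ vc.
  rewrite vE exprMn (exprS _ 2) dvdp_mul2r ?expf_neq0 // dvdp_XsubCl.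
  rewrite /root horner_exp expf_eq0 /= => v'c.
  apply: self; apply: nsq; apply: dvdp_mull; rewrite vE; apply: dvdp_mul => //.
  by rewrite dvdp_XsubCl.
have cp : coprimep (('X - c%:P) ^+ 3) (v ^+ 2).
  by apply: coprimep_expl; apply: coprimep_expr; rewrite coprimep_sym coprimep_XsubC.
move: dvd; rewrite Gauss_dvdpl // => dvd; apply: self; apply: nsq; apply: dvdp_mulr.
by apply: dvdp_trans dvd; rewrite -expr2 dvdp_exp2l.
Qed.

Record kummer (k : fieldType) (C : curve k) (s : {rmorphism C -> C}) (w : k) (x y : C)
    (f : {poly k}) : Prop := Kummer {
  kum_root : w ^+ 2 + w + 1 = 0;
  kum_pull : pullback s;
  kum_order : forall z, s (s (s z)) = z;
  kum_transc : transcendental x;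
  kum_fixed : forall z, s z = z <-> ratl x z;
  kum_neq0 : y != 0;
  kum_gen : s y = const C w * y;
  kum_eq : y ^+ 3 = ev x f
}.

Section Kummer.
Variables (k : fieldType) (three : 3%:R != 0 :> k) (C : curve k).
Variables (s : {rmorphism C -> C}).

Lemma cube_root_of_unity (w : k) : w ^+ 2 + w + 1 = 0 -> w ^+ 3 = 1.
Proof.
move=> E; apply/eqP; rewrite -subr_eq0; apply/eqP.
have -> : w ^+ 3 - 1 = (w - 1) * (w ^+ 2 + w + 1) by ring.
by rewrite E mulr0.
Qed.

Lemma cube_root_neq1 (w : k) : w ^+ 2 + w + 1 = 0 -> w != 1.
Proof.
move=> E; apply: contra three => /eqP w1; move: E; rewrite w1 => E.
by rewrite -[X in _ == X]E; apply/eqP; ring.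
Qed.

Lemma cube_root_sq (w : k) : w ^+ 2 + w + 1 = 0 -> (w ^+ 2) ^+ 2 + w ^+ 2 + 1 = 0.
Proof.
move=> E; have -> : (w ^+ 2) ^+ 2 + w ^+ 2 + 1 = (w ^+ 2 + w + 1) * (w ^+ 2 - w + 1) by ring.
by rewrite E mul0r.
Qed.

Section Eigenparts.
Variable w : k.
Hypotheses (wE : w ^+ 2 + w + 1 = 0) (sc : pullback s) (s3 : forall z, s (s (s z)) = z).

(** The projector onto the eigenspace of [w ^+ i]. The weights of [s z] and [s (s z)] are the
    inverses of [w ^+ i] and [w ^+ (2 * i)], written with nonnegative exponents by [w ^+ 3 = 1]. *)
Definition eigenpart i (z : C) :=
  const C (3%:R^-1) * (z + const C (w ^+ (i * 2)) * s z + const C (w ^+ i) * s (s z)).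

Lemma eigenpart_sum z : z = eigenpart 0 z + eigenpart 1 z + eigenpart 2 z.
Proof.
have w3 := cube_root_of_unity wE.
have three' : const C 3%:R != 0 by rewrite fmorph_eq0.
have cE : const C w ^+ 2 + const C w + 1 = 0 by rewrite -rmorphXn -rmorphD -(rmorph1 (const C)) -rmorphD wE rmorph0.
have -> : eigenpart 0 z + eigenpart 1 z + eigenpart 2 z =
  z + const C 3%:R^-1 * ((const C w ^+ 2 + const C w + 1) * s (s z)) +
      const C 3%:R^-1 * ((const C w ^+ 2 + const C w + 1) * s z) +
      const C 3%:R^-1 * (const C w ^+ 4 - const C w) * s z.
  rewrite /eigenpart !rmorphXn /= fmorphV /= !rmorph_nat.
  field; by rewrite -(rmorph_nat (const C)).
have -> : const C w ^+ 4 - const C w = 0.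
  by rewrite exprS -rmorphXn w3 rmorph1 mulr1 subrr.
by rewrite cE !mul0r !mulr0 mul0r !addr0.
Qed.

Lemma eigenpartP i z : s (eigenpart i z) = const C (w ^+ i) * eigenpart i z.
Proof.
have w3 := cube_root_of_unity wE.
have cw3 : const C w ^+ 3 = 1 by rewrite -rmorphXn w3 rmorph1.
have sw c : s (const C c) = const C c by exact: sc.
rewrite /eigenpart !(rmorphM, rmorphD) /= !sw s3.
have h1 : const C (w ^+ (i * 2)) * const C (w ^+ i) = 1.
  by rewrite -rmorphM -exprD -mulnSr mulnC exprM w3 expr1n rmorph1.
have h2 : const C (w ^+ i) * const C (w ^+ i) = const C (w ^+ (i * 2)).
  by rewrite -rmorphM -exprD addnn -muln2.
set a := const C (w ^+ (i * 2)) in h1 h2 *; set b := const C (w ^+ i) in h1 h2 *.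
rewrite -h2 in h1 *.
transitivity (const C 3%:R^-1 * ((b * b * b) * s z + b * b * s (s z) + b * z)); last by ring.
by rewrite h1; ring.
Qed.

End Eigenparts.

Variables (w : k) (x y : C) (f : {poly k}).
Hypothesis K : kummer s w x y f.

Let xT := kum_transc K.
Let rootw := kum_root K.
Let pulls := kum_pull K.
Let orders := kum_order K.

Lemma kummer_poly_neq0 : f != 0.
Proof.
apply/eqP=> f0; have := expf_neq0 3 (kum_neq0 K).
by rewrite (kum_eq K) f0 ev0 eqxx.
Qed.

Lemma kummer_surj z : exists a, s a = z.
Proof. by exists (s (s z)); exact: kum_order K z. Qed.

Lemma kummer_base : s x = x.
Proof. by apply/(kum_fixed K); exact: ratl_id. Qed.

(** The eigenparts of [z], divided by [1], [y] and [y ^+ 2], are fixed by [s]. *)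
Lemma kummer_decomposition z : exists a b c,
  [/\ ratl x a, ratl x b & ratl x c] /\ z = a + b * y + c * y ^+ 2.
Proof.
have y0 := kum_neq0 K.
have w0 : const C w != 0.
  rewrite fmorph_eq0; apply/eqP=> w0; have := kum_root K.
  by rewrite w0 expr0n !add0r => /eqP; rewrite oner_eq0.
exists (eigenpart w 0 z), (eigenpart w 1 z / y), (eigenpart w 2 z / y ^+ 2); split.
  split; apply/(kum_fixed K).
  - by rewrite (eigenpartP rootw pulls orders) rmorph1 mul1r.
  - rewrite fmorph_div (eigenpartP rootw pulls orders) (kum_gen K) expr1; field.
    by rewrite y0 w0.
  - have -> : s (eigenpart w 2 z / y ^+ 2) = s (eigenpart w 2 z) / (s y) ^+ 2 by rewrite fmorph_div rmorphXn.
    rewrite (eigenpartP rootw pulls orders) (kum_gen K) rmorphXn /=; field.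
    by rewrite y0 w0.
by rewrite {1}(eigenpart_sum rootw z); field.
Qed.

(* Eigenvectors for distinct eigenvalues are linearly independent. *)
Lemma kummer_independent a b c : ratl x a -> ratl x b -> ratl x c ->
  a + b * y + c * y ^+ 2 = 0 -> [/\ a = 0, b = 0 & c = 0].
Proof.
move=> /(kum_fixed K) sa /(kum_fixed K) sb /(kum_fixed K) sc E.
have y0 := kum_neq0 K; have sy := kum_gen K.
have wE := kum_root K; have w3 := cube_root_of_unity wE.
have sw := kum_pull K w.
set W := const C w in sy sw *.
have W3 : W ^+ 3 = 1 by rewrite /W -rmorphXn w3 rmorph1.
have WE : W ^+ 2 + W + 1 = 0.
  have -> : W ^+ 2 + W + 1 = const C (w ^+ 2 + w + 1) by rewrite !rmorphD /= rmorphXn rmorph1.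
  by rewrite wE rmorph0.
have three' : 3%:R != 0 :> C by rewrite -(rmorph_nat (const C)) fmorph_eq0.
have E1 : a + W * (b * y) + W ^+ 2 * (c * y ^+ 2) = 0.
  by rewrite -[RHS](rmorph0 s) -E !(rmorphD, rmorphM, rmorphXn) /= sa sb sc sy; ring.
have E2 : a + W ^+ 2 * (b * y) + W * (c * y ^+ 2) = 0.
  rewrite -[RHS](rmorph0 s) -E1 !(rmorphD, rmorphM, rmorphXn) /= sa sb sc sy sw.
  have -> : W ^+ 2 * (c * (W * y) ^+ 2) = W ^+ 3 * W * (c * y ^+ 2) by ring.
  by rewrite W3; ring.
have a0 : a = 0.
  apply: (mulfI three'); rewrite mulr0.
  have -> : 3%:R * a = (a + b * y + c * y ^+ 2) + (a + W * (b * y) + W ^+ 2 * (c * y ^+ 2)) +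
    (a + W ^+ 2 * (b * y) + W * (c * y ^+ 2)) - (W ^+ 2 + W + 1) * (b * y + c * y ^+ 2) by ring.
  by rewrite E E1 E2 WE mul0r !addr0 subrr.
rewrite a0 !add0r in E E1.
have W1 : W - 1 != 0.
  by rewrite subr_eq0 -(rmorph1 (const C)) (inj_eq (fmorph_inj _)) cube_root_neq1.
have W0 : W != 0.
  by apply/eqP=> W0; move/eqP: W3; rewrite W0 expr0n eq_sym oner_eq0.
have cy : c * y ^+ 2 = 0.
  apply: (mulfI W0); apply: (mulfI W1); rewrite !mulr0.
  have -> : (W - 1) * (W * (c * y ^+ 2)) =
    (W * (b * y) + W ^+ 2 * (c * y ^+ 2)) - W * (b * y + c * y ^+ 2) by ring.
  by rewrite E E1 mulr0 subrr.
have by0 : b * y = 0 by rewrite cy addr0 in E.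
split=> //; first by apply: (mulIf y0); rewrite by0 mul0r.
by apply: (mulIf (expf_neq0 2 y0)); rewrite cy mul0r.
Qed.

Lemma kummer_finite_over : finite_over x.
Proof.
split; first exact: xT.
exists 3, (fun i : 'I_3 => y ^+ i) => z.
have [a [b [c [[[p1 [q1 [q10 E1]]] [p2 [q2 [q20 E2]]] [p3 [q3 [q30 E3]]]] ->]]]] :=
  kummer_decomposition z.
exists (q1 * q2 * q3), (fun i : 'I_3 => nth 0 [:: p1 * q2 * q3; p2 * q1 * q3; p3 * q1 * q2] i).
rewrite !mulf_neq0 //; split=> //.
by rewrite !big_ord_recl big_ord0 /= !evM -E1 -E2 -E3; ring.
Qed.

Lemma kummer_point O : is_point O -> is_point [set a | O (s a)].
Proof. by apply: endo_point; [exact: kum_pull K|exact: kummer_surj]. Qed.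

Lemma regular_eigenpart i z : regular x z -> regular x (eigenpart w i z).
Proof.
have reg_s a : regular x a -> regular x (s a).
  move=> ra O PO Ox; apply: (ra _ (kummer_point PO)) => /=.
  by rewrite kummer_base.
move=> rz; have rc c : regular x (const C c) by move=> O PO _; exact: point_const.
have R := regular_subring x.
have Rm a b : regular x a -> regular x b -> regular x (a * b) by move=> *; apply: (subringM R).
have Rd a b : regular x a -> regular x b -> regular x (a + b) by move=> *; apply: (subringD R).
have rs := reg_s _ rz; have rss := reg_s _ rs.
exact: (Rm _ _ (rc _) (Rd _ _ (Rd _ _ rz (Rm _ _ (rc _) rs)) (Rm _ _ (rc _) rss))).
Qed.

End Kummer.

(** * Orders of the eigencomponents at a pole of [x] *)

Section KummerComponents.
Variables (k : fieldType) (C : curve k) (x : C).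
Hypothesis xT : transcendental x.
Implicit Types (O : set C) (e z : C) (p q F : {poly k}).

Lemma size_cubeM p F : p != 0 -> F != 0 ->
  size (p ^+ 3 * F) = (3 * (size p).-1 + (size F).-1).+1.
Proof.
move=> p0 F0; have p30 : p ^+ 3 != 0 by rewrite expf_neq0.
have := size_exp p 3; have := size_mul p30 F0.
move: p0 F0 p30; rewrite -!size_poly_gt0.
by move: (size (p ^+ 3 * F)) (size (p ^+ 3)) (size F) (size p); clear; lia.
Qed.

Lemma component_cube e p q F : q != 0 -> e ^+ 3 = ev x F ->
  (ev x p / ev x q * e) ^+ 3 = ev x (p ^+ 3 * F) / ev x (q ^+ 3).
Proof. by move=> q0 E; rewrite exprMn expr_div_n E !evE; field; rewrite ev_eq0. Qed.

(** A valuation ring contains an element as soon as it contains its cube, and the cube of a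
    component is a fraction in [x]. *)
Lemma component_infinity e p q F O : is_point O -> ~ O x -> p != 0 -> q != 0 -> F != 0 ->
  e ^+ 3 = ev x F ->
  O (ev x p / ev x q * e) <-> (3 * (size p).-1 + (size F).-1 <= 3 * (size q).-1)%N.
Proof.
move=> PO nx p0 q0 F0 E.
have q30 : q ^+ 3 != 0 by rewrite expf_neq0.
have -> : (3 * (size p).-1 + (size F).-1 <= 3 * (size q).-1)%N =
    (size (p ^+ 3 * F)%R <= size (q ^+ 3)%R)%N.
  by rewrite -[q ^+ 3]mulr1 !size_cubeM ?oner_eq0 // size_polyC oner_eq0 /= addn0 ltnS.
split=> [Oz|le].
  by apply: (ev_infinity_in PO nx q30); rewrite -(component_cube _ q0 E); exact: pointX.
by apply: (point_Xn PO (n := 3)) => //; rewrite (component_cube _ q0 E); exact: ev_infinity_le.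
Qed.

(** The cubes have degrees congruent modulo 3 to those of [F] and [F'], whatever the rational
    coefficients are. *)
Lemma component_val_neq e e' F F' b b' O : is_point O -> ~ O x -> F != 0 -> F' != 0 ->
  e ^+ 3 = ev x F -> e' ^+ 3 = ev x F' -> (size F).-1 != (size F').-1 %[mod 3] ->
  ratl x b -> ratl x b' -> val_neq O (b * e) (b' * e').
Proof.
move=> PO nx F0 F'0 E E' ne /(ratl_quot xT)[p [q [q0 ->]]] /(ratl_quot xT)[p' [q' [q'0 ->]]].
have [->|p0] := eqVneq p 0; first by rewrite ev0 !mul0r; exact: Or41.
have [->|p'0] := eqVneq p' 0; first by rewrite ev0 !mul0r; exact: Or42.
apply: (val_neq_cube (p := (p * q') ^+ 3 * F) (q := (p' * q) ^+ 3 * F') PO xT nx).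
- by apply: mulf_neq0 => //; apply: expf_neq0; exact: mulf_neq0.
- by apply: mulf_neq0 => //; apply: expf_neq0; exact: mulf_neq0.
- rewrite !size_cubeM ?mulf_neq0 // eqSS; apply: contra ne => /eqP h.
  by rewrite -(modnMDl (size (p * q')).-1 (size F).-1) mulnC h mulnC modnMDl.
rewrite (component_cube _ q0 E) (component_cube _ q'0 E') !evE.
have eq0 : ev x q != 0 by rewrite ev_eq0.
have eq'0 : ev x q' != 0 by rewrite ev_eq0.
by field; rewrite eq0 eq'0.
Qed.

(* [S / x^D] is the part of [b] that matters for the pole of [b * e] at infinity. *)
Lemma component_approx e F D b O : is_point O -> ~ O x -> F != 0 -> e ^+ 3 = ev x F ->
  ((size F).-1 <= 3 * D + 3)%N -> ratl x b ->
  exists S, O ((b - ev x S / x ^+ D) * e).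
Proof.
move=> PO nx F0 E le /(ratl_quot xT)[p [q [q0 ->]]].
have x0 := transcendental_neq0 xT; have eq0 : ev x q != 0 by rewrite ev_eq0.
(* In the error [r / (q * 'X^D)] the degree of [r] is below that of [q]; this gain of one, together
   with ['X^D], outweighs [F], whose degree is at most [3 * D + 3]. *)
exists ((p * 'X^D) %/ q); set r := (p * 'X^D) %% q.
have -> : ev x p / ev x q - ev x ((p * 'X^D) %/ q) / x ^+ D = ev x r / ev x (q * 'X^D).
  have -> : ev x r = ev x p * x ^+ D - ev x ((p * 'X^D) %/ q) * ev x q.
    rewrite -[X in X ^+ D]evX -evXn -!evM -evB; congr (ev x _).
    by apply/eqP; rewrite eq_sym subr_eq addrC /r -divp_eq.
  by rewrite !evE; field; rewrite eq0 expf_neq0.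
have [->|r0] := eqVneq r 0; first by rewrite ev0 !mul0r; exact: point0.
apply/(component_infinity PO nx r0 _ F0 E); first by rewrite mulf_neq0 // expf_neq0 // polyX_eq0.
rewrite size_mulXn //.
have lt : (size r < size q)%N by rewrite ltn_modp.
move: r0 lt le; rewrite -size_poly_gt0.
by move: (size r) (size q) (size F).-1; clear; lia.
Qed.

Lemma component_zero e F D S O : is_point O -> ~ O x -> F != 0 -> e ^+ 3 = ev x F ->
  (3 * D < (size F).-1)%N -> O (ev x S / x ^+ D * e) -> S = 0.
Proof.
move=> PO nx F0 E lt OS; apply/eqP; apply: contrapT => /negP S0.
have XD0 : 'X^D != 0 :> {poly k} by rewrite expf_neq0 // polyX_eq0.
have : O (ev x S / ev x 'X^D * e) by rewrite !evE.
move/(component_infinity PO nx S0 XD0 F0 E); rewrite size_polyXn /=.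
by move: lt; move: (size S).-1 (size F).-1; clear; lia.
Qed.

End KummerComponents.

Lemma size_sqrM (k : fieldType) (u v : {poly k}) : u != 0 -> v != 0 ->
  (size (u * v ^+ 2)).-1 = ((size u).-1 + 2 * (size v).-1)%N.
Proof.
move=> u0 v0; have v20 : v ^+ 2 != 0 by rewrite expf_neq0.
have := size_exp v 2; have := size_mul u0 v20; move: u0 v0 v20; rewrite -!size_poly_gt0.
by move: (size (u * v ^+ 2)) (size u) (size v) (size (v ^+ 2)); clear; lia.
Qed.

(** * The genus of a cyclic cubic cover *)

Section KummerGenus.
Variables (k : closedFieldType) (three : 3%:R != 0 :> k) (C : curve k).
Variables (s : {rmorphism C -> C}) (w : k) (x y : C) (h1 h2 : {poly k}).
Hypothesis K : kummer s w x y (h1 * h2 ^+ 2).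
Hypothesis sep : separable_poly (h1 * h2).

Let xT := kum_transc K.
Let e1 := y.
(** Together with 1 and [e1] this generates the regular functions over [k[x]]: dividing [y ^+ 2] by
    [h2] exchanges the roles of [h1] and [h2] in the cube. *)
Let e2 := y ^+ 2 / ev x h2.
Let F1 := h1 * h2 ^+ 2.
Let F2 := h2 * h1 ^+ 2.

Lemma kummer_factors_neq0 : h1 != 0 /\ h2 != 0.
Proof.
have := kummer_poly_neq0 K; rewrite mulf_eq0 negb_or expf_eq0 /= => /andP[].
by [].
Qed.

Lemma kummer_e2_cube : e2 ^+ 3 = ev x F2.
Proof.
have [h10 h20] := kummer_factors_neq0.
rewrite /e2 expr_div_n -exprM mulnC exprM (kum_eq K) !evE; field.
by rewrite ev_eq0.
Qed.

Lemma kummer_e2_neq0 : e2 != 0.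
Proof.
have [h10 h20] := kummer_factors_neq0.
by rewrite mulf_neq0 ?expf_neq0 ?(kum_neq0 K) // invr_eq0 ev_eq0.
Qed.

Lemma kummer_e2_gen : s e2 = const C (w ^+ 2) * e2.
Proof.
rewrite /e2 fmorph_div (pullback_ev (kum_pull K)) (kummer_base K).
by rewrite rmorphXn /= (kum_gen K) exprMn rmorphXn mulrA.
Qed.

Lemma component_regular (e b : C) (u v : {poly k}) : separable_poly (u * v) -> e != 0 ->
  e ^+ 3 = ev x (u * v ^+ 2) -> ratl x b -> regular x (b * e) -> exists p, b = ev x p.
Proof.
move=> sepuv e0 E rb reg.
have [p [q [q0 cpq qb]]] := ratl_coprime xT rb.
have [||r rE] := @ratl_regular _ _ x ((b * e) ^+ 3) xT.
- rewrite exprMn E; apply: (subringM (ratl_subring xT)); last exact: ratl_ev.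
  exact: (subringX 3 (ratl_subring xT) rb).
- exact: (subringX 3 (regular_subring x) reg).
have sq : (size q <= 1)%N.
  apply: (cube_factor_poly (r := r) sepuv q0 cpq).
  apply: (ev_inj xT); rewrite [RHS]evM -rE exprMn E !evE -qb; ring.
move: q0 qb; rewrite (size1_polyC sq) polyC_eq0 evC => q0 qb.
exists ((q`_0)^-1%:P * p); rewrite evM evC -qb fmorphV mulKf //.
by rewrite fmorph_eq0.
Qed.

Lemma kummer_regular z : regular x z ->
  exists p0 p1 p2, z = ev x p0 + ev x p1 * e1 + ev x p2 * e2.
Proof.
move=> rz; have [h10 h20] := kummer_factors_neq0.
have y0 := kum_neq0 K.
have reg i := regular_eigenpart K i rz.
have w0 : const C w != 0.
  rewrite fmorph_eq0; apply/eqP=> w0; have := kum_root K.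
  by rewrite w0 expr0n !add0r => /eqP; rewrite oner_eq0.
have [|p0 E0] := ratl_regular xT _ (reg 0%N).
  by apply/(kum_fixed K); rewrite (eigenpartP (kum_root K) (kum_pull K) (kum_order K)) rmorph1 mul1r.
have [||p1 E1] := @component_regular e1 (eigenpart s w 1 z / e1) h1 h2 sep y0 (kum_eq K).
- apply/(kum_fixed K); rewrite fmorph_div (eigenpartP (kum_root K) (kum_pull K) (kum_order K)) /e1 (kum_gen K) expr1; field.
  by rewrite y0 w0.
- by rewrite divfK.
have sep' : separable_poly (h2 * h1) by rewrite mulrC.
have e20 := kummer_e2_neq0.
have [||p2 E2] := @component_regular e2 (eigenpart s w 2 z / e2) h2 h1 sep' e20 kummer_e2_cube.
- apply/(kum_fixed K); rewrite fmorph_div (eigenpartP (kum_root K) (kum_pull K) (kum_order K)) kummer_e2_gen rmorphXn /=; field.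
  by rewrite e20 w0.
- by rewrite divfK.
exists p0, p1, p2; rewrite -E0 -E1 -E2 !divfK //.
exact: (eigenpart_sum three _ (kum_root K)).
Qed.

Lemma kummer_components z : exists a b c, [/\ ratl x a, ratl x b & ratl x c] /\
  z = a + b * e1 + c * e2.
Proof.
have [h10 h20] := kummer_factors_neq0.
have [a [b [c [[ra rb rc] E]]]] := kummer_decomposition three K z.
exists a, b, (c * ev x h2); split.
  by split=> //; apply: (subringM (ratl_subring xT)) => //; exact: ratl_ev.
by rewrite E /e2 /e1; field; rewrite ev_eq0.
Qed.

Lemma kummer_regular_gen p0 p1 p2 : regular x (ev x p0 + ev x p1 * e1 + ev x p2 * e2).
Proof.
move=> O PO Ox; have [h10 h20] := kummer_factors_neq0.
have Oe u : O (u ^+ 3) -> O u by apply: point_Xn.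
have Oe1 : O e1 by apply: Oe; rewrite (kum_eq K); exact: point_ev.
have Oe2 : O e2 by apply: Oe; rewrite kummer_e2_cube; exact: point_ev.
have Oev p : O (ev x p) by exact: point_ev.
exact: (pointD PO (pointD PO (Oev _) (point_mul PO (Oev _) Oe1)) (point_mul PO (Oev _) Oe2)).
Qed.

Hypothesis ramified : ~~ (3 %| (size F1).-1)%N.

Let A := (size h1).-1.
Let B := (size h2).-1.

Lemma kummer_degrees : (size F1).-1 = (A + 2 * B)%N /\ (size F2).-1 = (B + 2 * A)%N.
Proof.
have [h10 h20] := kummer_factors_neq0.
by rewrite /F1 /F2 !size_sqrM.
Qed.

(** The components have degrees 0, [A + 2 * B] and [B + 2 * A], the last being twice the second
    modulo 3. Ramification makes them distinct modulo 3, so no poles cancel. *)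
Lemma kummer_infinity O a b c : is_point O -> ~ O x -> ratl x a -> ratl x b -> ratl x c ->
  O (a + b * e1 + c * e2) -> [/\ O a, O (b * e1) & O (c * e2)].
Proof.
move=> PO nx ra rb rc; have [h10 h20] := kummer_factors_neq0.
have [d1 d2] := kummer_degrees; move: ramified; rewrite d1 => ram.
have F10 : F1 != 0 by rewrite mulf_neq0 ?expf_neq0.
have F20 : F2 != 0 by rewrite mulf_neq0 ?expf_neq0.
have one3 : 1 ^+ 3 = ev x 1 by rewrite expr1n ev1.
have s1 : (size (1 : {poly k})).-1 = 0%N by rewrite size_poly1.
have v01 : val_neq O (a * 1) (b * e1).
  apply: (component_val_neq xT PO nx (oner_neq0 _) F10 one3 (kum_eq K)) => //.
  by rewrite s1 d1; move: ram; rewrite /dvdn; move: A B; clear; lia.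
have v02 : val_neq O (a * 1) (c * e2).
  apply: (component_val_neq xT PO nx (oner_neq0 _) F20 one3 kummer_e2_cube) => //.
  by rewrite s1 d2; move: ram; rewrite /dvdn; move: A B; clear; lia.
have v12 : val_neq O (b * e1) (c * e2).
  apply: (component_val_neq xT PO nx F10 F20 (kum_eq K) kummer_e2_cube) => //.
  by rewrite d1 d2; move: ram; rewrite /dvdn; move: A B; clear; lia.
rewrite mulr1 in v01 v02 => Oz.
have [O01 Oc] := val_neq_add_in PO (val_neq_addl PO v01 v02 v12) Oz.
by have [Oa Ob] := val_neq_add_in PO v01 O01.
Qed.

(** Membership of each component at a pole of [x] depends only on degrees, hence not on the pole. *)
Lemma kummer_infinity_unique O O' : is_point O -> is_point O' -> ~ O x -> ~ O' x -> O = O'.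
Proof.
move=> PO PO' nx nx'; apply: point_maximal => // z.
have [h10 h20] := kummer_factors_neq0.
have F10 : F1 != 0 by rewrite mulf_neq0 ?expf_neq0.
have F20 : F2 != 0 by rewrite mulf_neq0 ?expf_neq0.
have [a [b [c [[ra rb rc] ->]]]] := kummer_components z.
have one3 : 1 ^+ 3 = ev x 1 by rewrite expr1n ev1.
have comp (e b' : C) F : F != 0 -> e ^+ 3 = ev x F -> ratl x b' -> O (b' * e) -> O' (b' * e).
  move=> F0 E /(ratl_quot xT)[p [q [q0 ->]]].
  have [->|p0] := eqVneq p 0; first by rewrite ev0 !mul0r => _; exact: point0.
  move/(component_infinity xT PO nx p0 q0 F0 E) => h.
  exact/(component_infinity xT PO' nx' p0 q0 F0 E).
move=> /(kummer_infinity PO nx ra rb rc)[Oa Ob Oc]; do 2?apply: pointD => //.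
- by rewrite -(mulr1 a); apply: (comp _ _ _ (oner_neq0 _) one3) => //; rewrite mulr1.
- exact: (comp _ _ _ F10 (kum_eq K)).
- exact: (comp _ _ _ F20 kummer_e2_cube).
Qed.

(** [D1] counts the [m > 0] for which [e1 / x ^+ m] still has a pole at infinity, that is
    [3 * m < A + 2 * B]; nonnegative powers of [x] times [e1] are regular at finite points and
    vanish in H^1. [D2] does the same for [e2]. *)
Let D1 := ((A + 2 * B).-1 %/ 3)%N.
Let D2 := ((B + 2 * A).-1 %/ 3)%N.

Let basis (i : 'I_(D1 + D2)) (O : set C) : C :=
  if `[< O x >] then 0 else
  match fintype.split i with
  | inl d => x ^+ d / x ^+ D1 * e1
  | inr d => x ^+ d / x ^+ D2 * e2
  end.

Lemma ev_rVpoly n (v : 'rV[k]_n) : ev x (rVpoly v) = \sum_(d < n) const C (v 0 d) * x ^+ d.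
Proof.
rewrite /ev (horner_coef_wide _ (leq_trans (size_poly _ _) (size_poly _ _))).
by apply: eq_bigr => i _; rewrite coef_map coef_rVpoly_ord.
Qed.

Lemma basis_sum (c : 'rV[k]_(D1 + D2)) O : ~ O x ->
  \sum_i const C (c 0 i) * basis i O =
  ev x (rVpoly (lsubmx c)) / x ^+ D1 * e1 + ev x (rVpoly (rsubmx c)) / x ^+ D2 * e2.
Proof.
move=> nx; rewrite big_split_ord !ev_rVpoly !mulr_suml; congr (_ + _).
  apply: eq_bigr => d _; rewrite mxE /basis asboolF // -/(unsplit (inl d)) unsplitK.
  by rewrite !mulrA.
apply: eq_bigr => d _; rewrite mxE /basis asboolF // -/(unsplit (inr d)) unsplitK.
by rewrite !mulrA.
Qed.

Lemma kummer_has_genus : has_genus C (D1 + D2).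
Proof.
have [h10 h20] := kummer_factors_neq0.
have F10 : F1 != 0 by rewrite mulf_neq0 ?expf_neq0.
have F20 : F2 != 0 by rewrite mulf_neq0 ?expf_neq0.
have [d1 d2] := kummer_degrees; move: (ramified); rewrite d1 => ram.
have x0 := transcendental_neq0 xT.
have [P [PP nx]] := infinite_point_exists xT.
have inP O : is_point O -> ~ O x -> O = P by move=> PO nOx; exact: kummer_infinity_unique.
have split_poly (S : {poly k}) D : ev x S / x ^+ D =
    ev x (take_poly D S) / x ^+ D + ev x (drop_poly D S).
  rewrite -{1}(poly_take_drop D S) evD evM evXn evX; field.
  by rewrite expf_neq0.
have rV_take D (S : {poly k}) : rVpoly (poly_rV (take_poly D S) : 'rV_D) = take_poly D S.
  by rewrite poly_rV_K // size_take_poly.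
apply: (@has_genus_basis _ _ _ basis).
- move=> i; apply: (sub_finite_set _ (finite_set1 P)) => O [PO nO]; apply: inP => // Ox.
  by apply: nO; rewrite /basis asboolT //; exact: point0.
- move=> a ra; have [f0 f0P] := strong_approximation (kummer_finite_over three K) ra.
  have [u0 [u1 [u2 [[r0 r1 r2] uE]]]] := kummer_components (a P - f0).
  have [p [q [q0 qu0]]] := r0.
  have Ou0 := polynomial_part xT PP nx q0 qu0.
  have [|S1 OS1] := component_approx (D := D1) xT PP nx F10 (kum_eq K) _ r1.
    by rewrite d1 /D1; move: ram; rewrite /dvdn; move: A B; clear; lia.
  have [|S2 OS2] := component_approx (D := D2) xT PP nx F20 kummer_e2_cube _ r2.
    by rewrite d2 /D2; move: ram; rewrite /dvdn; move: A B; clear; lia.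
  (* The part of [S1] below degree [D1] gives coordinates; the rest, divided by [x ^+ D1], is a
     polynomial in [x] and goes into the global function. The same holds for [S2]. *)
  exists (row_mx (poly_rV (take_poly D1 S1)) (poly_rV (take_poly D2 S2))).
  exists (f0 + (ev x (p %/ q) + ev x (drop_poly D1 S1) * e1 + ev x (drop_poly D2 S2) * e2)).
  move=> O PO; have [Ox|nOx] := pselect (O x).
    rewrite big1 => [|i _]; last by rewrite /basis asboolT // mulr0.
    rewrite subr0 opprD addrA; apply: point_sub => //; first exact: f0P.
    exact: kummer_regular_gen.
  rewrite (inP O PO nOx) basis_sum // row_mxKl row_mxKr !rV_take.
  have -> : a P - (ev x (take_poly D1 S1) / x ^+ D1 * e1 + ev x (take_poly D2 S2) / x ^+ D2 * e2) -
    (f0 + (ev x (p %/ q) + ev x (drop_poly D1 S1) * e1 + ev x (drop_poly D2 S2) * e2)) =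
    (u0 - ev x (p %/ q)) + (u1 - ev x S1 / x ^+ D1) * e1 + (u2 - ev x S2 / x ^+ D2) * e2.
    rewrite (split_poly S1) (split_poly S2); move/eqP: uE; rewrite subr_eq => /eqP ->; ring.
  by apply: pointD => //; apply: pointD.
move=> c f h.
have rf : regular x f.
  move=> O PO Ox; have := h O PO; rewrite big1 ?add0r // => i _.
  by rewrite /basis asboolT // mulr0.
have [p0 [p1 [p2 fE]]] := kummer_regular rf.
have := h P PP; rewrite basis_sum // fE.
(* The coordinates and the contribution of [f] to the same component occupy disjoint ranges of
   degrees, so [S1 = 0] and [S2 = 0] force all coordinates to vanish. *)
set S1 := rVpoly (lsubmx c) + p1 * 'X^D1; set S2 := rVpoly (rsubmx c) + p2 * 'X^D2.
have -> : ev x (rVpoly (lsubmx c)) / x ^+ D1 * e1 + ev x (rVpoly (rsubmx c)) / x ^+ D2 * e2 +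
   (ev x p0 + ev x p1 * e1 + ev x p2 * e2) =
   ev x p0 + ev x S1 / x ^+ D1 * e1 + ev x S2 / x ^+ D2 * e2.
  by rewrite /S1 /S2 !evE; field; rewrite !expf_neq0.
have rS S D : ratl x (ev x S / x ^+ D).
  apply: (subringM (ratl_subring xT)); first exact: ratl_ev.
  by apply: ratlV => //; rewrite -[X in X ^+ D]evX -evXn; exact: ratl_ev.
move=> /(kummer_infinity PP nx (ratl_ev x p0) (rS S1 D1) (rS S2 D2))[_ O1 O2].
have S10 : S1 = 0.
  apply: (component_zero xT PP nx F10 (kum_eq K) _ O1).
  by rewrite d1 /D1; move: ram; rewrite /dvdn; move: A B; clear; lia.
have S20 : S2 = 0.
  apply: (component_zero xT PP nx F20 kummer_e2_cube _ O2).
  by rewrite d2 /D2; move: ram; rewrite /dvdn; move: A B; clear; lia.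
have zero D (v : 'rV[k]_D) (p : {poly k}) : rVpoly v + p * 'X^D = 0 -> v = 0.
  move=> E; rewrite -[v]rVpolyK -(_ : take_poly D (rVpoly v + p * 'X^D) = rVpoly v).
    by rewrite E take_poly0r linear0.
  by rewrite take_polyDMXn // size_poly.
by rewrite -[c]hsubmxK (zero _ _ _ S10) (zero _ _ _ S20) row_mx0.
Qed.

(** The degrees [A + 2 * B] and [B + 2 * A] add up to [3 * (A + B)] and neither is divisible by 3,
    so rounding the two thirds loses exactly one: [D1 + D2] is [A + B - 1]. *)
Lemma kummer_genus g : has_genus C g -> (A + B = g.+1)%N.
Proof.
move/(has_genus_unique kummer_has_genus) => <-; move: ramified.
have [-> _] := kummer_degrees; rewrite /D1 /D2 /dvdn.
by move: A B; clear; lia.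
Qed.

End KummerGenus.

Lemma card_three (T : Type) (G : set T) : (G #= `I_3)%card <->
  exists a b c, [/\ a <> b, a <> c, b <> c & G = [set s | [\/ s = a, s = b | s = c]]].
Proof.
split=> [/card_set_bijP[f [fG fI fS]]|[a [b [c [ab ac bc GE]]]]].
  have [a Ga fa] : exists2 a, G a & f a = 0%N by have [a Ga <-] := fS 0%N isT; exists a.
  have [b Gb fb] : exists2 b, G b & f b = 1%N by have [b Gb <-] := fS 1%N isT; exists b.
  have [c Gc fc] : exists2 c, G c & f c = 2%N by have [c Gc <-] := fS 2%N isT; exists c.
  exists a, b, c; split; try by move=> E; move: fa fb fc; rewrite ?E => *; congruence.
  apply/seteqP; split=> [s Gs|s [->|->|->]//].
  have inj u : G u -> f s = f u -> s = u by move=> Gu; apply: fI; exact: mem_set.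
  have := fG s Gs; rewrite /= ; case E: (f s) => [|[|[|n]]] // _.
  - by apply: Or31; apply: inj; rewrite ?fa.
  - by apply: Or32; apply: inj; rewrite ?fb.
  - by apply: Or33; apply: inj; rewrite ?fc.
pose f s := if `[< s = a >] then 0%N else if `[< s = b >] then 1%N else 2%N.
have fa : f a = 0%N by rewrite /f asboolT.
have fb : f b = 1%N by rewrite /f asboolF ?asboolT // => /esym.
have fc : f c = 2%N by rewrite /f !asboolF // => /esym.
apply/card_set_bijP; exists f; rewrite GE; split.
- by move=> s [->|->|->]; rewrite ?fa ?fb ?fc.
- by move=> s t /set_mem[->|->|->] /set_mem[->|->|->]; rewrite ?fa ?fb ?fc.
- case=> [|[|[|n]]] // _; [exists a|exists b|exists c] => //=; by [apply: Or31|apply: Or32|apply: Or33].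
Qed.

Lemma subgroup_order3 (k : fieldType) (C : curve k) (G : set (C -> C)) :
  is_subgroup G -> (G #= `I_3)%card -> exists s : {rmorphism C -> C},
  [/\ pullback s, forall z, s (s (s z)) = z, exists z, s z != z &
    G = [set t | [\/ t = id, t = s | t = s \o s]]].
Proof.
move=> GG /card_three[a [b [c [ab ac bc GE]]]].
have [u [v [iu iv uv GE']]] : exists u v, [/\ id <> u, id <> v, u <> v &
    G = [set t | [\/ t = id, t = u | t = v]]].
  have := subgroup_id GG; rewrite GE => -[ia|ib|ic].
  - by exists b, c; rewrite ia.
  - exists a, c; rewrite ib; split; [exact: nesym|by []|by []|].
    by apply/seteqP; split=> t []; by [apply: Or31|apply: Or32|apply: Or33].
  - exists a, b; rewrite ic; split; [exact: nesym|exact: nesym|by []|].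
    by apply/seteqP; split=> t []; by [apply: Or31|apply: Or32|apply: Or33].
have Gu : G u by rewrite GE'; apply: Or32.
have Gv : G v by rewrite GE'; apply: Or33.
have bij t : G t -> bijective t by move=> /(subgroup_aut GG)[f [_ bf ->]].
have uvid : u \o v = id.
  have := subgroup_comp GG Gu Gv; rewrite {1}GE' => -[//|E|E].
    case: iv; apply/funext=> z; apply: (bij_inj (bij _ Gu)).
    by rewrite -[in LHS]E.
  case: iu; apply/funext=> z; have [v' _ vK] := bij _ Gv.
  by rewrite -(vK z) -[in LHS]E.
have uu : u \o u = v.
  have := subgroup_comp GG Gu Gu; rewrite {1}GE' => -[E|E|//].
    case: uv; apply/funext=> z; apply: (bij_inj (bij _ Gu)).
    by rewrite -[LHS]/((u \o u) z) E -[RHS]/((u \o v) z) uvid.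
  case: iu; apply/funext=> z; apply: (bij_inj (bij _ Gu)).
  by rewrite -[RHS]/((u \o u) z) E.
have [f [fp bf uE]] := subgroup_aut GG Gu.
exists f; split=> //.
- by move=> z; rewrite -uE -[RHS]/(id z) -uvid -uu.
- apply: contrapT => h; case: iu; apply/funext=> z.
  by apply/esym/eqP; rewrite uE; apply: contrapT => /negP nz; apply: h; exists z.
- by rewrite GE' -uu uE.
Qed.

Lemma cube_root_exists (k : closedFieldType) : exists w : k, w ^+ 2 + w + 1 = 0.
Proof.
have [|w] := closed_rootP (('X^2 + 'X + 1) : {poly k}) _.
  by rewrite -addrA size_polyDl ?size_polyXn // size_XaddC.
by rewrite /root !hornerE => /eqP E; exists w.
Qed.

Section ChangeGenerators.
Variables (k : closedFieldType) (three : 3%:R != 0 :> k) (C : curve k).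
Variables (s : {rmorphism C -> C}).

(** As [s] moves some [z], the eigenpart of [z] for [w] or for [w ^+ 2] is nonzero; the eigenvalue
    that occurs is taken as the root of unity. *)
Lemma kummer_exists : pullback s -> (forall z, s (s (s z)) = z) ->
  (exists z, s z != z) -> forall x, transcendental x -> (forall z, s z = z <-> ratl x z) ->
  exists w y f, kummer s w x y f.
Proof.
move=> sc s3 [z sz] x xT fix_s.
have [w wE] := cube_root_exists k.
have [w' [y0 [w'E y00 sy0]]] : exists w' y0, [/\ w' ^+ 2 + w' + 1 = 0, y0 != 0 &
    s y0 = const C w' * y0].
  have [e1|e1] := eqVneq (eigenpart s w 1 z) 0; last first.
    exists w, (eigenpart s w 1 z); split=> //; rewrite (eigenpartP wE sc s3).
    by rewrite expr1.
  have [e2|e2] := eqVneq (eigenpart s w 2 z) 0; last first.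
    exists (w ^+ 2), (eigenpart s w 2 z); split=> //; first exact: cube_root_sq.
    exact: (eigenpartP wE sc s3).
  case/eqP: sz; rewrite (eigenpart_sum three s wE z) e1 e2 !addr0.
  by rewrite (eigenpartP wE sc s3) rmorph1 mul1r.
have [p [q [q0 E]]] : ratl x (y0 ^+ 3).
  by apply/fix_s; rewrite rmorphXn sy0 exprMn -rmorphXn cube_root_of_unity // rmorph1 mul1r.
have eq0 : ev x q != 0 by rewrite ev_eq0.
(* Multiplying by the denominator [q] of the cube turns the cube into the polynomial
   [p * q ^+ 2]. *)
exists w', (ev x q * y0), (p * q ^+ 2); split=> //.
- exact: mulf_neq0.
- by rewrite rmorphM sy0 (_ : s (ev x q) = ev x q); [ring|apply/fix_s; exact: ratl_ev].
- by rewrite !evE -E; ring.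
Qed.

Lemma kummer_change w x y f x' w' y' f' : kummer s w x y f ->
  ratl x x' -> transcendental x' -> ratl x' x -> w' ^+ 2 + w' + 1 = 0 -> y' != 0 ->
  s y' = const C w' * y' -> y' ^+ 3 = ev x' f' -> kummer s w' x' y' f'.
Proof.
move=> K xx' x'T x'x w'E y'0 sy' E; split=> //.
- exact: kum_pull K.
- exact: kum_order K.
- have xT := kum_transc K; move=> z; split=> [/(kum_fixed K)|] rz; first exact: ratl_trans rz.
  by apply/(kum_fixed K); exact: (ratl_trans x'T xT).
Qed.

(** [t] fixes [k(x)], so it sends [y] to a cube root of the same element: [y], [s y] or
    [s (s y)]. *)
Lemma kummer_aut w x y f (t : {rmorphism C -> C}) : kummer s w x y f ->
  pullback t -> t x = x -> [\/ (t : C -> C) = id, t = s :> (C -> C) | t = s \o s :> (C -> C)].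
Proof.
move=> K tc tx; have xT := kum_transc K.
have tr a : ratl x a -> t a = a by exact: ratl_endo.
have wE := kum_root K; have sw := kum_pull K w.
have ext (u v : {rmorphism C -> C}) : (forall a, ratl x a -> u a = v a) -> u y = v y ->
    u = v :> (C -> C).
  move=> uv uvy; apply/funext=> z.
  have [a [b [c [[ra rb rc] ->]]]] := kummer_decomposition three K z.
  by rewrite !(rmorphD, rmorphM, rmorphXn) /= (uv a) // (uv b) // (uv c) // uvy.
have sr a : ratl x a -> s a = a by move/(kum_fixed K).
have : (t y - y) * ((t y - s y) * (t y - s (s y))) = 0.
  have ty : (t y) ^+ 3 = y ^+ 3 by rewrite -rmorphXn (kum_eq K) tr //; exact: ratl_ev.
  rewrite !(kum_gen K) rmorphM sw (kum_gen K); set W := const C w.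
  have WE : W ^+ 2 + W + 1 = 0.
    by rewrite /W -rmorphXn -(rmorph1 (const C)) -!rmorphD wE rmorph0.
  have -> : (t y - y) * ((t y - W * y) * (t y - W * (W * y))) =
     (t y ^+ 3 - y ^+ 3) - (W ^+ 2 + W + 1) * (t y * y * (t y - W * y))
     - (W ^+ 2 + W + 1) * (W - 1) * y ^+ 3 by ring.
  by rewrite ty WE; ring.
move/eqP; rewrite !mulf_eq0 !subr_eq0 => /orP[/eqP ty|/orP[/eqP ty|/eqP ty]].
- by apply: Or31; apply: (ext t idfun) => // a /tr.
- by apply: Or32; apply: (ext t s) => // a ra; rewrite tr ?sr.
- apply: Or33; apply: (ext t (s \o s : {rmorphism C -> C})) => // a ra.
  by rewrite tr //= !sr.
Qed.

End ChangeGenerators.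

Lemma separable_mulXsubC (k : fieldType) (a : k) (h : {poly k}) : separable_poly h -> ~~ root h a ->
  separable_poly (('X - a%:P) * h).
Proof.
move=> sh ha; rewrite separable_mul sh separable_poly.unlock derivXsubC coprimep1 /=.
by rewrite coprimep_sym coprimep_XsubC.
Qed.

(** Linear factors are inserted one at a time. A new root enters [h1]; a further copy moves it from
    [h1] to [h2], then from [h2] to [h3], so [h1] and [h2] record multiplicities modulo 3. *)
Lemma cube_free_part (k : closedFieldType) (f : {poly k}) : f != 0 -> exists h1 h2 h3 : {poly k},
  [/\ h3 != 0, separable_poly (h1 * h2) & f = h1 * h2 ^+ 2 * h3 ^+ 3].
Proof.
have [n] := ubnP (size f); elim: n f => // n IH f; rewrite ltnS => sf f0.
have [s1|s1] := eqVneq (size f) 1%N.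
  exists f, 1, 1; rewrite oner_neq0 !mulr1 expr1n expr1n !mulr1; split=> //.
  have fE : f = (f`_0)%:P by apply: size1_polyC; rewrite s1.
  have c0 : f`_0 != 0 by rewrite -polyC_eq0 -fE.
  by rewrite separable_poly.unlock {2}fE derivC coprimep0 -size_poly_eq1 s1.
have [a fa] : exists a, root f a by apply/closed_rootP.
have [g gE] := factor_theorem _ _ fa.
have g0 : g != 0 by apply: contra_neq f0 => g0; rewrite gE g0 mul0r.
have [|h1 [h2 [h3 [h30 sep E]]]] := IH g _ g0.
  by apply: leq_trans sf; rewrite gE size_Mmonic ?monicXsubC // size_XsubC addn2.
have [r1|r1] := boolP (root h1 a).
  have [h1' h1E] := factor_theorem _ _ r1.
  exists h1', (('X - a%:P) * h2), h3; split=> //.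
    by rewrite mulrA -h1E.
  by rewrite gE E h1E; ring.
have [r2|r2] := boolP (root h2 a).
  have [h2' h2E] := factor_theorem _ _ r2.
  exists h1, h2', (h3 * ('X - a%:P)); split.
  - by rewrite mulf_neq0 // polyXsubC_eq0.
  - by move: sep; rewrite h2E mulrA separable_mul => /andP[].
  - by rewrite gE E h2E; ring.
exists (('X - a%:P) * h1), h2, h3; split=> //.
  by rewrite -mulrA separable_mulXsubC // rootM negb_or r1.
by rewrite gE E; ring.
Qed.

(** * Quartic equations *)

Section NormalForm.
Variables (k : closedFieldType) (three : 3%:R != 0 :> k) (C : curve k).
Variables (s : {rmorphism C -> C}).

Lemma kummer_cube_free w x y f : kummer s w x y f -> exists y' h1 h2,
  [/\ kummer s w x y' (h1 * h2 ^+ 2), separable_poly (h1 * h2) &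
      (size f).-1 = (size (h1 * h2 ^+ 2)).-1 %[mod 3]].
Proof.
move=> K; have f0 := kummer_poly_neq0 K; have xT := kum_transc K.
have [h1 [h2 [h3 [h30 sep E]]]] := cube_free_part f0.
have eh3 : ev x h3 != 0 by rewrite ev_eq0.
exists (y / ev x h3), h1, h2; split=> //.
  apply: (kummer_change K) => //; first exact: ratl_id.
  - exact: ratl_id.
  - exact: kum_root K.
  - by rewrite mulf_neq0 ?invr_eq0 // (kum_neq0 K).
  - rewrite fmorph_div (kum_gen K) (pullback_ev (kum_pull K)) (kummer_base K); ring.
  - by rewrite expr_div_n (kum_eq K) E !evE; field.
have h0 : h1 * h2 ^+ 2 != 0 by apply: contra_neq f0 => h0; rewrite E h0 mul0r.
by rewrite {1}E mulrC size_cubeM //= mulnC modnMDl.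
Qed.

Section Shift.
Variables (x : C) (a : k).
Hypothesis xT : transcendental x.
Let x' := (x - const C a)^-1.

Lemma shift_neq0 : x - const C a != 0. Proof. exact: XsubC_neq0. Qed.

Lemma shift_transcendental : transcendental x'.
Proof.
apply: transcendentalV => h; apply: xT; rewrite -(subrK (const C a) x).
by apply: algebraic_add => //; exact: algebraic_id.
Qed.

Lemma shift_ratl : ratl x x'.
Proof.
apply: ratlV => //; apply: (subringB (ratl_subring xT)); first exact: ratl_id.
exact: ratl_const.
Qed.

Lemma shift_ratl_inv : ratl x' x.
Proof.
have -> : x = x'^-1 + const C a by rewrite invrK subrK.
have x'T := shift_transcendental.
apply: (subringD (ratl_subring x'T)); last exact: ratl_const.
by apply: ratlV => //; exact: ratl_id.
Qed.

(** This is the reversed Taylor expansion at [a]. Its coefficient in the top position is [g.[a]], so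
    the degree is kept when [a] is not a root. *)
Lemma shift_ev (g : {poly k}) : exists r : {poly k}, [/\ (size r <= size g)%N,
  r`_(size g).-1 = g.[a] & ev x g = (x - const C a) ^+ (size g).-1 * ev x' r].
Proof.
have [->|g0] := eqVneq g 0.
  by exists 0; rewrite size_poly0 coef0 horner0 !ev0 mulr0.
have sg : (size g).-1.+1 = size g by rewrite prednK // size_poly_gt0.
pose g1 := g \Po ('X + a%:P).
have sg1 : (size g1 <= (size g).-1.+1)%N by rewrite sg size_comp_poly2 ?size_XaddC.
have E : ev x g = ev (x - const C a) g1.
  rewrite /g1 /ev map_comp_poly horner_comp rmorphD /= map_polyX map_polyC /= !hornerE.
  by rewrite subrK.
exists (\poly_(j < (size g).-1.+1) g1`_((size g).-1 - j)); split.
- by apply: (leq_trans (size_poly _ _)); rewrite sg.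
- by rewrite coef_poly leqnn subnn -horner_coef0 /g1 horner_comp !hornerE.
- by rewrite E; apply: ev_rev => //; exact: shift_neq0.
Qed.

End Shift.

Lemma kummer_not_const w x y f : kummer s w x y f -> (1 < size f)%N.
Proof.
move=> K; rewrite ltnNge; apply/negP=> /size1_polyC fE.
have [c yE] : exists c, y = const C c.
  apply: algebraic_const; exists ('X^3 - (f`_0)%:P); first by rewrite -size_poly_gt0 size_XnsubC.
  rewrite /root rmorphB /= map_polyXn map_polyC /= !hornerE (kum_eq K).
  by rewrite {1}fE evC subrr.
have := kum_gen K; rewrite {1}yE (kum_pull K) -yE => /eqP.
rewrite -subr_eq0 -{1}[y]mul1r -mulrBl mulf_eq0 (negbTE (kum_neq0 K)) orbF subr_eq0.
rewrite -(rmorph1 (const C)) (inj_eq (fmorph_inj _)) eq_sym.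
by rewrite (negbTE (cube_root_neq1 three (kum_root K))).
Qed.

(* Unless infinity is already ramified, a branch point [a] is moved to infinity. *)
Lemma kummer_ramified w x y f : kummer s w x y f -> exists w' x' y' h1 h2,
  [/\ kummer s w' x' y' (h1 * h2 ^+ 2), separable_poly (h1 * h2) &
      ~~ (3 %| (size (h1 * h2 ^+ 2)%R).-1)%N].
Proof.
move=> K0; have [y1 [h1 [h2 [K sep _]]]] := kummer_cube_free K0; have xT := kum_transc K.
set F := h1 * h2 ^+ 2 in K.
have [dv|nd] := boolP (3 %| (size F).-1)%N; last first.
  by exists w, x, y1, h1, h2.
have [h10 h20] := kummer_factors_neq0 K.
have F0 : F != 0 by rewrite mulf_neq0 ?expf_neq0.
have [a [e [g [ne gN FE]]]] : exists a e (g : {poly k}),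
    [/\ ~~ (3 %| e)%N, g.[a] != 0 & F = ('X - a%:P) ^+ e * g].
  have [a Fa] : exists a, root F a.
    by apply/closed_rootP; rewrite neq_ltn (kummer_not_const K) orbT.
  have nsq u : u * u %| h1 * h2 -> coprimep u u by exact: separable_coprime.
  have self : ~ coprimep ('X - a%:P) ('X - a%:P) by rewrite coprimepp size_XsubC.
  have nboth : ~~ (root h1 a && root h2 a).
    apply/negP=> /andP[r1 r2]; apply: self; apply: nsq.
    by rewrite dvdp_mul // dvdp_XsubCl.
  have simple (u v : {poly k}) : u * v %| h1 * h2 -> root v a ->
      exists2 v', v = v' * ('X - a%:P) & ~~ root v' a.
    move=> uv va; have [v' vE] := factor_theorem _ _ va; exists v' => //.
    apply/negP=> v'a; apply: self; apply: nsq; apply: dvdp_trans uv; apply: dvdp_mull.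
    by rewrite vE; apply: dvdp_mul => //; rewrite dvdp_XsubCl.
  have [r1|r1] := boolP (root h1 a).
    have r2 : ~~ root h2 a by move: nboth; rewrite r1.
    have [|h1' h1E nr] := simple h2 h1 _ r1; first by rewrite mulrC.
    exists a, 1%N, (h1' * h2 ^+ 2); split=> //.
      by rewrite hornerM horner_exp mulf_neq0 ?expf_neq0.
    by rewrite /F h1E; ring.
  have r2 : root h2 a by move: Fa; rewrite rootM (negbTE r1) /root horner_exp expf_eq0.
  have [|h2' h2E nr] := simple h1 h2 _ r2; first by [].
  exists a, 2%N, (h1 * h2' ^+ 2); split=> //.
    by rewrite hornerM horner_exp mulf_neq0 ?expf_neq0.
  by rewrite /F h2E; ring.
have g0 : g != 0 by apply: contra_neq F0 => g0; rewrite FE g0 mulr0.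
pose x' := (x - const C a)^-1.
have t0 : x - const C a != 0 by exact: shift_neq0.
have [r [sr rn gE]] := shift_ev a xT g.
have [m mE] : exists m, (size F).-1 = (3 * m)%N by move/dvdnP: dv => [m ->]; exists m; rewrite mulnC.
have sF : (size F).-1 = (e + (size g).-1)%N.
  rewrite FE mulrC size_Mmonic ?monic_exp ?monicXsubC // size_exp_XsubC addnS /= addnC.
  move: g0; rewrite -size_poly_gt0; by case: (size g) => // n _; rewrite addnS.
have szr : (size r).-1 = (size g).-1.
  have : r`_(size g).-1 != 0 by rewrite rn.
  by move=> h; apply/eqP; rewrite eqn_leq -!subn1 leq_sub2r //= !subn1;
     case: leqP => // lt; rewrite nth_default ?eqxx in h => //; move: lt; case: (size r).
(* [F] is [(x - a) ^+ (3 * m)] times a polynomial [r] in [x'], so [y1 * x' ^+ m] has cube [r]. The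
   degree of [r] is [3 * m - e], which is prime to 3. *)
have K' : kummer s w x' (y1 * x' ^+ m) r.
  apply: (kummer_change K).
  - exact: shift_ratl.
  - exact: shift_transcendental.
  - exact: shift_ratl_inv.
  - exact: kum_root K.
  - by rewrite mulf_neq0 ?expf_neq0 ?invr_eq0 // (kum_neq0 K).
  - have -> : s (y1 * x' ^+ m) = s y1 * x' ^+ m.
      rewrite rmorphM rmorphXn; congr (_ * _ ^+ _); apply/(kum_fixed K).
      exact: shift_ratl.
    by rewrite (kum_gen K) mulrA.
  rewrite exprMn (kum_eq K) FE evM evXn gE !evE -exprM (mulnC m) -mE sF exprD.
  by rewrite /x' !exprVn; field; rewrite !expf_neq0.
have [y2 [u1 [u2 [K2 sep2 E2]]]] := kummer_cube_free K'.
exists w, x', y2, u1, u2; split=> //.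
move: ne; rewrite /dvdn -E2 szr; move: mE; rewrite sF; move: (size g).-1; clear; lia.
Qed.

Lemma kummer_swap w x y h1 h2 : kummer s w x y (h1 * h2 ^+ 2) ->
  exists y', kummer s (w ^+ 2) x y' (h2 * h1 ^+ 2).
Proof.
move=> K; exists (y ^+ 2 / ev x h2); apply: (kummer_change K).
- exact: ratl_id.
- exact: kum_transc K.
- exact: ratl_id.
- exact: cube_root_sq (kum_root K).
- exact: kummer_e2_neq0 K.
- exact: kummer_e2_gen K.
- exact: kummer_e2_cube K.
Qed.

Definition picard_form w x y f :=
  [/\ kummer s w x y f, separable_poly f & size f = 5%N].

(* Up to [kummer_swap], either [h2] is constant, or [h1] is a cubic and the root
   of [h2] is moved to infinity. *)
Lemma kummer_quartic w x y h1 h2 : kummer s w x y (h1 * h2 ^+ 2) -> separable_poly (h1 * h2) ->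
  ~~ (3 %| (size (h1 * h2 ^+ 2)%R).-1)%N -> ((size h1).-1 + (size h2).-1 = 4)%N ->
  exists w' x' y' f', picard_form w' x' y' f'.
Proof.
wlog le : w y h1 h2 / (size h2 <= size h1)%N.
  move=> wl K sep ram sm; case: (leqP (size h2) (size h1)) => le; first exact: wl K sep ram sm.
  have [y' K'] := kummer_swap K.
  apply: (wl _ _ h2 h1 (ltnW le) K'); rewrite 1?[h2 * h1]mulrC //; last by rewrite addnC.
  have [d1 d2] := kummer_degrees K; move: ram; rewrite d1 d2 /dvdn; clear; lia.
move=> K sep ram sm; have [h10 h20] := kummer_factors_neq0 K; have xT := kum_transc K.
have [d1 _] := kummer_degrees K; move: (ram); rewrite d1 => ram1.
have s1 : (0 < size h1)%N by rewrite size_poly_gt0.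
have s2 : (0 < size h2)%N by rewrite size_poly_gt0.
(* Degrees 2 and 2 are excluded by ramification, since [h1 * h2 ^+ 2] would have degree 6. *)
have [[e1 e2]|[e1 e2]] : (size h1 = 5 /\ size h2 = 1)%N \/ (size h1 = 4 /\ size h2 = 2)%N.
  move: ram1 sm le s1 s2; rewrite /dvdn; move: (size h1) (size h2); clear; lia.
  exists w, x, y, (h1 * h2 ^+ 2); split=> //; last by move: d1; rewrite e1 e2; case: (size (h1 * h2 ^+ 2)) => //= n ->.
  have [c c0 h2E] : exists2 c, c != 0 & h2 = c%:P by apply/size_poly1P/eqP.
  rewrite (eqp_separable (q := h1 * h2)) //.
  rewrite expr2 mulrA {2}h2E mulrC; apply/eqpP; exists (1, c); rewrite ?oner_neq0 //=.
  by rewrite scale1r mul_polyC.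
have [b h2b] : exists b, root h2 b by apply/closed_rootP; rewrite e2.
have [c' h2E] := factor_theorem _ _ h2b.
have c'0 : c' != 0 by apply: contra_neq h20 => c'0; rewrite h2E c'0 mul0r.
have [c c0 c'E] : exists2 c, c != 0 & c' = c%:P.
  apply/size_poly1P/eqP; move: e2; rewrite h2E size_Mmonic ?monicXsubC // size_XsubC addn2.
  by case.
have [r h1E] := closed_field_poly_normal h1.
have sr : size r = 3%N.
  by move: e1; rewrite h1E size_scale ?lead_coef_eq0 // size_prod_XsubC => -[].
have ub : uniq (b :: r).
  rewrite -separable_prod_XsubC big_cons mulrC.
  rewrite -(eqp_separable (p := h1 * h2)) // h1E h2E c'E -scalerAl; apply/eqpP.
  exists (1, lead_coef h1 * c); rewrite /= ?oner_neq0 ?mulf_neq0 ?lead_coef_eq0 //.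
  by rewrite scale1r -!mul_polyC !polyCM; ring.
pose x' := (x - const C b)^-1.
have t0 : x - const C b != 0 by exact: shift_neq0.
(* The roots of [h1] in the coordinate [x'], and 0 for the old infinity, which is ramified because
   [h1 * h2 ^+ 2] has degree 5. The constant [d] collects the factors [b - a] from [x - a = (x - b)
   * (b - a) * (x' - (a - b)^-1)]. *)
pose rts := 0 :: [seq (a - b)^-1 | a <- r].
pose d := lead_coef h1 * c ^+ 2 * \prod_(a <- r) (b - a).
have rb a : a \in r -> a - b != 0.
  move=> ar; rewrite subr_eq0; apply: contraTneq ub => <-.
  by rewrite /= ar.
have d0 : d != 0.
  rewrite !mulf_neq0 ?expf_neq0 ?lead_coef_eq0 // prodf_seq_neq0.
  by apply/allP => a ar /=; rewrite -opprB oppr_eq0 rb.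
have urts : uniq rts.
  rewrite /rts /=; apply/andP; split.
    by apply/mapP=> -[a ar] /esym/eqP; rewrite invr_eq0 (negbTE (rb a ar)).
  rewrite map_inj_uniq; first by case/andP: ub.
  by move=> u v /invr_inj /addIr.
exists w, x', (y * x' ^+ 2), (d *: \prod_(t <- rts) ('X - t%:P)); split.
- apply: (kummer_change K).
  + exact: shift_ratl.
  + exact: shift_transcendental.
  + exact: shift_ratl_inv.
  + exact: kum_root K.
  + by rewrite mulf_neq0 ?expf_neq0 ?invr_eq0 // (kum_neq0 K).
  + have -> : s (y * x' ^+ 2) = s y * x' ^+ 2.
      rewrite rmorphM rmorphXn; congr (_ * _ ^+ _); apply/(kum_fixed K).
      exact: shift_ratl.
    by rewrite (kum_gen K) mulrA.
  have prodE (l : seq k) : {subset l <= r} -> ev x (\prod_(a <- l) ('X - a%:P)) =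
      (x - const C b) ^+ size l * const C (\prod_(a <- l) (b - a)) *
      ev x' (\prod_(t <- [seq (a - b)^-1 | a <- l]) ('X - t%:P)).
    elim: l => [|a l IH] lr; first by rewrite !big_nil !ev1 rmorph1 !mulr1.
    rewrite !big_cons /= !evE IH => [|u ul]; last by apply: lr; rewrite inE ul orbT.
    have ab : const C a - const C b != 0.
      by rewrite -rmorphB fmorph_eq0 rb // lr // inE eqxx.
    rewrite rmorphM rmorphB fmorphV rmorphB exprS /x'; field.
    by rewrite ab t0.
  rewrite exprMn (kum_eq K) h1E h2E c'E -!mul_polyC /rts big_cons.
  rewrite !evE prodE // sr /d !(rmorphM, rmorphXn) /= rmorph0 subr0.
  by rewrite /x'; field.
- rewrite (eqp_separable (q := \prod_(t <- rts) ('X - t%:P))) ?separable_prod_XsubC //.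
  exact: eqp_scale.
- by rewrite size_scale // size_prod_XsubC /= size_map sr.
Qed.

End NormalForm.

Lemma distinguished_picard (k : closedFieldType) (three : 3%:R != 0 :> k) (C : curve k)
    (G : set (C -> C)) : has_genus C 3 -> distinguished G ->
  exists (s : {rmorphism C -> C}) w x y f,
    picard_form s w x y f /\ G = [set t | [\/ t = id, t = s | t = s \o s]].
Proof.
move=> g3 [GG G3 [Q [phi [[phik phiG] gQ]]]].
have [s [sc s3 sz GE]] := subgroup_order3 GG G3.
have [q0 [q0T q0P]] := genus0_generator gQ.
have xT : transcendental (phi q0) by exact: pullback_transcendental.
have fix_s z : s z = z <-> ratl (phi q0) z.
  split=> [sz'|[p [q [qn0 E]]]].
    have : range phi z by rewrite phiG => t; rewrite GE => -[->|->|->] //=; rewrite !sz'.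
    move=> [v _ <-]; have [p [q [qn0 E]]] := q0P v; exists p, q; split=> //.
    by rewrite -!(pullback_ev phik) -rmorphM E.
  have : range phi z.
    exists (ev q0 p / ev q0 q) => //; rewrite fmorph_div !(pullback_ev phik) -E mulrAC mulfV ?mul1r //.
    by rewrite ev_eq0.
  by rewrite phiG; apply; rewrite GE; apply: Or32.
have [w [y [f K]]] := kummer_exists three sc s3 sz xT fix_s.
have [w1 [x1 [y1 [h1 [h2 [K1 sep ram]]]]]] := kummer_ramified three K.
have AB := kummer_genus three K1 sep ram g3.
have [w' [x' [y' [f' pf]]]] := kummer_quartic K1 sep ram AB.
by exists s, w', x', y', f'.
Qed.

(** [x2] is fixed by [s1], so the whole first group fixes [k(x2)] and [kummer_aut] applies to its
    members. *)
Lemma kummer_same_group (k : closedFieldType) (three : 3%:R != 0 :> k) (C : curve k)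
    (s1 s2 : {rmorphism C -> C}) w1 w2 (x1 x2 y1 y2 : C) f1 f2 :
  kummer s1 w1 x1 y1 f1 -> kummer s2 w2 x2 y2 f2 -> ratl x1 x2 ->
  forall t : C -> C, [\/ t = id, t = s1 | t = s1 \o s1] -> [\/ t = id, t = s2 | t = s2 \o s2].
Proof.
move=> K1 K2 x12.
have sx : s1 x2 = x2 by apply/(kum_fixed K1).
move=> t [->|->|->]; first exact: Or31.
  exact: (kummer_aut three K2 (kum_pull K1) sx).
apply: (kummer_aut three (t := s1 \o s1 : {rmorphism C -> C}) K2).
  by move=> c; rewrite /= !(kum_pull K1).
by rewrite /= !sx.
Qed.

(** * Regular differentials *)

Section Derivations.
Variables (k : fieldType) (C : curve k).

Record derivation (D : C -> C) : Prop := Derivation {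
  derD : forall a b, D (a + b) = D a + D b;
  derM : forall a b, D (a * b) = a * D b + D a * b;
  derC : forall c, D (const C c) = 0
}.

Lemma der0 D : derivation D -> D 0 = 0.
Proof. by move=> DD; have := derC DD 0; rewrite rmorph0. Qed.

Lemma derN D a : derivation D -> D (- a) = - D a.
Proof. by move=> DD; apply/eqP; rewrite -addr_eq0 -(derD DD) addNr der0. Qed.

Lemma derB D a b : derivation D -> D (a - b) = D a - D b.
Proof. by move=> DD; rewrite (derD DD) derN. Qed.

Lemma der_ev D x p : derivation D -> D (ev x p) = ev x p^`() * D x.
Proof.
move=> DD; elim/poly_ind: p => [|p c IH].
  by rewrite deriv0 ev0 mul0r der0.
rewrite !evE (derD DD) (derC DD) (derM DD) IH addr0 derivD derivM derivX derivC !evE.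
by rewrite mulr1 addr0; ring.
Qed.

Lemma derX D a n : derivation D -> D (a ^+ n) = a ^+ n.-1 * D a *+ n.
Proof.
move=> DD; have := der_ev a 'X^n DD; rewrite derivXn evXn evX => ->.
by rewrite raddfMn /= evXn evX mulrnAl.
Qed.

Lemma der_quot D a b : derivation D -> b != 0 -> D (a / b) = (D a * b - a * D b) / b ^+ 2.
Proof.
move=> DD b0; have := derM DD (a / b) b; rewrite divfK // => E.
apply: (mulIf b0); move: E => /eqP; rewrite addrC -subr_eq => /eqP <-.
by field.
Qed.

(** [D1 x * D2 - D2 x * D1] is a derivation that kills [x]; it kills [y] too, because [y ^+ 3] is a
    polynomial in [x] and 3 is invertible, hence everything. *)
Lemma derivation_proportional (three : 3%:R != 0 :> k) s w x y f (D1 D2 : C -> C) :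
  kummer s w x y f -> derivation D1 -> derivation D2 ->
  forall z, D1 x * D2 z = D2 x * D1 z.
Proof.
move=> K DD1 DD2; have xT := kum_transc K.
pose E z := D1 x * D2 z - D2 x * D1 z.
have DE : derivation E.
  split=> [a b|a b|c]; rewrite /E.
  - by rewrite (derD DD1) (derD DD2); ring.
  - by rewrite (derM DD1) (derM DD2); ring.
  - by rewrite (derC DD1) (derC DD2) !mulr0 subrr.
have Ex : E x = 0 by rewrite /E mulrC subrr.
have three' : 3%:R != 0 :> C by rewrite -(rmorph_nat (const C)) fmorph_eq0.
have Ey : E y = 0.
  have : E (y ^+ 3) = 0 by rewrite (kum_eq K) (der_ev _ _ DE) Ex mulr0.
  rewrite (derX _ _ DE) => /eqP; rewrite -mulr_natr mulf_eq0 (negbTE three') orbF mulf_eq0.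
  by rewrite expf_eq0 /= (negbTE (kum_neq0 K)) => /eqP.
have Er a : ratl x a -> E a = 0.
  move=> /(ratl_quot xT)[p [q [q0 ->]]]; rewrite (der_quot _ DE) ?ev_eq0 // !(der_ev _ _ DE) Ex.
  by rewrite !mulr0 mul0r subrr mul0r.
move=> z; apply/eqP; rewrite -subr_eq0 -/(E z).
have [a [b [c [[ra rb rc] ->]]]] := kummer_decomposition three K z.
by apply/eqP; rewrite !(derD DE) !(derM DE) (Er a) // (Er b) // (Er c) // Ey; ring.
Qed.

(** This is [3 * y ^+ 2 * d/dx], dual to [dx / (3 * y ^+ 2)] and without denominators on [x] and
    [y]. It is forced on [z] by the product rule for [q * z]; independence of [1], [y], [y ^+ 2]
    makes it well defined. *)
Lemma kummer_derivation (three : 3%:R != 0 :> k) s w x y f : kummer s w x y f ->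
  exists D, [/\ derivation D, D x = 3%:R * y ^+ 2 & D y = ev x f^`()].
Proof.
move=> K; have xT := kum_transc K.
pose val p0 p1 p2 := ev x p0 + ev x p1 * y + ev x p2 * y ^+ 2.
pose dval p0 p1 p2 := 3%:R * y ^+ 2 * val p0^`() p1^`() p2^`() +
  ev x f^`() * (ev x p1 + 2%:R * ev x p2 * y).
have rep z : exists q p0 p1 p2, q != 0 /\ ev x q * z = val p0 p1 p2.
  have [a [b [c [[[p1 [q1 [q10 E1]]] [p2 [q2 [q20 E2]]] [p3 [q3 [q30 E3]]]] ->]]]] :=
    kummer_decomposition three K z.
  exists (q1 * q2 * q3), (p1 * q2 * q3), (p2 * q1 * q3), (p3 * q1 * q2).
  by rewrite !mulf_neq0 // /val !evM -E1 -E2 -E3; split=> //; ring.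
have /choice[D DP] : forall z, exists v, forall q p0 p1 p2, q != 0 ->
    ev x q * z = val p0 p1 p2 ->
    ev x q * v = dval p0 p1 p2 - 3%:R * y ^+ 2 * ev x q^`() * z.
  move=> z; have [q [p0 [p1 [p2 [q0 E]]]]] := rep z.
  have eq0 : ev x q != 0 by rewrite ev_eq0.
  exists ((dval p0 p1 p2 - 3%:R * y ^+ 2 * ev x q^`() * z) / ev x q) => Q P0 P1 P2 Q0 E'.
  have eQ0 : ev x Q != 0 by rewrite ev_eq0.
  have : ev x (q * P0 - Q * p0) + ev x (q * P1 - Q * p1) * y + ev x (q * P2 - Q * p2) * y ^+ 2 = 0.
    transitivity (ev x q * val P0 P1 P2 - ev x Q * val p0 p1 p2); first by rewrite /val !evE; ring.
    by rewrite -E -E'; ring.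
  move=> /(kummer_independent three K (ratl_ev _ _) (ratl_ev _ _) (ratl_ev _ _))[i0 i1 i2].
  have dd p P : ev x (q * P - Q * p) = 0 -> ev x q * ev x P = ev x Q * ev x p /\
      ev x q^`() * ev x P + ev x q * ev x P^`() = ev x Q^`() * ev x p + ev x Q * ev x p^`().
    move/eqP; rewrite ev_eq0 // subr_eq0 => /eqP e; split; first by rewrite -!evM e.
    by rewrite -!evM -!evD -!derivM e.
  have [e0 d0] := dd _ _ i0; have [e1 d1] := dd _ _ i1; have [e2 d2] := dd _ _ i2.
  apply: (mulfI eq0).
  have -> : ev x q * (ev x Q * ((dval p0 p1 p2 - 3%:R * y ^+ 2 * ev x q^`() * z) / ev x q)) =
    ev x Q * dval p0 p1 p2 - 3%:R * y ^+ 2 * ev x q^`() * (ev x Q * z) by field.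
  have -> : ev x q * (dval P0 P1 P2 - 3%:R * y ^+ 2 * ev x Q^`() * z) =
    ev x q * dval P0 P1 P2 - 3%:R * y ^+ 2 * ev x Q^`() * (ev x q * z) by ring.
  rewrite E E' /dval /val; apply/eqP; rewrite -subr_eq0; apply/eqP.
  transitivity (3%:R * y ^+ 2 * (
     ((ev x Q^`() * ev x p0 + ev x Q * ev x p0^`()) - (ev x q^`() * ev x P0 + ev x q * ev x P0^`())) +
     ((ev x Q^`() * ev x p1 + ev x Q * ev x p1^`()) - (ev x q^`() * ev x P1 + ev x q * ev x P1^`())) * y +
     ((ev x Q^`() * ev x p2 + ev x Q * ev x p2^`()) - (ev x q^`() * ev x P2 + ev x q * ev x P2^`())) * y ^+ 2)
    + ev x f^`() * ((ev x Q * ev x p1 - ev x q * ev x P1) + 2%:R * y * (ev x Q * ev x p2 - ev x q * ev x P2))).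
    by ring.
  by rewrite d0 d1 d2 e1 e2; ring.
have Dval q p0 p1 p2 z : q != 0 -> ev x q * z = val p0 p1 p2 ->
    ev x q * D z = dval p0 p1 p2 - 3%:R * y ^+ 2 * ev x q^`() * z by exact: DP.
have one0 : (1 : {poly k}) != 0 by exact: oner_neq0.
have D1 z p0 p1 p2 : z = val p0 p1 p2 -> D z = dval p0 p1 p2.
  move=> E; have := Dval 1 p0 p1 p2 z one0; rewrite ev1 !mul1r => /(_ E) ->.
  by rewrite -polyC1 derivC ev0; ring.
exists D; split; last first.
- rewrite (D1 y 0 1 0); last by rewrite /val !evE; ring.
  by rewrite /dval /val deriv0 -polyC1 derivC !evE rmorph1; ring.
- rewrite (D1 x 'X 0 0); last by rewrite /val !evE; ring.
  by rewrite /dval /val deriv0 derivX !evE; ring.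
split=> [z1 z2|z1 z2|c]; last first.
- rewrite (D1 _ c%:P 0 0); last by rewrite /val !evE; ring.
  by rewrite /dval /val deriv0 derivC !evE; ring.
- have [q [p0 [p1 [p2 [q0 E]]]]] := rep z1; have [Q [P0 [P1 [P2 [Q0 E']]]]] := rep z2.
  have eq0 : ev x q != 0 by rewrite ev_eq0.
  have eQ0 : ev x Q != 0 by rewrite ev_eq0.
  apply: (mulfI (mulf_neq0 eq0 eQ0)).
  have := Dval (q * Q) (p0 * P0 + f * (p1 * P2 + p2 * P1)) (p0 * P1 + p1 * P0 + f * (p2 * P2))
    (p0 * P2 + p1 * P1 + p2 * P0) (z1 * z2) (mulf_neq0 q0 Q0).
  rewrite evM => ->.
    have -> : ev x q * ev x Q * (z1 * D z2 + D z1 * z2) =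
      (ev x q * z1) * (ev x Q * D z2) + (ev x q * D z1) * (ev x Q * z2) by ring.
    rewrite (Dval _ _ _ _ _ q0 E) (Dval _ _ _ _ _ Q0 E').
    have -> : 3%:R * y ^+ 2 * ev x (q * Q)^`() * (z1 * z2) =
      3%:R * y ^+ 2 * (ev x q^`() * z1 * (ev x Q * z2) + ev x Q^`() * z2 * (ev x q * z1)).
      by rewrite derivM !evE; ring.
    rewrite E E' /dval /val !(derivD, derivM) !evE -(kum_eq K); ring.
  have -> : ev x q * ev x Q * (z1 * z2) = (ev x q * z1) * (ev x Q * z2) by ring.
  by rewrite E E' /val !evE -(kum_eq K); ring.
- have [q [p0 [p1 [p2 [q0 E]]]]] := rep z1; have [Q [P0 [P1 [P2 [Q0 E']]]]] := rep z2.
  have eq0 : ev x q != 0 by rewrite ev_eq0.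
  have eQ0 : ev x Q != 0 by rewrite ev_eq0.
  apply: (mulfI (mulf_neq0 eq0 eQ0)).
  have := Dval (q * Q) (p0 * Q + P0 * q) (p1 * Q + P1 * q) (p2 * Q + P2 * q) (z1 + z2) (mulf_neq0 q0 Q0).
  rewrite evM => ->.
    have -> : ev x q * ev x Q * (D z1 + D z2) = ev x Q * (ev x q * D z1) + ev x q * (ev x Q * D z2) by ring.
    rewrite (Dval _ _ _ _ _ q0 E) (Dval _ _ _ _ _ Q0 E') /dval /val !(derivD, derivM) !evE.
    have Z1 : 3%:R * y ^+ 2 * ev x Q^`() * (ev x q * z1) = 3%:R * y ^+ 2 * ev x Q^`() * val p0 p1 p2 by rewrite E.
    have Z2 : 3%:R * y ^+ 2 * ev x q^`() * (ev x Q * z2) = 3%:R * y ^+ 2 * ev x q^`() * val P0 P1 P2 by rewrite E'.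
    apply/eqP; rewrite -subr_eq0; apply/eqP.
    transitivity ((3%:R * y ^+ 2 * ev x Q^`() * val p0 p1 p2 - 3%:R * y ^+ 2 * ev x Q^`() * (ev x q * z1)) +
      (3%:R * y ^+ 2 * ev x q^`() * val P0 P1 P2 - 3%:R * y ^+ 2 * ev x q^`() * (ev x Q * z2))).
      by rewrite /val; ring.
    by rewrite Z1 Z2; ring.
  have -> : ev x q * ev x Q * (z1 + z2) = ev x Q * (ev x q * z1) + ev x q * (ev x Q * z2) by ring.
  by rewrite E E' /val !evE; ring.
Qed.

End Derivations.

Section HolomorphicForms.
Variables (k : closedFieldType) (C : curve k).

(* If [D] is the derivation dual to the differential [eta], these are the [u]
   such that [u eta] is regular. *)
Definition holomorphic (D : C -> C) : set C := [set u | forall O : set C, is_point O ->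
  exists a t, [/\ O a, O t & u = a * D t]].

Definition affine_span (x y : C) : set C := [set u | exists a b c : k,
  u = const C a + const C b * x + const C c * y].

Lemma holomorphic_scale (D1 D2 : C -> C) h : h != 0 -> (forall z, D2 z = h * D1 z) ->
  forall u, holomorphic D2 u <-> holomorphic D1 (u / h).
Proof.
move=> h0 E u; split=> hu O PO; have [a [t [Oa Ot uE]]] := hu O PO; exists a, t; split=> //.
  by rewrite uE E; field.
by rewrite E mulrCA -uE mulrC divfK.
Qed.

Variables (three : 3%:R != 0 :> k) (s : {rmorphism C -> C}) (w : k) (x y : C) (f : {poly k}).
Hypotheses (K : kummer s w x y f) (sep : separable_poly f) (sf : size f = 5%N).
Variable D : C -> C.
Hypotheses (DD : derivation D) (Dx : D x = 3%:R * y ^+ 2) (Dy : D y = ev x f^`()).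

Let xT := kum_transc K.
Let y0 := kum_neq0 K.

Let K1 : kummer s w x y (f * 1 ^+ 2). Proof. by rewrite expr1n mulr1. Qed.
Let sep1 : separable_poly (f * 1). Proof. by rewrite mulr1. Qed.
Let ram : ~~ (3 %| (size (f * 1 ^+ 2)%R).-1)%N. Proof. by rewrite expr1n mulr1 sf. Qed.
Let e2E : y ^+ 2 / ev x 1 = y ^+ 2. Proof. by rewrite ev1 divr1. Qed.
Let f0 : f != 0. Proof. by rewrite -size_poly_gt0 sf. Qed.
Let dfn : (size f).-1 = 4%N. Proof. by rewrite sf. Qed.
Let f20 : f ^+ 2 != 0. Proof. by rewrite expf_neq0. Qed.
Let y2cube : (y ^+ 2) ^+ 3 = ev x (f ^+ 2).
Proof. by rewrite evXn -(kum_eq K); ring. Qed.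
Let df2n : (size (f ^+ 2)).-1 = 8%N. Proof. by rewrite size_exp sf. Qed.

Let three' : 3%:R != 0 :> C. Proof. by rewrite -(rmorph_nat (const C)) fmorph_eq0. Qed.

Lemma regular_form z : regular x z -> exists p0 p1 p2,
  z = ev x p0 + ev x p1 * y + ev x p2 * y ^+ 2.
Proof.
move=> rz; have [p0 [p1 [p2 E]]] := kummer_regular three K1 sep1 rz.
by exists p0, p1, p2; rewrite E e2E.
Qed.

Lemma regular_in O p0 p1 p2 : is_point O -> O x ->
  O (ev x p0 + ev x p1 * y + ev x p2 * y ^+ 2).
Proof.
move=> PO Ox; have Oy : O y.
  by apply: (point_Xn PO (n := 3)) => //; rewrite (kum_eq K); exact: point_ev.
have Oev p : O (ev x p) by exact: point_ev.
have Oy2 : O (y ^+ 2) by exact: pointX.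
exact: (pointD PO (pointD PO (Oev _) (point_mul PO (Oev _) Oy)) (point_mul PO (Oev _) Oy2)).
Qed.

Lemma regular_der u : regular x u -> regular x (D u).
Proof.
move=> ru; have [p0 [p1 [p2 ->]]] := regular_form ru.
have -> : D (ev x p0 + ev x p1 * y + ev x p2 * y ^+ 2) =
  ev x (p1 * f^`() + 3%:R%:P * (f * p1^`())) +
  ev x (2%:R%:P * (p2 * f^`()) + 3%:R%:P * (f * p2^`())) * y + ev x (3%:R%:P * p0^`()) * y ^+ 2.
  rewrite !(derD DD) !(derM DD) !(der_ev _ _ DD) Dx Dy !evE !rmorph_nat -(kum_eq K).
  by ring.
by move=> O PO Ox; exact: regular_in.
Qed.

(** A local denominator [u] reduces this to regular functions, through
    [u * D t = D (u * t) - D u * t]. *)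
Lemma der_finite_point O t : is_point O -> O x -> O t -> O (D t).
Proof.
move=> PO Ox Ot.
have [u [ru rut nu]] := local_denominator PO Ox (kummer_finite_over three K) Ot.
have Ou := ru O PO Ox.
apply: (point_mulr_unit PO Ou nu).
have -> : u * D t = D (u * t) - D u * t by rewrite (derM DD); ring.
apply: point_sub => //; first exact: (regular_der rut).
by apply: point_mul => //; exact: (regular_der ru).
Qed.

Lemma infinity_components O a b c : is_point O -> ~ O x -> ratl x a -> ratl x b -> ratl x c ->
  O (a + b * y + c * y ^+ 2) -> [/\ O a, O (b * y) & O (c * y ^+ 2)].
Proof.
move=> PO nx ra rb rc; have := kummer_infinity K1 ram PO nx ra rb rc.
by rewrite e2E.
Qed.

Lemma y_component O p q : is_point O -> ~ O x -> p != 0 -> q != 0 ->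
  O (ev x p / ev x q * y) <-> (3 * (size p).-1 + 4 <= 3 * (size q).-1)%N.
Proof.
by move=> PO nx p0 q0; have := component_infinity xT PO nx p0 q0 f0 (kum_eq K); rewrite dfn.
Qed.

Lemma y2_component O p q : is_point O -> ~ O x -> p != 0 -> q != 0 ->
  O (ev x p / ev x q * y ^+ 2) <-> (3 * (size p).-1 + 8 <= 3 * (size q).-1)%N.
Proof.
by move=> PO nx p0 q0; have := component_infinity xT PO nx p0 q0 f20 y2cube; rewrite df2n.
Qed.

Lemma size_wronskian (p q : {poly k}) n m : (size p <= n.+1)%N -> (size q <= m.+1)%N ->
  (size (p^`() * q - p * q^`())%R <= n + m)%N.
Proof.
move=> sp sq.
have sp' : (size p^`() <= n)%N.
  by apply: (leq_trans (size_poly _ _)); move: sp; case: (size p).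
have sq' : (size q^`() <= m)%N.
  by apply: (leq_trans (size_poly _ _)); move: sq; case: (size q).
have bound (u v : {poly k}) i j : (size u <= i)%N -> (size v <= j)%N ->
    (size (u * v)%R <= (i + j).-1)%N.
  by move=> su sv; apply: (leq_trans (size_polyMleq _ _)); rewrite -!subn1 leq_sub2r // leq_add.
apply: (leq_trans (size_polyD _ _)); rewrite geq_max size_polyN; apply/andP; split.
  by apply: (leq_trans (bound _ _ _ _ sp' sq)); rewrite addnS.
by apply: (leq_trans (bound _ _ _ _ sp sq')); rewrite addSn.
Qed.

Lemma size_mulE (u v : {poly k}) : u != 0 -> v != 0 ->
  (size (u * v)).-1 = ((size u).-1 + (size v).-1)%N.
Proof.
move=> u0 v0; rewrite size_mul //; move: u0 v0; rewrite -!size_poly_gt0.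
by case: (size u) => // n; case: (size v) => // m; rewrite addnS.
Qed.

Lemma size_mul_le (u v : {poly k}) i j : (size u <= i.+1)%N -> (size v <= j.+1)%N ->
  (size (u * v)%R <= (i + j).+1)%N.
Proof.
move=> su sv; apply: (leq_trans (size_polyMleq _ _)).
by have := leq_add su sv; rewrite addSn addnS; case: (size u + size v)%N.
Qed.

Let wr (p q : {poly k}) : {poly k} := p^`() * q - p * q^`().

Lemma der_ratl p q : q != 0 -> D (ev x p / ev x q) = 3%:R * y ^+ 2 * ev x (wr p q) / ev x (q ^+ 2).
Proof.
move=> q0; rewrite (der_quot _ DD) ?ev_eq0 // !(der_ev _ _ DD) Dx /wr !evE.
by field; rewrite ev_eq0.
Qed.

(** At the pole of [x] the differential [dx / (3 * y ^+ 2)] vanishes to order 4, which is the pole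
    order of [y]; so [D t] has at most the pole of [y]. This is checked on each of the three
    components separately. *)
Lemma der_infinity0 O a : is_point O -> ~ O x -> ratl x a -> O a -> O (D a / y).
Proof.
move=> PO nx ra Oa; have [d md] := residue PO Oa.
(* Subtracting the residue makes the degree of [p] smaller than that of [q]; with equal degrees the
   bound on the Wronskian would be too weak. *)
have -> : D a = D (a - const C d) by rewrite (derB _ _ DD) (derC DD) subr0.
have [|p [q [q0 E]]] := @ratl_quot _ _ x (a - const C d) xT.
  by apply: (subringB (ratl_subring xT)) => //; exact: ratl_const.
have [p0|p0] := eqVneq p 0.
  by rewrite E p0 ev0 mul0r der0 // mul0r; exact: point0.
have lt : (size p < size q)%N.
  rewrite ltnNge; apply/negP=> /(ev_infinity_le PO nx p0); rewrite -[_ / _]invf_div -E.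
  by apply: nonunit_notin => //; rewrite E mulf_neq0 ?invr_eq0 ?ev_eq0.
rewrite E der_ratl //.
have -> : 3%:R * y ^+ 2 * ev x (wr p q) / ev x (q ^+ 2) / y =
   ev x (3%:R%:P * wr p q) / ev x (q ^+ 2) * y.
  rewrite !evE rmorph_nat; field.
  by rewrite ?(ev_eq0 _ xT) ?q0 ?y0.
have [w0|w0] := eqVneq (3%:R%:P * wr p q) 0; first by rewrite w0 ev0 !mul0r; exact: point0.
apply/(y_component PO nx w0); first by rewrite expf_neq0.
have sw : (size (3%:R%:P * wr p q)%R <= (size p).-1 + (size q).-1)%N.
  rewrite mul_polyC; apply: (leq_trans (size_scale_leq _ _)).
  by apply: size_wronskian; exact: leqSpred.
rewrite (expr2 q) (size_mulE q0 q0).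
move: sw lt w0 p0; rewrite -!size_poly_gt0; clear.
by move: (size (3%:R%:P * wr p q)) (size p) (size q) => a b c; lia.
Qed.

Lemma size_der_component (c : k) (p q : {poly k}) : (0 < (size p).-1 + (size q).-1)%N ->
  (size (3%:R%:P * (f * wr p q) + c%:P * (f^`() * (p * q)))%R <=
    ((size p).-1 + (size q).-1 + 3).+1)%N.
Proof.
move=> pos; have sp : (size p <= (size p).-1.+1)%N by exact: leqSpred.
have sq : (size q <= (size q).-1.+1)%N by exact: leqSpred.
have sw : (size (wr p q) <= ((size p).-1 + (size q).-1).-1.+1)%N.
  by rewrite prednK //; exact: size_wronskian.
have sf1 : (size f <= 5)%N by rewrite sf.
have sf' : (size f^`() <= 4)%N by apply: (leq_trans (size_poly _ _)); rewrite sf.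
have constM e (u : {poly k}) : (size (e%:P * u)%R <= size u)%N.
  by rewrite mul_polyC; exact: size_scale_leq.
apply: (leq_trans (size_polyD _ _)); rewrite geq_max; apply/andP; split.
  apply: (leq_trans (constM _ _)); apply: (leq_trans (size_mul_le sf1 sw)).
  by move: pos; clear; case: (_ + _)%N => // n _; rewrite ltnS addnC addSnnS.
apply: (leq_trans (constM _ _)); apply: (leq_trans (size_mul_le sf' (size_mul_le sp sq))).
by rewrite ltnS addnC.
Qed.

Lemma der_infinity1 O b : is_point O -> ~ O x -> ratl x b -> O (b * y) -> O (D (b * y) / y).
Proof.
move=> PO nx /(ratl_quot xT)[p [q [q0 ->]]].
have [->|p0] := eqVneq p 0.
  by move=> _; rewrite ev0 !mul0r der0 // mul0r; exact: point0.
have eq0 : ev x q != 0 by rewrite ev_eq0.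
move/(y_component PO nx p0 q0) => le.
pose M := 3%:R%:P * (f * wr p q) + 1%:P * (f^`() * (p * q)).
have -> : D (ev x p / ev x q * y) / y = ev x M / ev x (q ^+ 2 * f) * y ^+ 2.
  rewrite (derM DD) der_ratl // Dy /M !evE rmorph_nat rmorph1 -(kum_eq K); field.
  by rewrite y0 eq0.
have [M0|M0] := eqVneq M 0; first by rewrite M0 ev0 !mul0r; exact: point0.
have q20 : q ^+ 2 != 0 by rewrite expf_neq0.
apply/(y2_component PO nx M0); first by rewrite mulf_neq0.
have sM : (size M <= ((size p).-1 + (size q).-1 + 3).+1)%N.
  apply: size_der_component; move: le; clear; move: (size p).-1 (size q).-1; lia.
rewrite (size_mulE q20 f0) (expr2 q) (size_mulE q0 q0) dfn.
by move: sM le; clear; move: (size M) (size p).-1 (size q).-1; lia.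
Qed.

Lemma der_infinity2 O c : is_point O -> ~ O x -> ratl x c -> O (c * y ^+ 2) ->
  O (D (c * y ^+ 2) / y).
Proof.
move=> PO nx /(ratl_quot xT)[p [q [q0 ->]]].
have [->|p0] := eqVneq p 0.
  by move=> _; rewrite ev0 !mul0r der0 // mul0r; exact: point0.
have eq0 : ev x q != 0 by rewrite ev_eq0.
move/(y2_component PO nx p0 q0) => le.
pose M := 3%:R%:P * (f * wr p q) + 2%:R%:P * (f^`() * (p * q)).
have -> : D (ev x p / ev x q * y ^+ 2) / y = ev x M / ev x (q ^+ 2).
  rewrite (derM DD (_ / _)) der_ratl // (derX _ _ DD) Dy /M !evE !rmorph_nat -(kum_eq K) /=; field.
  by rewrite y0 eq0.
have q20 : q ^+ 2 != 0 by rewrite expf_neq0.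
apply: ev_infinity_le => //.
have sM : (size M <= ((size p).-1 + (size q).-1 + 3).+1)%N.
  apply: size_der_component; move: le; clear; move: (size p).-1 (size q).-1; lia.
have s2 := size_mulE q0 q0; rewrite -expr2 in s2.
have pos : (0 < size (q ^+ 2))%N by rewrite size_poly_gt0.
by move: sM le s2 pos; clear; move: (size M) (size p).-1 (size q).-1 (size (q ^+ 2)); lia.
Qed.

Lemma der_infinity O t : is_point O -> ~ O x -> O t -> O (D t / y).
Proof.
move=> PO nx; have [a [b [c [[ra rb rc] ->]]]] := kummer_decomposition three K t.
move=> /(infinity_components PO nx ra rb rc)[Oa Ob Oc].
rewrite !(derD DD) !mulrDl; apply: (pointD PO); last exact: der_infinity2.
by apply: (pointD PO); [exact: der_infinity0|exact: der_infinity1].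
Qed.

Lemma holomorphic_sub u : holomorphic D u -> affine_span x y u.
Proof.
move=> hu; have ru : regular x u.
  move=> O PO Ox; have [a [t [Oa Ot ->]]] := hu O PO.
  by apply: point_mul => //; exact: der_finite_point.
have [p0 [p1 [p2 uE]]] := regular_form ru.
have [P [PP nx]] := infinite_point_exists xT.
have [a [t [Oa Ot uE']]] := hu P PP.
have : P (u / y) by rewrite uE' -mulrA; apply: point_mul => //; exact: der_infinity.
(* Division by [y] shifts the components cyclically: [y ^+ 2] to [y], [y] to 1, and 1 to
   [y ^+ 2 / f]. The degree bounds then leave [p0] of degree at most 1, [p1] constant and
   [p2 = 0]. *)
have -> : u / y = ev x p1 + ev x p2 * y + ev x p0 / ev x f * y ^+ 2.
  by rewrite uE -(kum_eq K); field.
have r0 : ratl x (ev x p0 / ev x f).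
  by apply: (subringM (ratl_subring xT)); [exact: ratl_ev|apply: ratlV => //; exact: ratl_ev].
move=> /(infinity_components PP nx (ratl_ev x p1) (ratl_ev x p2) r0)[O1 O2 O0].
have one0 : (1 : {poly k}) != 0 by exact: oner_neq0.
have p1E : p1 = (p1`_0)%:P.
  apply: size1_polyC.
  have : P (ev x p1 / ev x 1) by rewrite ev1 divr1.
  by move/(ev_infinity_in PP nx one0); rewrite size_poly1.
have p2E : p2 = 0.
  apply/eqP; apply: contrapT => /negP p20.
  have : P (ev x p2 / ev x 1 * y) by rewrite ev1 divr1.
  by move/(y_component PP nx p20 one0); rewrite size_poly1 addnC.
have sp0 : (size p0 <= 2)%N.
  have [->|p00] := eqVneq p0 0; first by rewrite size_poly0.
  move/(y2_component PP nx p00 f0): O0; rewrite dfn.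
  by clear; move: (size p0); lia.
exists p0`_0, p0`_1, p1`_0.
rewrite uE p2E p1E ev0 mul0r addr0 evC coefC /=; congr (_ + _).
rewrite /ev (horner_coef_wide _ (leq_trans (size_poly _ _) sp0)) !big_ord_recl big_ord0.
by rewrite !coef_map /= expr0 expr1 mulr1 addr0.
Qed.

(** The Jacobian criterion: [D x = 3 * y ^+ 2] is a unit unless [y] vanishes at [O]; then [f]
    vanishes there, and [D y = f'] is a unit by separability. *)
Lemma holomorphic_finite O v : is_point O -> O x -> O v ->
  exists a t, [/\ O a, O t & v = a * D t].
Proof.
move=> PO Ox Ov; have Oy : O y.
  by apply: (point_Xn PO (n := 3)) => //; rewrite (kum_eq K); exact: point_ev.
have use t : O t -> ~ nonunit O (D t) -> exists a t, [/\ O a, O t & v = a * D t].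
  move=> Ot nt; have ODt : O (D t) by exact: der_finite_point.
  exists (v / D t), t; split=> //; last by rewrite divfK // (unit_neq0 PO nt).
  by apply: point_mul => //; exact: unit_inv.
have [my|ny] := pselect (nonunit O y); last first.
  apply: (use x) => //; rewrite Dx expr2; apply: unitM => //; first 1 last.
  - exact: point_mul.
  - by rewrite -(rmorph_nat (const C)); exact: const_unit.
  - exact: unitM.
  by rewrite -(rmorph_nat (const C)); exact: point_const.
apply: (use y) => //; rewrite Dy => mf'.
have mf : nonunit O (ev x f) by rewrite -(kum_eq K); exact: nonunitX.
move: sep; rewrite separable_poly.unlock => /Bezout_eq1_coprimepP[[u1 u2] /= E].
apply: (nonunit1 PO); rewrite -(ev1 x) -E !evE; apply: nonunitD => //.
  by apply: nonunitMl => //; exact: point_ev.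
by apply: nonunitMl => //; exact: point_ev.
Qed.

Lemma holomorphic_infinity O : is_point O -> ~ O x ->
  forall v, O (v / y) -> exists a t, [/\ O a, O t & v = a * D t].
Proof.
move=> PO nx v Ov.
(* [x / y] is a parameter at infinity and [M] is the numerator of its derivative. In degree 4 its
   coefficient is [3 - 4 = -1] times that of [f], hence nonzero. *)
pose M := 3%:R%:P * f - 'X * f^`().
have MC : M`_4 = - f`_4.
  by rewrite coefB coefCM coefXM /= coef_deriv; ring.
have M0 : M != 0.
  have f4 : f`_4 != 0 by have := lead_coef_eq0 f; rewrite /lead_coef sf /= => ->.
  by apply/eqP=> M0; move/eqP: MC; rewrite M0 coef0 eq_sym oppr_eq0 (negbTE f4).
have f4 : f`_4 != 0 by have := lead_coef_eq0 f; rewrite /lead_coef sf /= => ->.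
have sM : (size f <= size M)%N.
  rewrite sf ltnNge; apply/negP=> sM; move/eqP: MC; rewrite nth_default // eq_sym oppr_eq0.
  by rewrite (negbTE f4).
have eM0 : ev x M != 0 by rewrite ev_eq0.
have Dt : D (x / y) = ev x M / y ^+ 2.
  by rewrite (der_quot _ DD) // Dx Dy /M !evE rmorph_nat -(kum_eq K); field.
exists (v / y * (ev x f / ev x M)), (x / y); split.
- by apply: point_mul => //; exact: ev_infinity_le.
- have -> : x / y = ev x 'X / ev x f * y ^+ 2 by rewrite evX -(kum_eq K); field.
  apply/(y2_component PO nx _ f0); first by rewrite polyX_eq0.
  by rewrite size_polyX dfn.
by rewrite Dt -(kum_eq K); field; rewrite y0 eM0.
Qed.

Lemma holomorphicE u : holomorphic D u <-> affine_span x y u.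
Proof.
split; first exact: holomorphic_sub.
move=> [a [b [c ->]]] O PO; have [Ox|nx] := pselect (O x).
  apply: holomorphic_finite => //.
  have Oy : O y.
    by apply: (point_Xn PO (n := 3)) => //; rewrite (kum_eq K); exact: point_ev.
  have Oc d : O (const C d) by exact: point_const.
  exact: (pointD PO (pointD PO (Oc _) (point_mul PO (Oc _) Ox)) (point_mul PO (Oc _) Oy)).
apply: holomorphic_infinity => //.
have -> : (const C a + const C b * x + const C c * y) / y =
    ev x (a%:P + b%:P * 'X) / ev x f * y ^+ 2 + const C c.
  by rewrite !evE -(kum_eq K); field.
apply: pointD => //; last exact: point_const.
set p := a%:P + _; have [->|p0] := eqVneq p 0; first by rewrite ev0 !mul0r; exact: point0.
apply/(y2_component PO nx p0 f0); rewrite dfn.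
have : (size p <= 2)%N.
  apply: (leq_trans (size_polyD _ _)); rewrite geq_max (leq_trans (size_polyC_leq1 _)) //=.
  by rewrite mul_polyC (leq_trans (size_scale_leq _ _)) // size_polyX.
by clear; move: (size p); lia.
Qed.

End HolomorphicForms.

(** * Comparison of two equations *)

Section Bivariate.
Variable k : fieldType.
Implicit Types (P Q : {poly {poly k}}) (a b c t v : k).

(** The outer variable is [y], the inner one [x]. The truncated subtraction makes every coefficient
    beyond [n] vanish. *)
Definition total_degree_le n P := forall i, (size (P`_i)%R <= n.+1 - i)%N.

Lemma total_degreeD n P Q : total_degree_le n P -> total_degree_le n Q -> total_degree_le n (P + Q).
Proof.
by move=> dP dQ i; rewrite coefD (leq_trans (size_polyD _ _)) // geq_max dP dQ.
Qed.

Lemma total_degreeN n P : total_degree_le n P -> total_degree_le n (- P).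
Proof. by move=> dP i; rewrite coefN size_polyN. Qed.

Lemma total_degreeM n m P Q : total_degree_le n P -> total_degree_le m Q ->
  total_degree_le (n + m) (P * Q).
Proof.
move=> dP dQ i; rewrite coefM; apply: (leq_trans (size_sum _ _ _)).
apply/bigmax_leqP => j _.
have [->|Pj] := eqVneq P`_j 0; first by rewrite mul0r size_poly0.
have [->|Qj] := eqVneq Q`_(i - j)%N 0; first by rewrite mulr0 size_poly0.
rewrite size_mul //; have := dP j; have := dQ (i - j)%N; have := ltn_ord j.
move: Pj Qj; rewrite -!size_poly_gt0; clear.
by move: (j : nat) => l; move: (size P`_l) (size Q`_(i - l)%N) => p q; lia.
Qed.

Lemma total_degreeX n P : total_degree_le 1 P -> total_degree_le n (P ^+ n).
Proof.
move=> dP; elim: n => [|n IH]; last by rewrite exprS; exact: (total_degreeM dP IH).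
by case=> [|i]; rewrite coef1 ?size_poly1 ?size_poly0.
Qed.

Lemma total_degreeC n c P : total_degree_le n P -> total_degree_le n (c%:P%:P * P).
Proof.
move=> dP i; rewrite coefCM mul_polyC; apply: leq_trans (dP i); exact: size_scale_leq.
Qed.

Definition linear_form a b c : {poly {poly k}} := (a%:P + b%:P * 'X)%:P + c%:P *: 'X.

Lemma linear_form_degree a b c : total_degree_le 1 (linear_form a b c).
Proof.
case=> [|[|i]]; rewrite coefD coefC coefZ coefX /= ?mulr0 ?addr0 ?add0r ?mulr1 ?size_poly0 //.
  apply: (leq_trans (size_polyD _ _)); rewrite geq_max (leq_trans (size_polyC_leq1 _)) //=.
  by rewrite mul_polyC (leq_trans (size_scale_leq _ _)) // size_polyX.
exact: size_polyC_leq1.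
Qed.

Lemma linear_form_horner a b c t v : (linear_form a b c).[v%:P].[t] = a + b * t + c * v.
Proof. by rewrite /linear_form !hornerE. Qed.

(** The equation [y ^+ 3 = g(x)], homogenised to degree 4 and evaluated at [(P0 : P1 : P2)]. *)
Definition quartic_form P0 P1 P2 (g : {poly k}) : {poly {poly k}} :=
  P2 ^+ 3 * P0 - \sum_(i < 5) (g`_i)%:P%:P * (P1 ^+ i * P0 ^+ (4 - i)).

Lemma quartic_form_degree P0 P1 P2 g : total_degree_le 1 P0 -> total_degree_le 1 P1 ->
  total_degree_le 1 P2 -> total_degree_le 4 (quartic_form P0 P1 P2 g).
Proof.
move=> d0 d1 d2; apply: total_degreeD.
  exact: (total_degreeM (n := 3) (m := 1) (total_degreeX 3 d2) d0).
apply: total_degreeN; elim/big_ind: _ => [i|P Q|i _]; first by rewrite coef0 size_poly0.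
  exact: total_degreeD.
apply: total_degreeC; have := total_degreeM (total_degreeX i d1) (total_degreeX (4 - i) d0).
by rewrite subnKC // -ltnS.
Qed.

(** Interpolation at [1], [-1], [2], [-2], which are nonzero and distinct when 6 is invertible; 12
    clears the denominators of Lagrange's formula. *)
Lemma poly3_coefs (two : 2%:R != 0 :> k) (three : 3%:R != 0 :> k) a b c d :
  (forall t, t != 0 -> a + b * t + c * t ^+ 2 + d * t ^+ 3 = 0) ->
  [/\ a = 0, b = 0, c = 0 & d = 0].
Proof.
move=> h; have one0 := oner_neq0 k.
have h1 := h 1 one0; have h2 := h 2%:R two.
have h3 := h (-1) (_ : -1 != 0); rewrite oppr_eq0 in h3; move/(_ one0) in h3.
have h4 := h (- 2%:R) (_ : - 2%:R != 0); rewrite oppr_eq0 in h4; move/(_ two) in h4.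
have six : 12%:R != 0 :> k.
  by rewrite (_ : 12%:R = 2%:R * 2%:R * 3%:R) ?mulf_neq0 // -!natrM.
have z (u : k) : 12%:R * u = 0 -> u = 0 by move=> hu; apply: (mulfI six); rewrite hu mulr0.
split; apply: z.
- transitivity (8%:R * (a + b * 1 + c * 1 ^+ 2 + d * 1 ^+ 3) + 8%:R * (a + b * -1 + c * (-1) ^+ 2 + d * (-1) ^+ 3)
    - 2%:R * (a + b * 2%:R + c * 2%:R ^+ 2 + d * 2%:R ^+ 3)
    - 2%:R * (a + b * (- 2%:R) + c * (- 2%:R) ^+ 2 + d * (- 2%:R) ^+ 3)); first by ring.
  by rewrite h1 h2 h3 h4; ring.
- transitivity (8%:R * (a + b * 1 + c * 1 ^+ 2 + d * 1 ^+ 3) - 8%:R * (a + b * -1 + c * (-1) ^+ 2 + d * (-1) ^+ 3)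
    - (a + b * 2%:R + c * 2%:R ^+ 2 + d * 2%:R ^+ 3)
    + (a + b * (- 2%:R) + c * (- 2%:R) ^+ 2 + d * (- 2%:R) ^+ 3)); first by ring.
  by rewrite h1 h2 h3 h4; ring.
- transitivity (- 2%:R * (a + b * 1 + c * 1 ^+ 2 + d * 1 ^+ 3) - 2%:R * (a + b * -1 + c * (-1) ^+ 2 + d * (-1) ^+ 3)
    + 2%:R * (a + b * 2%:R + c * 2%:R ^+ 2 + d * 2%:R ^+ 3)
    + 2%:R * (a + b * (- 2%:R) + c * (- 2%:R) ^+ 2 + d * (- 2%:R) ^+ 3)); first by ring.
  by rewrite h1 h2 h3 h4; ring.
- transitivity (- 2%:R * (a + b * 1 + c * 1 ^+ 2 + d * 1 ^+ 3) + 2%:R * (a + b * -1 + c * (-1) ^+ 2 + d * (-1) ^+ 3)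
    + (a + b * 2%:R + c * 2%:R ^+ 2 + d * 2%:R ^+ 3)
    - (a + b * (- 2%:R) + c * (- 2%:R) ^+ 2 + d * (- 2%:R) ^+ 3)); first by ring.
  by rewrite h1 h2 h3 h4; ring.
Qed.

Lemma poly4_coefs (two : 2%:R != 0 :> k) (three : 3%:R != 0 :> k) a b c d e :
  (forall t, a + b * t + c * t ^+ 2 + d * t ^+ 3 + e * t ^+ 4 = 0) ->
  [/\ a = 0, b = 0, c = 0, d = 0 & e = 0].
Proof.
move=> h; have a0 : a = 0 by have := h 0; rewrite !expr0n /= !mulr0 !addr0.
have [|b0 c0 d0 e0] := @poly3_coefs two three b c d e; last by split.
move=> t t0; apply: (mulfI t0); rewrite mulr0 -[RHS](h t) a0; ring.
Qed.

(* The line [M] through the centres of the two homologies is [t = 0], and [v] is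
   shifted so that [l0 + l1 t + l2 v] vanishes at [v = 0]. *)
Lemma quartic_identity_normal (two : 2%:R != 0 :> k) (three : 3%:R != 0 :> k)
    (l0 l1 l2 b0 b1 b2 g0 g1 g2 g3 g4 lam : k) (F : k -> k) : l2 != 0 -> g4 != 0 ->
  (forall t v, let L := l0 + l1 * t + l2 * v in
    (b0 + b1 * t + b2 * v) ^+ 3 * L -
    (g0 * L ^+ 4 + g1 * t * L ^+ 3 + g2 * t ^+ 2 * L ^+ 2 + g3 * t ^+ 3 * L + g4 * t ^+ 4) =
    lam * (v ^+ 3 - F t)) ->
  exists c0 c4, forall t, F t = c4 * t ^+ 4 + c0.
Proof.
move=> l20 g40 E0.
pose m0 := l0 / l2; pose n := l1 / l2; pose e := b0 - b2 * m0; pose d := b1 - b2 * n.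
have E t v : (b2 * v + e + d * t) ^+ 3 * (l2 * v) -
    (g0 * (l2 * v) ^+ 4 + g1 * t * (l2 * v) ^+ 3 + g2 * t ^+ 2 * (l2 * v) ^+ 2 +
     g3 * t ^+ 3 * (l2 * v) + g4 * t ^+ 4) = lam * ((v - m0 - n * t) ^+ 3 - F t).
  have LE : l2 * v = l0 + l1 * t + l2 * (v - m0 - n * t) by rewrite /m0 /n; field.
  have BE : b2 * v + e + d * t = b0 + b1 * t + b2 * (v - m0 - n * t) by rewrite /e /d; ring.
  by rewrite BE LE; exact: E0.
(* At [v = 0] only the term in [t ^+ 4] remains on the left, so [F] is a multiple of [t ^+ 4] minus
   the cube of [m0 + n * t]. It remains to prove [n = 0]. *)
have FE t : lam * F t = g4 * t ^+ 4 - lam * (m0 + n * t) ^+ 3.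
  have := E t 0; rewrite !mulr0 !expr0n /= !mulr0 !add0r => h.
  have -> : lam * F t = lam * (0 - m0 - n * t) ^+ 3 - lam * ((0 - m0 - n * t) ^+ 3 - F t) by ring.
  by rewrite sub0r -h; ring.
have lam0 : lam != 0.
  apply: contra_neq g40 => lam0; have := FE 1.
  by rewrite lam0 !mul0r subr0 expr1n mulr1.
have coefs t : [/\ (e + d * t) ^+ 3 * l2 - g3 * t ^+ 3 * l2 - 3%:R * lam * (m0 + n * t) ^+ 2 = 0,
    3%:R * b2 * (e + d * t) ^+ 2 * l2 - g2 * t ^+ 2 * l2 ^+ 2 + 3%:R * lam * (m0 + n * t) = 0,
    3%:R * b2 ^+ 2 * (e + d * t) * l2 - g1 * t * l2 ^+ 3 - lam = 0 &
    b2 ^+ 3 * l2 - g0 * l2 ^+ 4 = 0].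
  apply: (poly3_coefs two three) => v v0; apply: (mulfI v0); rewrite mulr0.
  have /eqP := E t v; rewrite mulrBr FE -subr_eq0 => /eqP h.
  by rewrite -[RHS]h; ring.
have [c00 c01 _ _] : [/\ e ^+ 3 * l2 - 3%:R * lam * m0 ^+ 2 = 0,
    3%:R * e ^+ 2 * d * l2 - 6%:R * lam * m0 * n = 0,
    3%:R * e * d ^+ 2 * l2 - 3%:R * lam * n ^+ 2 = 0 & d ^+ 3 * l2 - g3 * l2 = 0].
  by apply: (poly3_coefs two three) => t _; have [h _ _ _] := coefs t; rewrite -[RHS]h; ring.
have [c10 c11 _ _] : [/\ 3%:R * b2 * e ^+ 2 * l2 + 3%:R * lam * m0 = 0,
    6%:R * b2 * e * d * l2 + 3%:R * lam * n = 0,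
    3%:R * b2 * d ^+ 2 * l2 - g2 * l2 ^+ 2 = 0 & (0 : k) = 0].
  by apply: (poly3_coefs two three) => t _; have [_ h _ _] := coefs t; rewrite -[RHS]h; ring.
have [c20 _ _ _] : [/\ 3%:R * b2 ^+ 2 * e * l2 - lam = 0,
    3%:R * b2 ^+ 2 * d * l2 - g1 * l2 ^+ 3 = 0, (0 : k) = 0 & (0 : k) = 0].
  by apply: (poly3_coefs two three) => t _; have [_ _ h _] := coefs t; rewrite -[RHS]h; ring.
have lamE : lam = 3%:R * b2 ^+ 2 * e * l2 by apply/esym/eqP; rewrite -subr_eq0 c20.
have b20 : b2 != 0 by apply: contra_neq lam0 => b20; rewrite lamE b20 expr0n /= !(mulr0, mul0r).
have e0 : e != 0 by apply: contra_neq lam0 => e0; rewrite lamE e0 !(mulr0, mul0r).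
have r1 : e + 3%:R * b2 * m0 = 0.
  apply: (mulfI (_ : 3%:R * b2 * e * l2 != 0)); first by rewrite !mulf_neq0.
  by rewrite mulr0 -[RHS]c10 lamE; ring.
have r2 : 2%:R * d + 3%:R * b2 * n = 0.
  apply: (mulfI (_ : 3%:R * b2 * e * l2 != 0)); first by rewrite !mulf_neq0.
  by rewrite mulr0 -[RHS]c11 lamE; ring.
have r3 : d + 2%:R * b2 * n = 0.
  apply: (mulfI (_ : 3%:R * e ^+ 2 * l2 != 0)); first by rewrite !mulf_neq0 ?expf_neq0.
  rewrite mulr0; transitivity ((3%:R * e ^+ 2 * d * l2 - 6%:R * lam * m0 * n) +
    6%:R * b2 * e * l2 * n * (e + 3%:R * b2 * m0)); first by rewrite lamE; ring.
  by rewrite c01 r1 mulr0 addr0.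
(* [r2] and [r3] are linear relations between [d] and [b2 * n] with determinant 1. *)
have n0 : n = 0.
  apply: (mulfI b20); rewrite mulr0.
  have -> : b2 * n = 2%:R * (d + 2%:R * b2 * n) - (2%:R * d + 3%:R * b2 * n) by ring.
  by rewrite r2 r3 mulr0 subrr.
exists (- m0 ^+ 3), (g4 / lam) => t; apply: (mulfI lam0); rewrite FE n0; field.
by rewrite lam0.
Qed.

End Bivariate.

Lemma ev_comp (k : fieldType) (C : curve k) (x : C) p q : ev x (p \Po q) = ev (ev x q) p.
Proof. by rewrite /ev map_comp_poly horner_comp. Qed.

Lemma quartic_form_horner (k : fieldType) (P0 P1 P2 : {poly {poly k}}) (g : {poly k}) (t v : k) :
  let h (P : {poly {poly k}}) := P.[v%:P].[t] in
  h (quartic_form P0 P1 P2 g) = h P2 ^+ 3 * h P0 -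
    (g`_0 * h P0 ^+ 4 + g`_1 * h P1 * h P0 ^+ 3 + g`_2 * h P1 ^+ 2 * h P0 ^+ 2 +
     g`_3 * h P1 ^+ 3 * h P0 + g`_4 * h P1 ^+ 4).
Proof.
move=> h; rewrite /h /quartic_form !big_ord_recl big_ord0 /bump /=.
rewrite !(hornerD, hornerN, hornerM, horner_exp, hornerC, horner0) /=; ring.
Qed.

(** Both spans describe the same regular differentials, relative to two reference differentials; [h]
    is the quotient of these, found as the ratio of the dual derivations. *)
Lemma picard_spans (k : closedFieldType) (three : 3%:R != 0 :> k) (C : curve k)
    (s1 s2 : {rmorphism C -> C}) w1 w2 (x1 x2 y1 y2 : C) f1 f2 :
  picard_form s1 w1 x1 y1 f1 -> picard_form s2 w2 x2 y2 f2 ->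
  exists2 h, h != 0 & forall u, affine_span x2 y2 u <-> affine_span x1 y1 (u / h).
Proof.
move=> [K1 sep1 sf1] [K2 sep2 sf2].
have [D1 [DD1 Dx1 Dy1]] := kummer_derivation three K1.
have [D2 [DD2 Dx2 Dy2]] := kummer_derivation three K2.
have three' : 3%:R != 0 :> C by rewrite -(rmorph_nat (const C)) fmorph_eq0.
have n1 : D1 x1 != 0 by rewrite Dx1 mulf_neq0 ?expf_neq0 // (kum_neq0 K1).
have n2 : D2 x2 != 0 by rewrite Dx2 mulf_neq0 ?expf_neq0 // (kum_neq0 K2).
have prop z : D2 z = D2 x1 / D1 x1 * D1 z.
  apply: (mulfI n1); rewrite (derivation_proportional three K1 DD1 DD2); field.
  by rewrite n1.
have h0 : D2 x1 / D1 x1 != 0.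
  by apply: contra_neq n2 => h0; rewrite prop h0 mul0r.
exists (D2 x1 / D1 x1) => // u.
rewrite -(holomorphicE three K2 sep2 sf2 DD2 Dx2 Dy2) (holomorphic_scale h0 prop).
exact: (holomorphicE three K1 sep1 sf1 DD1 Dx1 Dy1).
Qed.

Lemma transcendental_affine (k : fieldType) (C : curve k) (x : C) m0 m1 :
  transcendental x -> m1 != 0 -> transcendental (const C m0 + const C m1 * x).
Proof.
move=> xT m10 h; apply: xT; have c10 : const C m1 != 0 by rewrite fmorph_eq0.
have -> : x = (const C m0 + const C m1 * x - const C m0) / const C m1 by field.
by apply: algebraic_div; [apply: algebraic_sub => //|]; exact: algebraic_id.
Qed.

Section QuarticRelation.
Variables (k : closedFieldType) (two : 2%:R != 0 :> k) (three : 3%:R != 0 :> k) (C : curve k).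
Variables (s : {rmorphism C -> C}) (w : k) (x y : C) (f : {poly k}).
Hypotheses (K : kummer s w x y f) (sf : size f = 5%N).

Let xT := kum_transc K.

(** Reducing by [y ^+ 3 = f] and using independence of [1], [y], [y ^+ 2], the coefficients of [1]
    and [y] in [P] are multiples of [f], with cofactors minus those of [y ^+ 3] and [y ^+ 4]. As [f]
    has degree 4, the degree bounds make the first cofactor constant and the second zero. *)
Lemma quartic_relation (P : {poly {poly k}}) : total_degree_le 4 P ->
  (map_poly (ev x) P).[y] = 0 -> exists lam : k, P = lam%:P%:P * ('X^3 - f%:P).
Proof.
move=> dP E.
have f0 : f != 0 by rewrite -size_poly_gt0 sf.
have zero i : (4 < i)%N -> P`_i = 0.
  by move=> i4; apply/eqP; rewrite -size_poly_leq0 (leq_trans (dP i)) // leqn0 subn_eq0.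
have sP : (size P <= 5)%N by apply/leq_sizeP => i; exact: zero.
have : ev x (P`_0 + f * P`_3) + ev x (P`_1 + f * P`_4) * y + ev x P`_2 * y ^+ 2 = 0.
  rewrite -[RHS]E (horner_coef_wide _ (leq_trans (size_poly _ _) sP)) !big_ord_recl big_ord0.
  rewrite !coef_map /= !evE -(kum_eq K) /bump /=; ring.
move=> /(kummer_independent three K (ratl_ev _ _) (ratl_ev _ _) (ratl_ev _ _))[/eqP e0 /eqP e1 /eqP e2].
rewrite !ev_eq0 // !addr_eq0 in e0 e1 e2.
have big (Q R : {poly k}) n : (n < 5)%N -> (size Q <= n)%N -> Q == - (f * R) -> R = 0.
  move=> n5 sQ /eqP QE; apply/eqP; apply: contrapT => /negP R0.
  have := sQ; rewrite QE size_polyN size_mul // sf; move: n5 R0; rewrite -size_poly_gt0.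
  by clear; move: (size R); lia.
have P4 : P`_4 = 0 by exact: (big _ _ 4 _ (dP 1%N) e1).
have P1 : P`_1 = 0 by move/eqP: e1; rewrite P4 mulr0 oppr0.
have [lam P3] : exists lam, P`_3 = lam%:P.
  exists (P`_3)`_0; apply: size1_polyC; have := dP 0%N; rewrite (eqP e0) size_polyN.
  have [->|R0] := eqVneq P`_3 0; first by rewrite size_poly0.
  rewrite size_mul // sf; move: R0; rewrite -size_poly_gt0.
  by clear; move: (size P`_3); lia.
exists lam; apply/polyP=> i; rewrite coefCM coefB coefXn coefC.
case: i => [|[|[|[|i]]]] /=.
- by rewrite sub0r mulrN (eqP e0) P3 mulrC.
- by rewrite subr0 mulr0.
- by rewrite subr0 mulr0; apply/eqP.
- by rewrite subr0 mulr1.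
by rewrite subr0 mulr0; case: i => [|i] //; exact: zero.
Qed.

Lemma ev_linear_form (a b c : k) : (map_poly (ev x) (linear_form a b c)).[y] =
  const C a + const C b * x + const C c * y.
Proof.
rewrite /linear_form rmorphD /= map_polyC map_polyZ map_polyX !hornerE /= !evE.
by [].
Qed.

(** By homogeneity the factor [h] drops out of the second equation, which becomes a quartic in [x]
    and [y] vanishing on the curve; [quartic_relation] then identifies it. *)
Lemma coordinate_identity (h x' y' : C) (g : {poly k}) (l0 l1 l2 a0 a1 a2 b0 b1 b2 : k) :
  h != 0 -> y' ^+ 3 = ev x' g -> (size g <= 5)%N ->
  1 = h * (const C l0 + const C l1 * x + const C l2 * y) ->
  x' = h * (const C a0 + const C a1 * x + const C a2 * y) ->
  y' = h * (const C b0 + const C b1 * x + const C b2 * y) ->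
  exists lam, forall t v,
    let L := l0 + l1 * t + l2 * v in let A := a0 + a1 * t + a2 * v in
    (b0 + b1 * t + b2 * v) ^+ 3 * L -
    (g`_0 * L ^+ 4 + g`_1 * A * L ^+ 3 + g`_2 * A ^+ 2 * L ^+ 2 + g`_3 * A ^+ 3 * L + g`_4 * A ^+ 4) =
    lam * (v ^+ 3 - f.[t]).
Proof.
move=> h0 E sg LE AE BE.
set L := _ + _ in LE; set A := _ + _ in AE; set B := _ + _ in BE.
pose P := quartic_form (linear_form l0 l1 l2) (linear_form a0 a1 a2) (linear_form b0 b1 b2) g.
have [||lam PE] := @quartic_relation P.
- by apply: quartic_form_degree; exact: linear_form_degree.
- rewrite /P /quartic_form rmorphB rmorphM rmorphXn /= rmorph_sum /= hornerD hornerN hornerM horner_exp.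
  rewrite !ev_linear_form -/L -/B !big_ord_recl big_ord0 /= !hornerD horner0.
  rewrite !rmorphM !rmorphXn /= !hornerM !horner_exp !map_polyC /= !hornerC !ev_linear_form -/L -/A !evC.
  have -> : B = y' / h by rewrite BE mulrC mulKf.
  have -> : A = x' / h by rewrite AE mulrC mulKf.
  have -> : L = 1 / h by rewrite LE mulrC mulKf.
  rewrite expr_div_n E /ev (horner_coef_wide _ (leq_trans (size_poly _ _) sg)) !big_ord_recl big_ord0.
  by rewrite !coef_map /= /bump /=; field.
exists lam => t v L' A'.
have := congr1 (fun Q : {poly {poly k}} => Q.[v%:P].[t]) PE.
rewrite /P quartic_form_horner !linear_form_horner => ->.
by rewrite !(hornerD, hornerN, hornerM, horner_exp, hornerC, hornerXn, hornerX) /=.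
Qed.

(* If the centre [y = infinity] of the first homology is not mapped to a point
   with [x' = infinity], its [x']-coordinate is finite. *)
Lemma coordinate_infinity (h x' y' : C) (g : {poly k}) (l0 l1 a0 a1 a2 b0 b1 b2 : k) :
  h != 0 -> y' ^+ 3 = ev x' g -> size g = 5%N ->
  1 = h * (const C l0 + const C l1 * x) ->
  x' = h * (const C a0 + const C a1 * x + const C a2 * y) ->
  y' = h * (const C b0 + const C b1 * x + const C b2 * y) -> a2 = 0.
Proof.
move=> h0 E sg LE AE BE.
have LE' : 1 = h * (const C l0 + const C l1 * x + const C 0 * y).
  by rewrite rmorph0 mul0r addr0.
have sg' : (size g <= 5)%N by rewrite sg.
have [lam id] := coordinate_identity h0 E sg' LE' AE BE.
have g4 : g`_4 != 0 by have := lead_coef_eq0 g; rewrite /lead_coef sg /= => ->; rewrite -size_poly_gt0 sg.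
(* The arguments are the coefficients in [v] of the identity at [t = 0]; that of [v ^+ 4] is
   [a2 ^+ 4] times minus the leading coefficient of [g]. *)
have [|_ _ _ _ e4] := @poly4_coefs _ two three
  (l0 * b0 ^+ 3 - (g`_0 * l0 ^+ 4 + g`_1 * l0 ^+ 3 * a0 + g`_2 * l0 ^+ 2 * a0 ^+ 2 +
     g`_3 * l0 * a0 ^+ 3 + g`_4 * a0 ^+ 4) + lam * f.[0])
  (3%:R * l0 * b0 ^+ 2 * b2 - (g`_1 * l0 ^+ 3 * a2 + 2%:R * g`_2 * l0 ^+ 2 * a0 * a2 +
     3%:R * g`_3 * l0 * a0 ^+ 2 * a2 + 4%:R * g`_4 * a0 ^+ 3 * a2))
  (3%:R * l0 * b0 * b2 ^+ 2 - (g`_2 * l0 ^+ 2 * a2 ^+ 2 + 3%:R * g`_3 * l0 * a0 * a2 ^+ 2 +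
     6%:R * g`_4 * a0 ^+ 2 * a2 ^+ 2))
  (l0 * b2 ^+ 3 - (g`_3 * l0 * a2 ^+ 3 + 4%:R * g`_4 * a0 * a2 ^+ 3) - lam)
  (- (g`_4 * a2 ^+ 4)) _.
  move=> v; have /eqP := id 0 v; rewrite -subr_eq0 => /eqP idv.
  by rewrite -[RHS]idv; ring.
move/eqP: e4; rewrite oppr_eq0 mulf_eq0 (negbTE g4) expf_eq0 /=.
by move/eqP.
Qed.

Lemma kummer_affine m0 m1 : m1 != 0 -> exists f' : {poly k},
  [/\ kummer s w (const C m0 + const C m1 * x) y f', size f' = 5%N &
      f = f' \Po (m0%:P + m1%:P * 'X)].
Proof.
move=> m10; have c10 : const C m1 != 0 by rewrite fmorph_eq0.
set x' := _ + _; have x'T : transcendental x' by exact: transcendental_affine.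
pose q := (m1^-1)%:P * ('X - m0%:P).
have qx : ev x' q = x by rewrite /q !evE fmorphV /x'; field.
exists (f \Po q); split.
- apply: (kummer_change K) => //.
  + by apply: (subringD (ratl_subring xT)); [exact: ratl_const|
      apply: (subringM (ratl_subring xT)); [exact: ratl_const|exact: ratl_id]].
  + by rewrite -qx; exact: ratl_ev.
  + exact: kum_root K.
  + exact: kum_neq0 K.
  + exact: kum_gen K.
  + by rewrite ev_comp qx; exact: kum_eq K.
- by rewrite size_comp_poly2 ?sf // /q mul_polyC size_scale ?size_XsubC // invr_eq0.
rewrite -comp_polyA (_ : q \Po _ = 'X) ?comp_polyXr //.
rewrite /q comp_polyM comp_polyC comp_polyB comp_polyX comp_polyC addrC addKr mulrA -polyCM.
by rewrite mulVf // mul1r.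
Qed.

End QuarticRelation.

(** In the coordinates [(1 : x1 : y1)] the first homologies have centre [(0 : 0 : 1)], the second
    ones the common zero of the linear forms giving 1 and [x2]. If one centre lies on the line at
    infinity of the other equation, the centres coincide by [coordinate_infinity], and one of [x1],
    [x2] is a function of the other. Otherwise the line joining the centres becomes [x = 0]. *)
Lemma two_picard_forms (k : closedFieldType) (two : 2%:R != 0 :> k) (three : 3%:R != 0 :> k)
    (C : curve k) (s1 s2 : {rmorphism C -> C}) w1 w2 (x1 x2 y1 y2 : C) f1 f2 :
  picard_form s1 w1 x1 y1 f1 -> picard_form s2 w2 x2 y2 f2 ->
  [\/ ratl x1 x2, ratl x2 x1 |
   exists x c0 c4, [/\ c0 != 0, c4 != 0 & kummer s1 w1 x y1 (c4%:P * 'X^4 + c0%:P)]].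
Proof.
move=> pf1 pf2; have [h h0 span] := picard_spans three pf1 pf2.
have [K1 sep1 sf1] := pf1; have [K2 sep2 sf2] := pf2.
have x1T := kum_transc K1; have x2T := kum_transc K2.
have coords u : affine_span x2 y2 u -> exists a b c,
    u = h * (const C a + const C b * x1 + const C c * y1).
  by move/span => [a [b [c E]]]; exists a, b, c; rewrite -E mulrC divfK.
have [l0 [l1 [l2 LE]]] : exists a b c, 1 = h * (const C a + const C b * x1 + const C c * y1).
  by apply: coords; exists 1, 0, 0; rewrite rmorph1 rmorph0 !mul0r !addr0.
have [a0 [a1 [a2 AE]]] : exists a b c, x2 = h * (const C a + const C b * x1 + const C c * y1).
  by apply: coords; exists 0, 1, 0; rewrite rmorph1 rmorph0 !mul0r mul1r add0r addr0.
have [b0 [b1 [b2 BE]]] : exists a b c, y2 = h * (const C a + const C b * x1 + const C c * y1).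
  by apply: coords; exists 0, 0, 1; rewrite rmorph1 rmorph0 !mul0r mul1r !add0r.
have rl (x : C) (xT : transcendental x) a b : ratl x (const C a + const C b * x).
  by apply: (subringD (ratl_subring xT)); [exact: ratl_const|
    apply: (subringM (ratl_subring xT)); [exact: ratl_const|exact: ratl_id]].
have [l20|l2n] := eqVneq l2 0.
  have LE' : 1 = h * (const C l0 + const C l1 * x1).
    by rewrite LE l20 rmorph0 mul0r addr0.
  have a20 := coordinate_infinity two three K1 sf1 h0 (kum_eq K2) sf2 LE' AE BE.
  apply: Or31; rewrite -[x2]divr1 LE' AE a20 rmorph0 mul0r addr0 -mulf_div mulfV // mul1r.
  by apply: (subringM (ratl_subring x1T)); [exact: rl|apply: ratlV => //; exact: rl].
(* Eliminating [y1] between the forms of 1 and [x2] gives the line through both centres. *)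
pose m0 := l2 * a0 - a2 * l0; pose m1 := l2 * a1 - a2 * l1.
have X2E : const C l2 * x2 - const C a2 = h * (const C m0 + const C m1 * x1).
  rewrite -[const C a2]mulr1 LE AE /m0 /m1 !rmorphB !rmorphM /=; ring.
clearbody m0 m1.
have cl2 : const C l2 != 0 by rewrite fmorph_eq0.
have nconst c : const C l2 * x2 - const C a2 != const C c.
  apply/eqP=> E; apply: x2T.
  have -> : x2 = (const C c + const C a2) / const C l2 by rewrite -E; field.
  by apply: algebraic_div; [apply: algebraic_add|]; exact: algebraic_id.
(* If [m1 = 0], that line is the line at infinity of the first equation, and the argument for
   [l2 = 0] applies with the equations exchanged. *)
have [m10|m1n] := eqVneq m1 0.
  apply: Or32; rewrite m10 rmorph0 mul0r addr0 in X2E.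
  have m0n : m0 != 0.
    by apply: contraTneq (nconst 0) => m00; rewrite X2E m00 rmorph0 mulr0 eqxx.
  have cm0 : const C m0 != 0 by rewrite fmorph_eq0.
  have hE : h = const C (- a2 / m0) + const C (l2 / m0) * x2.
    rewrite !fmorph_div rmorphN; apply: (mulIf cm0); rewrite -X2E; field.
    by rewrite cm0.
  have hi0 : h^-1 != 0 by rewrite invr_eq0.
  have LE' : 1 = h^-1 * (const C (- a2 / m0) + const C (l2 / m0) * x2) by rewrite -hE mulVf.
  have coords' u : affine_span x1 y1 u -> exists a b c,
      u = h^-1 * (const C a + const C b * x2 + const C c * y2).
    move=> su; have [|a [b [c E]]] := (span (u * h)).2; first by rewrite mulfK.
    by exists a, b, c; rewrite -E mulrC mulfK.
  have [a0' [a1' [a2' AE']]] : exists a b c, x1 = h^-1 * (const C a + const C b * x2 + const C c * y2).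
    by apply: coords'; exists 0, 1, 0; rewrite rmorph1 rmorph0 !mul0r mul1r add0r addr0.
  have [b0' [b1' [b2' BE']]] : exists a b c, y1 = h^-1 * (const C a + const C b * x2 + const C c * y2).
    by apply: coords'; exists 0, 0, 1; rewrite rmorph1 rmorph0 !mul0r mul1r !add0r.
  have a20 := coordinate_infinity two three K2 sf2 hi0 (kum_eq K1) sf1 LE' AE' BE'.
  rewrite AE' a20 rmorph0 mul0r addr0.
  apply: (subringM (ratl_subring x2T)); last exact: rl.
  by apply: ratlV => //; rewrite hE; exact: rl.
apply: Or33.
have cm1 : const C m1 != 0 by rewrite fmorph_eq0.
set x := const C m0 + const C m1 * x1 in X2E.
have [f [K sf fE]] := kummer_affine K1 sf1 m0 m1n.
have [g [K' sg _]] := kummer_affine K2 sf2 (- a2) l2n.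
have lin u v t : const C u + const C v * x1 + const C t * y1 =
    const C (u - v * m0 / m1) + const C (v / m1) * x + const C t * y1.
  rewrite /x !(rmorphB, rmorphM, fmorphV) /=; field.
  by rewrite cm1.
have xE : const C (- a2) + const C l2 * x2 = h * (const C 0 + const C 1 * x + const C 0 * y1).
  by rewrite rmorphN addrC X2E rmorph0 rmorph1 mul0r mul1r add0r addr0.
rewrite lin in LE; rewrite lin in BE.
have sg' : (size g <= 5)%N by rewrite sg.
have [lam id] := coordinate_identity three K sf h0 (kum_eq K') sg' LE xE BE.
have g4 : g`_4 != 0 by have := lead_coef_eq0 g; rewrite /lead_coef sg /= => ->; rewrite -size_poly_gt0 sg.
have f4 : f`_4 != 0 by have := lead_coef_eq0 f; rewrite /lead_coef sf /= => ->; rewrite -size_poly_gt0 sf.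
have [|c0 [c4 FE]] := @quartic_identity_normal _ two three (l0 - l1 * m0 / m1) (l1 / m1) l2
    (b0 - b1 * m0 / m1) (b1 / m1) b2 g`_0 g`_1 g`_2 g`_3 g`_4 lam (fun t => f.[t]) l2n g4.
  move=> t v L; rewrite -id /= !mul0r !mul1r add0r addr0 -/L; ring.
have [|e0 e1 e2 e3 e4] := @poly4_coefs _ two three (f`_0 - c0) f`_1 f`_2 f`_3 (f`_4 - c4).
  move=> t; have := FE t; rewrite (horner_coef_wide _ (eq_leq sf)) !big_ord_recl big_ord0 /bump /=.
  by move/eqP; rewrite -subr_eq0 => /eqP E; rewrite -[RHS]E; ring.
have fP : f = c4%:P * 'X^4 + c0%:P.
  apply/polyP=> i; rewrite coefD coefCM coefXn coefC.
  move/eqP: e0; rewrite subr_eq0 => /eqP e0; move/eqP: e4; rewrite subr_eq0 => /eqP e4.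
  case: i => [|[|[|[|[|i]]]]] /=; rewrite ?mulr0 ?mulr1 ?addr0 ?add0r //.
  by rewrite nth_default // sf.
have c4E : c4 = f`_4 by apply/eqP; rewrite eq_sym -subr_eq0 e4.
exists x, c0, c4; split; [|by rewrite c4E|by rewrite -fP].
(* Without its constant term the quartic would make [f1] a scalar times a fourth power, against
   separability. *)
apply/eqP=> c00; pose u := m0%:P + m1%:P * 'X.
have su : size u = 2%N by rewrite /u addrC mul_polyC size_polyDl size_scale ?size_polyX // ltnS size_polyC_leq1.
have : coprimep u u.
  apply: (separable_coprime sep1); rewrite fE fP c00 addr0 comp_polyM comp_polyC comp_Xn_poly.
  by apply: dvdp_mull; rewrite -expr2 dvdp_exp2l.
by rewrite coprimepp su.
Qed.

Lemma qpoly_lift (L F : fieldType) (h : {poly L}) (hI : monic_irreducible_poly h)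
    (Phi : {rmorphism L -> F}) (y : F) : root (map_poly Phi h) y ->
  exists phi : {rmorphism {poly %/ h with hI} -> F},
    forall p, phi (in_qpoly h p) = (map_poly Phi p).[y].
Proof.
move=> hy; have mkE : mk_monic h = h by exact: mk_monicE.
pose g (z : {poly %/ h with hI}) := (map_poly Phi (val z)).[y].
have E p : g (in_qpoly h p) = (map_poly Phi p).[y].
  rewrite [in RHS](Pdiv.RingMonic.rdivp_eq (monic_mk_monic h) p).
  by rewrite rmorphD rmorphM hornerD hornerM mkE (rootP hy) mulr0 add0r /g /= mkE.
have zm : zmod_morphism g.
  move=> a b; rewrite /g.
  have -> : val (a - b) = val a - val b :> {poly L} by [].
  by rewrite rmorphB hornerD hornerN.
have mm : monoid_morphism g.
  split; first by rewrite /g /= map_polyC /= hornerC rmorph1.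
  move=> a b; have -> : a * b = in_qpoly h (val a * val b) by [].
  by rewrite E rmorphM hornerM.
pose z_ := GRing.isZmodMorphism.Build _ _ g zm.
pose m_ := GRing.isMonoidMorphism.Build _ _ g mm.
by pose phi : {rmorphism {poly %/ h with hI} -> F} := HB.pack g z_ m_; exists phi.
Qed.

(** * The curve [y^3 = x^4 - 1] *)

Section FunctionFieldY0.
Variable k : closedFieldType.

Let h := Y0_poly k.
Definition Y0_x : Y0 k := qpolyC h (tofrac 'X).
Definition Y0_y : Y0 k := in_qpoly h 'X.

Lemma Y0_mk_monic : mk_monic h = h.
Proof. by apply: mk_monicE; exact: Y0_poly_irr. Qed.

Lemma in_qpoly_Y0C a : in_qpoly h a%:P = qpolyC h a.
Proof.
apply: val_inj; apply: in_qpoly_small.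
by rewrite Y0_mk_monic size_Y0_poly (leq_ltn_trans (size_polyC_leq1 _)).
Qed.

Lemma ev_Y0_x p : ev Y0_x p = qpolyC h (tofrac p).
Proof.
rewrite /ev /Y0_x /= /Y0_const map_poly_comp.
by rewrite -[RHS](congr1 (qpolyC h) (P1_horner p)) -horner_map.
Qed.

Lemma Y0_x_transcendental : transcendental Y0_x.
Proof.
move=> [p p0 /rootP]; rewrite [LHS]ev_Y0_x => E.
have := congr1 (fun r : {poly %/ h} => val r) E => /= /eqP.
by rewrite polyC_eq0 tofrac_eq0 (negPf p0).
Qed.

Lemma in_qpolyX (p : {poly {fraction {poly k}}}) n :
  in_qpoly h (p ^+ n) = (in_qpoly h p : Y0 k) ^+ n.
Proof.
elim: n => [|n IH]; first by rewrite !expr0 -polyC1 in_qpoly_Y0C.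
by rewrite !exprS -IH; exact: (@in_qpolyM _ h p (p ^+ n)).
Qed.

Lemma Y0_eq : Y0_y ^+ 3 = ev Y0_x ('X^4 - 1).
Proof.
rewrite -in_qpolyX ev_Y0_x -in_qpoly_Y0C.
have -> : 'X^3 = h + (tofrac ('X^4 - 1))%:P by rewrite subrK.
rewrite in_qpolyD; have -> : in_qpoly h h = 0; last exact: add0r.
apply: val_inj => /=; rewrite Y0_mk_monic.
by apply: Pdiv.RingMonic.rmodpp; case: (Y0_poly_irr k).
Qed.

Lemma Y0_decomposition z : exists a b c,
  [/\ ratl Y0_x a, ratl Y0_x b & ratl Y0_x c] /\ z = a + b * Y0_y + c * Y0_y ^+ 2.
Proof.
have rat a : ratl Y0_x (qpolyC h a : Y0 k).
  have [p [q [q0 E]]] := P1_fraction a; exists p, q; split=> //.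
  by rewrite !ev_Y0_x -E rmorphM.
pose v : {poly {fraction {poly k}}} := val z.
exists (qpolyC h v`_0), (qpolyC h v`_1), (qpolyC h v`_2); split; first by split.
have zE : z = in_qpoly h v.
  by apply: val_inj; symmetry; apply: in_qpoly_small; exact: size_mk_monic.
have vE : v = (v`_0)%:P + (v`_1)%:P * 'X + (v`_2)%:P * 'X^2.
  have vs : (size v <= 3)%N.
    rewrite -ltnS -(size_Y0_poly k) -/h -Y0_mk_monic; exact: size_mk_monic.
  apply/polyP => i; rewrite !coefD coefC coefMX !coefCM coefXn coefC.
  case: i => [|[|[|i]]] /=; rewrite ?mulr0 ?mulr1 ?addr0 ?add0r //.
  by rewrite nth_default // (leq_trans vs).
rewrite [LHS]zE {1}vE !in_qpolyD; congr (_ + _ + _); first exact: in_qpoly_Y0C.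
  by rewrite -in_qpoly_Y0C; exact: (@in_qpolyM _ h _ 'X).
by rewrite -in_qpoly_Y0C -in_qpolyX; exact: (@in_qpolyM _ h _ 'X^2).
Qed.

Section Lift.
Variable C : curve k.
Implicit Types (x y z : C).

Lemma Y0_lift x y : transcendental x -> y ^+ 3 = ev x ('X^4 - 1) ->
  exists phi : {rmorphism Y0 k -> C}, [/\ pullback phi, phi Y0_x = x & phi Y0_y = y].
Proof.
move=> xT xy; have [Phi PhiE] := frac_lift xT.
have hy : root (map_poly Phi (Y0_poly k)) y.
  by rewrite /root /Y0_poly rmorphB /= map_polyXn map_polyC /= PhiE !hornerE xy subrr.
have [phi phiE] := qpoly_lift (Y0_poly_irr k) hy.
have phiC a : phi (qpolyC h a) = Phi a.
  by rewrite -in_qpoly_Y0C phiE map_polyC hornerC.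
exists phi; split.
- by move=> c; rewrite [LHS]phiC [LHS]PhiE evC.
- by rewrite [LHS]phiC PhiE evX.
- by rewrite [LHS]phiE map_polyX hornerX.
Qed.
End Lift.
End FunctionFieldY0.

Section Coordinates.
Variables (k : closedFieldType) (C : curve k).
Implicit Types (x y z : C).

(** An isomorphism with [Y0] in terms of generators, so that automorphisms can be built on [C]
    without computing in the quotient ring. *)
Definition Y0_coordinates x y : Prop :=
  [/\ transcendental x, y ^+ 3 = ev x ('X^4 - 1) &
      forall z, exists a b c,
        [/\ ratl x a, ratl x b & ratl x c] /\ z = a + b * y + c * y ^+ 2].

Lemma Y0_coordinates_lift x y : Y0_coordinates x y ->
  exists phi : {rmorphism Y0 k -> C},
    [/\ pullback phi, bijective phi, phi (Y0_x k) = x & phi (Y0_y k) = y].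
Proof.
move=> [xT xy dec]; have [phi [phik phix phiy]] := Y0_lift xT xy.
exists phi; split=> //.
have rat a : ratl x a -> exists u, phi u = a.
  move=> /(ratl_quot xT)[p [q [_ ->]]]; exists (ev (Y0_x k) p / ev (Y0_x k) q).
  by rewrite fmorph_div !pullback_ev // phix.
have /choice[g gK] : forall z, exists u, phi u = z.
  move=> z; have [a [b [c [[/rat[a' <-] /rat[b' <-] /rat[c' <-]] ->]]]] := dec z.
  exists (a' + b' * Y0_y k + c' * Y0_y k ^+ 2).
  by rewrite !rmorphD !(rmorphM phi) phiy.
by exists g => // u; apply: (fmorph_inj phi); rewrite gK.
Qed.

Lemma isomorphic_Y0P : isomorphic C (Y0 k) <-> exists x y, Y0_coordinates x y.
Proof.
split=> [[phi [phik [g gK phiK]]]|[x [y xy]]]; last first.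
  by have [phi [? ? _ _]] := Y0_coordinates_lift xy; exists phi.
exists (phi (Y0_x k)), (phi (Y0_y k)); split.
- by apply: pullback_transcendental => //; exact: Y0_x_transcendental.
- by rewrite -rmorphXn Y0_eq pullback_ev.
move=> z; have [a [b [c [[ra rb rc] E]]]] := Y0_decomposition (g z).
exists (phi a), (phi b), (phi c); split; first by split; exact: pullback_ratl.
by rewrite -(phiK z) E !rmorphD !(rmorphM phi) /=.
Qed.

Lemma Y0_endo x y x' y' : Y0_coordinates x y ->
  transcendental x' -> y' ^+ 3 = ev x' ('X^4 - 1) ->
  exists t : {rmorphism C -> C}, [/\ pullback t, t x = x' & t y = y'].
Proof.
move=> xy x'T x'y'.
have [phi [phik [g gK phiK] <- <-]] := Y0_coordinates_lift xy.
have [psi [psik <- <-]] := Y0_lift x'T x'y'.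
pose z_ := GRing.isZmodMorphism.Build _ _ g (can2_zmod_morphism gK phiK).
pose m_ := GRing.isMonoidMorphism.Build _ _ g (can2_monoid_morphism gK phiK).
pose G : {rmorphism C -> Y0 k} := HB.pack g z_ m_.
exists (psi \o G : {rmorphism C -> C}); split=> [c||]; rewrite /= ?gK //.
by rewrite -phik gK psik.
Qed.

Lemma Y0_endo_ext x y (u v : {rmorphism C -> C}) : Y0_coordinates x y ->
  pullback u -> pullback v -> u x = v x -> u y = v y -> u =1 v.
Proof.
move=> [xT _ dec] uc vc ux uy z.
have rat a : ratl x a -> u a = v a.
  by move=> /(ratl_quot xT)[p [q [_ ->]]]; rewrite !fmorph_div !pullback_ev // ux.
have [a [b [c [[ra rb rc] ->]]]] := dec z.
by rewrite !rmorphD !(rmorphM u) !(rmorphM v) uy !rat.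
Qed.

Lemma kummer_isomorphic_Y0 s w x y c0 c4 : 3%:R != 0 :> k -> c0 != 0 -> c4 != 0 ->
  kummer (C := C) s w x y (c4%:P * 'X^4 + c0%:P) -> isomorphic C (Y0 k).
Proof.
move=> three c00 c40 K; apply/isomorphic_Y0P; have xT := kum_transc K.
(* With [x] scaled by [r] and [y] by [n], both sides of the equation become multiples of [- c0]. *)
have [r rE] : exists r : k, c4 * r ^+ 4 = - c0.
  have [|r /rootP] := closed_rootP ('X^4 - (- c0 / c4)%:P : {poly k}) _.
    by rewrite size_XnsubC.
  by rewrite hornerD hornerN hornerXn hornerC => /subr0_eq rE; exists r; rewrite rE mulrC divfK.
have [n nE] : exists n : k, n ^+ 3 = - c0.
  have [|n /rootP] := closed_rootP ('X^3 - (- c0)%:P : {poly k}) _.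
    by rewrite size_XnsubC.
  by rewrite hornerD hornerN hornerXn hornerC => /subr0_eq nE; exists n.
have r0 : r != 0 by apply: contra c00 => /eqP r0; rewrite -oppr_eq0 -rE r0 expr0n mulr0.
have n0 : n != 0 by apply: contra c00 => /eqP n0; rewrite -oppr_eq0 -nE n0 expr0n.
have cr0 : const C r != 0 by rewrite fmorph_eq0.
have cn0 : const C n != 0 by rewrite fmorph_eq0.
have XE : x / const C r = const C 0 + const C r^-1 * x by rewrite rmorph0 add0r fmorphV mulrC.
have XT : transcendental (x / const C r).
  by rewrite XE; apply: transcendental_affine => //; rewrite invr_eq0.
have xX : ratl (x / const C r) x.
  by exists ('X * r%:P), 1; rewrite oner_neq0 ev1 mul1r !evE divfK.
exists (x / const C r), (y / const C n); split=> //; last first.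
  move=> z; have [a [b [c [[ra rb rc] ->]]]] := kummer_decomposition three K z.
  have M u v := subringM (ratl_subring XT) (a := u) (b := v).
  have T u : ratl x u -> ratl (x / const C r) u by exact: ratl_trans.
  exists a, (b * const C n), (c * const C n * const C n); split.
    by split; [exact: T|apply: (M)|apply: (M); [apply: (M)|]]; rewrite /=; do ?[exact: ratl_const | exact: T].
  by field.
rewrite !exprMn !exprVn (kum_eq K) !evE -!rmorphXn.
have -> : c4 = - c0 / r ^+ 4 by rewrite -rE mulfK // expf_neq0.
rewrite nE; rewrite !rmorphM !rmorphN !fmorphV rmorphXn.
have c00' : const C c0 != 0 by rewrite fmorph_eq0.
by rewrite rmorph1; field; rewrite cr0 oppr_eq0.
Qed.
End Coordinates.

(** * Distinguished groups and special curves *)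

Section Special.
Variables (k : closedFieldType) (two : 2%:R != 0 :> k) (three : 3%:R != 0 :> k).
Variable C : curve k.
Implicit Types (x y z : C).

Lemma order3_distinguished (s : {rmorphism C -> C}) x : pullback s ->
  (forall z, s (s (s z)) = z) -> (exists z, s z != z) -> transcendental x ->
  (forall z, s z = z <-> ratl x z) ->
  distinguished [set t : C -> C | [\/ t = id, t = s | t = s \o s]].
Proof.
move=> sc s3 [z0 sz0] xT sx.
have ss3 : s \o s \o s = id :> (C -> C) by apply/funext => z /=; rewrite s3.
have bs : bijective s by exists (s \o s) => z /=; rewrite s3.
split; first split.
- move=> t [->|->|->]; first by exists idfun; split=> //; exists id.
    by exists s.
  exists (s \o s : {rmorphism C -> C}); split=> //; last exact: bij_comp.
  by move=> c /=; rewrite !sc.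
- exact: Or31.
- move=> t u [->|->|->] [->|->|->]; do ?[exact: Or31 | exact: Or32 | exact: Or33].
  by apply: Or32; apply/funext => z /=; rewrite s3.
- move=> t u [->|->|->] tu ut.
  + by apply: Or31; apply/funext => z; exact: tu.
  + by apply: Or33; apply/funext => z /=; rewrite -{2}(ut z) s3.
  + by apply: Or32; apply/funext => z /=; rewrite -{2}(ut z) /= s3.
- apply/card_three; exists id, s, (s \o s); split=> //.
  + by move=> /(congr1 (@^~ z0)) /= E; rewrite -E eqxx in sz0.
  + move=> /(congr1 (@^~ (s z0))) /=; rewrite s3 => E.
    by rewrite E eqxx in sz0.
  + move=> /(congr1 (@^~ (s (s z0)))) /=; rewrite s3 => E.
    by rewrite -E eqxx in sz0.
have [Phi PhiE] := frac_lift xT; exists (P1 k), Phi; split; last exact: P1_genus0.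
split; first by move=> c; rewrite [LHS]PhiE evC.
apply/seteqP; split=> [_ [a _ <-] t|z zG].
  suff sa : s (Phi a) = Phi a by move=> [->|->|->] //=; rewrite !sa.
  apply/sx; have [p [q [q0 E]]] := P1_fraction a; exists p, q; split=> //.
  by rewrite -!PhiE -E rmorphM.
have /sx /(ratl_quot xT)[p [q [q0 ->]]] : s z = z by apply: zG; exact: Or32.
by exists (tofrac p / tofrac q) => //; rewrite fmorph_div !PhiE.
Qed.

(** The inclusion of [kummer_same_group] is between groups of order 3: [s1] is not the identity, so
    it is [s2] or its square, and it generates the second group. *)
Lemma kummer_group_eq (s1 s2 : {rmorphism C -> C}) w1 w2 x1 x2 y1 y2 f1 f2 :
  kummer s1 w1 x1 y1 f1 -> kummer s2 w2 x2 y2 f2 -> ratl x1 x2 ->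
  [set t : C -> C | [\/ t = id, t = s1 | t = s1 \o s1]] =
  [set t : C -> C | [\/ t = id, t = s2 | t = s2 \o s2]].
Proof.
move=> K1 K2 x12; have sub := kummer_same_group three K1 K2 x12.
apply/seteqP; split; first exact: sub.
have s2E : s2 \o s2 \o (s2 \o s2) = s2 :> (C -> C).
  by apply/funext => z /=; rewrite (kum_order K2).
have nid : s1 <> id :> (C -> C).
  move=> E; have := kum_gen K1; rewrite E -{1}(mul1r y1) => /(mulIf (kum_neq0 K1)).
  rewrite -(rmorph1 (const C)) => /fmorph_inj /eqP.
  by rewrite eq_sym (negPf (cube_root_neq1 three (kum_root K1))).
have [//|->|E] := sub s1 (Or32 _ _ erefl); first by [].
by move=> t [->|->|->]; [exact: Or31|apply: Or33; rewrite E s2E|exact: Or32].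
Qed.

Lemma special_isomorphic : has_genus C 3 -> special C -> isomorphic C (Y0 k).
Proof.
move=> g3 [G1 [G2 [d1 d2 ne]]].
have [s1 [w1 [x1 [y1 [f1 [pf1 E1]]]]]] := distinguished_picard three g3 d1.
have [s2 [w2 [x2 [y2 [f2 [pf2 E2]]]]]] := distinguished_picard three g3 d2.
have [K1 _ _] := pf1; have [K2 _ _] := pf2.
case: (two_picard_forms two three pf1 pf2) => [x12|x21|[x [c0 [c4 [c00 c40 K]]]]].
- by case: ne; rewrite E1 E2; exact: (kummer_group_eq K1 K2 x12).
- by case: ne; rewrite E1 E2; symmetry; exact: (kummer_group_eq K2 K1 x21).
exact: (kummer_isomorphic_Y0 three c00 c40 K).
Qed.
End Special.

Section Y0Special.
Variables (k : closedFieldType) (three : 3%:R != 0 :> k) (C : curve k) (x y : C).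
Hypothesis xy : Y0_coordinates x y.

Lemma Y0_rotation w : w ^+ 2 + w + 1 = 0 :> k ->
  exists s : {rmorphism C -> C}, [/\ pullback s, s x = x, s y = const C w * y,
    forall z, s (s (s z)) = z & forall z, s z = z <-> ratl x z].
Proof.
move=> wE; have [xT yE dec] := xy; have w3 := cube_root_of_unity wE.
have cw3 : const C w * (const C w * const C w) = 1 by rewrite -!rmorphM; rewrite -[w * (w * w)]/(w ^+ 3) w3 rmorph1.
have wy3 : (const C w * y) ^+ 3 = ev x ('X^4 - 1).
  by rewrite exprMn -rmorphXn w3 rmorph1 mul1r.
have [s [sc sx sy]] := Y0_endo xy xT wy3; exists s; split=> // z.
  apply: (Y0_endo_ext (u := s \o s \o s) (v := idfun) xy) => /=.
  - by move=> c; rewrite /= !sc.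
  - by [].
  - by rewrite !sx.
  by rewrite sy (rmorphM s) sc sy !(rmorphM s) !sc sy -[RHS]mul1r -cw3 -!mulrA.
split; last exact: ratl_endo.
have [a [b [c [[ra rb rc] ->]]]] := dec z.
set u := b * y; set v := c * y ^+ 2.
have sa : s a = a by exact: ratl_endo ra.
have su : s u = const C w * u by rewrite rmorphM (ratl_endo sc xT sx rb) sy mulrCA.
have sv : s v = const C w ^+ 2 * v.
  rewrite rmorphM (ratl_endo sc xT sx rc) rmorphXn sy exprMn mulrCA //.
clearbody u v; rewrite !rmorphD sa su sv -!addrA => /addrI E.
have w1 : const C w != 1 by rewrite -(rmorph1 (const C)) (inj_eq (fmorph_inj _)) (cube_root_neq1 three wE).
have w0 : const C w != 0 by apply: contraNneq w1 => w0; move: cw3; rewrite w0 mul0r => /esym/eqP; rewrite oner_eq0.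
have cwE : const C w ^+ 2 + const C w + 1 = 0.
  by rewrite -rmorphXn -rmorphD -(rmorph1 (const C)) -rmorphD wE rmorph0.
have sW : s (const C w) = const C w by exact: sc.
(* Applying [s] to the relation gives a second one; eliminating [u] between them leaves
   [3 * w * v = 0]. *)
have E2 : const C w * (const C w * u) + const C w ^+ 2 * (const C w ^+ 2 * v) =
    const C w * u + const C w ^+ 2 * v.
  by have := congr1 s E; rewrite !rmorphD !(rmorphM s) !sW su sv.
have v0 : v = 0.
  have c3 : const C 3%:R * const C w != 0 by rewrite mulf_neq0 // fmorph_eq0.
  apply: (mulfI c3); rewrite mulr0 rmorph_nat.
  have {}E2 : const C w * (const C w * u) + const C w ^+ 2 * (const C w ^+ 2 * v) -
      (const C w * u + const C w ^+ 2 * v) = 0 by apply/eqP; rewrite subr_eq0 E2.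
  have E1 : const C w * u + const C w ^+ 2 * v - (u + v) = 0 by apply/eqP; rewrite subr_eq0 E.
  transitivity (const C w * (const C w * u) + const C w ^+ 2 * (const C w ^+ 2 * v) -
      (const C w * u + const C w ^+ 2 * v) - const C w * (const C w * u + const C w ^+ 2 * v - (u + v)) -
      (const C w ^+ 2 + const C w + 1) * (const C w ^+ 2 - 2%:R * const C w) * v); first by ring.
  by rewrite E2 E1 cwE; ring.
have u0 : u = 0.
  apply/eqP; have := E; rewrite v0 mulr0 !addr0 -{2}(mul1r u) => /eqP.
  by rewrite -subr_eq0 -mulrBl mulf_eq0 subr_eq0 (negPf w1).
by rewrite u0 v0 !addr0.
Qed.

(* [C] covers the [y]-line with branch points [-1], [-w], [-w^2] and infinity,
   where [w^2 + w + 1 = 0]; [t] lifts the involution of the line that exchanges [-1]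
   with infinity and [-w] with [-w^2]. *)
Lemma Y0_involution : exists t : {rmorphism C -> C}, exists mu : k,
  [/\ pullback t, mu ^+ 2 = 3%:R, y + 1 != 0, t x = const C mu * x / (y + 1) &
      forall z, t (t z) = z].
Proof.
have [xT yE _] := xy.
have [mu muE] : exists mu : k, mu ^+ 2 = 3%:R.
  have [|mu /rootP] := closed_rootP ('X^2 - (3%:R)%:P : {poly k}) _.
    by rewrite size_XnsubC.
  by rewrite hornerD hornerN hornerXn hornerC => /subr0_eq muE; exists mu.
pose m := const C mu; have mE : m ^+ 2 = 3%:R by rewrite -rmorphXn muE rmorph_nat.
have y3 : y ^+ 3 = x ^+ 4 - 1 by rewrite yE evB evXn ev1 evX.
have c3 : 3%:R != 0 :> C by rewrite -(rmorph_nat (const C)) fmorph_eq0.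
have m0 : m != 0 by apply: contraNneq c3 => m0; rewrite -mE m0 expr0n.
have x0 := transcendental_neq0 xT.
have y10 : y + 1 != 0.
  apply/eqP => /eqP; rewrite addr_eq0 => /eqP yN; move: y3.
  have -> : y ^+ 3 = - 1 by rewrite yN; ring.
  by rewrite -{1}(add0r (- 1)) => /addIr /esym/eqP; rewrite expf_eq0 (negPf x0).
(* The involution of the line is [y' + 1 = 3 / (y + 1)]. Since [(2 - y) ^+ 3 + (y + 1) ^+ 3 = 9 * (y
   ^+ 3 + 1) / (y + 1)], one gets [y' ^+ 3 + 1 = 9 * x ^+ 4 / (y + 1) ^+ 4]. The equation thus asks
   for [mu ^+ 4 = 9]; the choice [mu ^+ 2 = 3] also makes the lift an involution. *)
set x' := m * x / (y + 1); pose y' := (2%:R - y) / (y + 1).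
have y'1 : y' + 1 = 3%:R / (y + 1) by rewrite /y'; field.
have x'y' : y' ^+ 3 = x' ^+ 4 - 1.
  have -> : x' ^+ 4 = (m ^+ 2) ^+ 2 * (y ^+ 3 + 1) / (y + 1) ^+ 4.
    by rewrite y3 subrK /x'; field.
  by rewrite mE /y'; field.
have x'T : transcendental x'.
  have [[c cE]|//] := const_or_transcendental x'.
  have [y'T|[d dE]] : transcendental y' \/ exists d, y' = const C d.
  - by case: (const_or_transcendental y'); [right|left].
  - case: y'T; exists ('X^3 - (c ^+ 4 - 1)%:P); first by rewrite -size_poly_gt0 size_XnsubC.
    rewrite /root -/(ev y' _) evB evXn evX evC x'y' cE.
    by rewrite rmorphB rmorphXn rmorph1 subrr.
  have yc : y = const C (3%:R / (d + 1) - 1).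
    by rewrite rmorphB fmorph_div rmorphD rmorph1 rmorph_nat -dE y'1; field; rewrite y10 c3.
  have xc : x = const C (c * (3%:R / (d + 1)) / mu).
    rewrite !fmorph_div rmorphM fmorph_div rmorphD rmorph1 rmorph_nat -dE y'1 -cE /x' -/m.
    by field; rewrite m0 y10 c3.
  by case: xT; rewrite xc; exact: algebraic_id.
have x'y'E : y' ^+ 3 = ev x' ('X^4 - 1) by rewrite evB evXn ev1 evX.
have [t [tc tx ty]] := Y0_endo xy x'T x'y'E.
exists t, mu; split=> // z; have tm : t m = m by exact: tc.
have ty1 : t y + 1 = 3%:R / (y + 1) by rewrite ty.
apply: (Y0_endo_ext (u := t \o t) (v := idfun) xy) => //=.
- by move=> c; rewrite /= !tc.
- rewrite tx {1}/x' fmorph_div rmorphM tm tx rmorphD rmorph1 ty1 /x'.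
  have -> : m * (m * x / (y + 1)) / (3%:R / (y + 1)) = m ^+ 2 * x / 3%:R by field; rewrite ?y10 c3.
  by rewrite mE; field.
rewrite ty {1}/y' fmorph_div rmorphB rmorph_nat rmorphD rmorph1 ty1 ty /y'.
by field; rewrite ?y10 c3.
Qed.

Lemma Y0_special : special C.
Proof.
have [xT yE _] := xy.
have [w wE] := cube_root_exists k.
have [s [sc sx sy s3 sfix]] := Y0_rotation wE.
have [t [mu [tc muE y10 tx tt]]] := Y0_involution.
have y0 : y != 0.
  apply/eqP=> y0; have /eqP := yE; rewrite y0 expr0n /= eq_sym ev_eq0 //.
  by rewrite -size_poly_eq0 size_XnsubC.
have w1 : const C w != 1.
  by rewrite -(rmorph1 (const C)) (inj_eq (fmorph_inj _)) (cube_root_neq1 three wE).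
have sy' : s y != y by rewrite sy -subr_eq0 -{2}(mul1r y) -mulrBl mulf_neq0 // subr_eq0.
pose s' : {rmorphism C -> C} := t \o s \o t.
have txT : transcendental (t x) by exact: (pullback_transcendental (phi := t)).
exists [set u : C -> C | [\/ u = id, u = s | u = s \o s]],
  [set u : C -> C | [\/ u = id, u = s' | u = s' \o s']]; split.
- by apply: order3_distinguished sfix => //; exists y.
- apply: order3_distinguished txT _ => [c|z||z].
  + by rewrite /= tc sc tc.
  + by rewrite /= !tt s3 tt.
  + by exists (t y); rewrite /= tt (inj_eq (fmorph_inj t)).
  split=> /= [E|/(pullback_ratl (phi := t) tc)].
    have /sfix /(pullback_ratl (phi := t) tc) : s (t z) = t z by rewrite -[RHS](congr1 t E) tt.
    by rewrite tt.
  by rewrite tt => /sfix ->; rewrite tt.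
move=> E.
(* If the groups were equal, [s] would fix [t x], as its conjugate [s'] does; but [t x] is
   [mu * x / (y + 1)], and [s] fixes [x] and moves [y]. *)
have s'tx : s' (t x) = t x by rewrite /= tt sx.
have : s (t x) = t x.
  have : [set u : C -> C | [\/ u = id, u = s' | u = s' \o s']] s by rewrite -E; exact: Or32.
  move=> [->|->|->]; [by []|exact: s'tx|].
  by rewrite -[LHS]/(s' (s' (t x))) !s'tx.
have mu0 : const C mu != 0.
  rewrite fmorph_eq0; apply: contraNneq three => mu0.
  by rewrite -muE mu0 expr0n.
rewrite tx fmorph_div !rmorphM sc sx rmorphD rmorph1.
move/(mulfI (mulf_neq0 mu0 (transcendental_neq0 xT)))/invr_inj/addIr => E'.
by rewrite E' eqxx in sy'.
Qed.
End Y0Special.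

Theorem lemma1p17 (K : fieldType) (char_neq2 : 2%N \notin [pchar K])
    (char_neq3 : 3%N \notin [pchar K])
    (Kbar : closedFieldType) (iota : {rmorphism K -> Kbar})
    (Kbar_closure : algebraic_closure iota)
    (Y : curve K) (Ybar : curve Kbar) (j : base_change iota Y Ybar)
    (Y_picard : picard_curve j) :
  special Ybar <-> isomorphic Ybar (Y0 Kbar).
Proof.
have unit_bar n : prime n -> n \notin [pchar K] -> n%:R != 0 :> Kbar.
  move=> np nK; rewrite -(rmorph_nat iota) fmorph_eq0.
  by apply: contra nK => nE; rewrite inE np.
have two := unit_bar 2%N isT char_neq2; have three := unit_bar 3%N isT char_neq3.
have [sm g3 _] := Y_picard; split.
  by apply: special_isomorphic => //; exact: has_genus_base_change sm g3.
by move=> /isomorphic_Y0P[x [y xy]]; exact: (Y0_special three xy).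
Qed.
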